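(* Let $P\subset\mathbb{R}^d$ be a closed convex cone with $P-P=\mathbb{R}^d$ and $P\cap(-P)=\{0\}$. Let $(Y,\mathcal{B})$ be a measurable space with $\mathcal{B}$ countably generated, on which $\mathbb{R}^d$ acts measurably, let $\lambda$ be an $\mathbb{R}^d$-invariant $\sigma$-finite measure on $Y$, and let $X\in\mathcal{B}$ satisfy $X+a\subset X$ for all $a\in P$ and $\bigcap_{a\in P}(X+a)=\emptyset$. Let $\eta$ be a Poisson process on $Y$ with intensity measure $\lambda$, let $E$ be the product system over $P$ associated to $\eta$ (and $X$), and let $V=(V_a)_{a\in P}$ be the semigroup of isometries on $L^2(X,\lambda)$ given by $V_a(f)(y)=f(y-a)$ if $y-a\in X$ and $V_a(f)(y)=0$ if $y-a\notin X$. Then $E$ is isomorphic to the product system of the CCR flow associated to the isometric representation $V$. More precisely, the maps determined by $$\Gamma\big(L^2(X\setminus(X+a))\big)\ni e(f)\mapsto \Sigma_f\in E(a),\qquad f\in L^2(X\setminus(X+a)),\ a\in P,$$ provide an isomorphism from the product system associated to $V$ onto $E$.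
   Context: All probability spaces and sub-$\sigma$-algebras are complete; ''generated by random variables'' means the smallest complete $\sigma$-algebra making them measurable. For $a,b\in P$, $a\le b$ means $b-a\in P$. The action of $\mathbb{R}^d$ on $Y$ is written additively. Inner products are linear in the first variable. Poisson process: with $\overline{\mathbb{N}}=\{0,1,2,\dots\}\cup\{\infty\}$, a point process on $Y$ is a measurable map $\eta$ from a probability space $(\Omega,\mathcal{F},\mathbb{P})$ to the $\overline{\mathbb{N}}$-valued $\sigma$-finite measures on $Y$ (with the smallest $\sigma$-algebra making each $\mu\mapsto\mu(B)$ measurable). It is a Poisson process with intensity $\lambda$ if each $\eta(B)$ is Poisson with parameter $\lambda(B)$ (a.s. $\infty$ if $\lambda(B)=\infty$) and $\eta(B_1),\dots,\eta(B_n)$ are independent for disjoint $B_i\in\mathcal{B}$. It is assumed that $\mathcal{F}$ is generated by $\{\eta(B):B\in\mathcal{B}\}$. Write $\eta(u)=\int u\,d\eta$. The product system $E$: for $a\le b$ in $P$ let $\mathcal{F}_{a,b}$ be generated by $\{\eta(B):B\in\mathcal{B},\ B\subset(X+a)\setminus(X+b)\}$ and $\mathcal{F}_a=\mathcal{F}_{0,a}$. For $c\in P$ let $S_c:L^2(\Omega,\mathcal{F}_{a,b},\mathbb{P})\to L^2(\Omega,\mathcal{F}_{a+c,b+c},\mathbb{P})$ be the unitary with $S_c(f(\eta(B_1),\dots,\eta(B_n)))=f(\eta(B_1+c),\dots,\eta(B_n+c))$. Then $E=\{(a,f):a\in P,\ f\in L^2(\Omega,\mathcal{F}_a,\mathbb{P})\}$,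 a Borel subset of $P\times L^2(\Omega,\mathcal{F},\mathbb{P})$ with the inherited measurable structure, fibres $E(a)=L^2(\Omega,\mathcal{F}_a,\mathbb{P})$ and product $(a,f)(b,g)=(a+b,fS_a(g))$. The vectors $\Sigma_f$: fix a measurable $\ell:\mathbb{C}\setminus\{0\}\to\mathbb{C}$ with $e^{\ell(z)}=z$ for all $z$ and $\ell(x)=\log x$ for $x>0$. Let $\mathcal{S}$ be the set of complex-valued square integrable simple functions $f$ on $X$ with $f(x)\ne-1$ for all $x\in X$. For $f\in\mathcal{S}$ put $u_f(x)=\ell(1+f(x))$ and $\Sigma_f=e^{\eta(u_f)}/\mathbb{E}(e^{\eta(u_f)})$. One has $\mathbb{E}(\Sigma_f\overline{\Sigma_g})=\exp(\int f\overline{g}\,d\lambda)$ for $f,g\in\mathcal{S}$. For general $f\in L^2(X,\lambda)$, $\Sigma_f$ is the $L^2(\Omega,\mathcal{F},\mathbb{P})$-limit of $\Sigma_{f_n}$ for any sequence $f_n\in\mathcal{S}$ with $f_n\to f$ in $L^2(X,\lambda)$ (the limit exists and is independent of the sequence). If $f\in L^2(X\setminus(X+a))$ (extended by $0$) then $\Sigma_f\in L^2(\Omega,\mathcal{F}_a,\mathbb{P})$. CCR flow: $\Gamma(H)$ is the symmetric Fock space of $H$, with exponential vectors $e(\xi)$, $\langle e(\xi)|e(\zeta)\rangle=e^{\langle\xi|\zeta\rangle}$. For a strongly continuous semigroup of isometries $V=(V_a)_{a\in P}$ on a separable Hilbert space $H$, the CCR flow associated to $V$ is the $E_0$-semigroup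 $\alpha$ on $B(\Gamma(H))$ with $\alpha_a(W(\xi))=W(V_a\xi)$, where $W(\cdot)$ are the Weyl operators. Its product system is identified with the one having fibres $\Gamma(\ker V_a^* )\subset\Gamma(H)$, $a\in P$, the measurable structure inherited from $P\times\Gamma(H)$, and multiplication determined by $e(\xi)\cdot e(\zeta)=e(\xi+V_a\zeta)$ for $\xi\in\ker V_a^*$, $\zeta\in\ker V_b^*$. For the $V$ of the claim, $\ker V_a^*=L^2(X\setminus(X+a))$. An isomorphism of product systems over $P$ is a Borel isomorphism that maps fibres unitarily onto corresponding fibres and preserves multiplication. *)

(* Defs.v *)
From HB Require Import structures.
From mathcomp Require Import all_boot all_order all_algebra generic_quotient.
From mathcomp Require Import perm.
From mathcomp Require Import complex.
From mathcomp Require Import all_classical all_reals all_analysis.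
From mathcomp Require Import measurable_realfun.

Set Implicit Arguments.
Unset Strict Implicit.
Unset Printing Implicit Defensive.

Import Order.TTheory GRing.Theory Num.Theory.
Import numFieldNormedType.Exports.

Local Open Scope classical_set_scope.
Local Open Scope ring_scope.
Local Open Scope complex_scope.
Local Open Scope quotient_scope.

Section complex_functions.
Context d (T : measurableType d) (R : realType).
Implicit Types (mu : {measure set T -> \bar R}) (f : T -> R[i]).

Definition Cintegral mu (D : set T) f : R[i] :=
  Rintegral mu D (@complex.Re R \o f) +i* Rintegral mu D (@complex.Im R \o f).

Definition sqintegrable mu f : bool :=
  (@complex.Re R \o f \in Lfun mu 2%:E) && (@complex.Im R \o f \in Lfun mu 2%:E).

End complex_functions.

Definition Cexp (R : realType) (z : R[i]) : R[i] :=
  (expR (complex.Re z))%:C * (cos (complex.Im z) +i* sin (complex.Im z)).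

Section L2_def.
Context d (T : measurableType d) (R : realType) (mu : {measure set T -> \bar R}).

Definition L2fun := {f : T -> R[i] | sqintegrable mu f}.

Definition L2ae (f g : L2fun) : bool :=
  `[< {ae mu, forall x, val f x = val g x} >].

Let L2ae_refl : reflexive L2ae.
Proof. by move=> f; apply/asboolP; apply: aeW. Qed.

Let L2ae_sym : symmetric L2ae.
Proof.
by move=> f g; apply/asboolP/asboolP; apply: filterS => x ->.
Qed.

Let L2ae_trans : transitive L2ae.
Proof.
move=> f g h /asboolP gf /asboolP fh; apply/asboolP.
by apply: filterS2 gf fh => x -> ->.
Qed.

Canonical L2ae_canonical := EquivRel L2ae L2ae_refl L2ae_sym L2ae_trans.

Definition L2 : Type := {eq_quot L2ae}.
HB.instance Definition _ := Choice.on L2.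
HB.instance Definition _ := EqQuotient.on L2.

Lemma L2_eqP (f g : L2fun) :
  \pi_L2 f = \pi_L2 g <-> {ae mu, forall x, val f x = val g x}.
Proof. by split => [/eqmodP/asboolP|h]; last exact/eqmodP/asboolP. Qed.

Lemma sqintegrable0 : sqintegrable mu (fun=> 0).
Proof.
have l0 : (cst 0 : T -> R) \in Lfun mu 2%:E.
  exact: (Lfun_submod_closed mu (lee1n 2)).1.
by apply/andP; split.
Qed.

Let LfunDZ (a : R) (f g : T -> R) : f \in Lfun mu 2%:E -> g \in Lfun mu 2%:E ->
  (fun x => a * f x + g x) \in Lfun mu 2%:E.
Proof. by move=> hf hg; exact: (Lfun_submod_closed mu (lee1n 2)).2. Qed.

Let LfunZ (a : R) (f : T -> R) : f \in Lfun mu 2%:E ->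
  (fun x => a * f x) \in Lfun mu 2%:E.
Proof.
move=> hf; have [l0 _] := Lfun_submod_closed mu (lee1n 2).
have := LfunDZ a hf l0.
suff -> : (fun x => a * f x + 0 x) = (fun x => a * f x) by [].
by apply/funext => x; rewrite addr0.
Qed.

Lemma sqintegrableD (f g : T -> R[i]) : sqintegrable mu f -> sqintegrable mu g ->
  sqintegrable mu (fun x => f x + g x).
Proof.
move=> /andP[f1 f2] /andP[g1 g2]; apply/andP; split.
- rewrite (_ : _ \o _ = fun x => 1 * complex.Re (f x) + complex.Re (g x)).
    exact: LfunDZ.
  by apply/funext => x /=; rewrite mul1r; case: (f x) (g x) => [? ?] [? ?].
- rewrite (_ : _ \o _ = fun x => 1 * complex.Im (f x) + complex.Im (g x)).
    exact: LfunDZ.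
  by apply/funext => x /=; rewrite mul1r; case: (f x) (g x) => [? ?] [? ?].
Qed.

Lemma sqintegrableZ (c : R[i]) (f : T -> R[i]) : sqintegrable mu f ->
  sqintegrable mu (fun x => c * f x).
Proof.
case: c => a b /andP[f1 f2]; apply/andP; split.
- rewrite (_ : _ \o _ =
      fun x => a * complex.Re (f x) + (- b) * complex.Im (f x)).
    by apply: LfunDZ => //; exact: LfunZ.
  by apply/funext => x /=; case: (f x) => ? ? /=; rewrite mulNr.
- rewrite (_ : _ \o _ = fun x => a * complex.Im (f x) + b * complex.Re (f x)).
    by apply: LfunDZ => //; exact: LfunZ.
  by apply/funext => x /=; case: (f x).
Qed.

(* The class of [f], or [0] if [f] is not square integrable. *)
Definition toL2 (f : T -> R[i]) : L2 :=
  \pi_L2 (insubd (Sub (fun=> 0) sqintegrable0 : L2fun) f).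

Definition fun_of_L2 (f : L2) : T -> R[i] := val (repr f).

Lemma sqintegrable_L2 (f : L2) : sqintegrable mu (fun_of_L2 f).
Proof. exact: (valP (repr f)). Qed.

Lemma toL2K (f : L2) : toL2 (fun_of_L2 f) = f.
Proof. by rewrite /toL2 /fun_of_L2 valKd reprK. Qed.

Lemma fun_toL2 (f : T -> R[i]) : sqintegrable mu f ->
  {ae mu, forall x, fun_of_L2 (toL2 f) x = f x}.
Proof.
move=> hf; have : \pi_L2 (repr (toL2 f)) = toL2 f by rewrite reprK.
by move/L2_eqP; rewrite insubdK.
Qed.

Lemma toL2_ae (f g : T -> R[i]) : sqintegrable mu f -> sqintegrable mu g ->
  {ae mu, forall x, f x = g x} -> toL2 f = toL2 g.
Proof. by move=> hf hg fg; apply/L2_eqP; rewrite !insubdK. Qed.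

Definition L2add (f g : L2) := toL2 (fun x => fun_of_L2 f x + fun_of_L2 g x).
Definition L2scale (c : R[i]) (f : L2) := toL2 (fun x => c * fun_of_L2 f x).
Definition L2opp (f : L2) := L2scale (-1) f.
Definition L2zero : L2 := toL2 (fun=> 0).

Lemma L2addA : associative L2add.
Proof.
move=> f g h; apply: toL2_ae.
- by apply: sqintegrableD; exact: sqintegrable_L2.
- by apply: sqintegrableD; exact: sqintegrable_L2.
have := fun_toL2 (sqintegrableD (sqintegrable_L2 f) (sqintegrable_L2 g)).
have := fun_toL2 (sqintegrableD (sqintegrable_L2 g) (sqintegrable_L2 h)).
by apply: filterS2 => x -> ->; rewrite addrA.
Qed.

Lemma L2addC : commutative L2add.
Proof.
by move=> f g; congr toL2; apply/funext => x; rewrite addrC.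
Qed.

Lemma L2add0 : left_id L2zero L2add.
Proof.
move=> f; rewrite -[RHS]toL2K; apply: toL2_ae.
- by apply: sqintegrableD; exact: sqintegrable_L2.
- exact: sqintegrable_L2.
by have := fun_toL2 sqintegrable0; apply: filterS => x ->; rewrite add0r.
Qed.

Lemma L2addN : left_inverse L2zero L2opp L2add.
Proof.
move=> f; apply: toL2_ae.
- by apply: sqintegrableD; exact: sqintegrable_L2.
- exact: sqintegrable0.
have := fun_toL2 (sqintegrableZ (-1) (sqintegrable_L2 f)).
by apply: filterS => x ->; rewrite mulN1r addNr.
Qed.

HB.instance Definition _ :=
  GRing.isZmodule.Build L2 L2addA L2addC L2add0 L2addN.

Lemma L2scaleA (a b : R[i]) (f : L2) : L2scale a (L2scale b f) = L2scale (a * b) f.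
Proof.
apply: toL2_ae; do ?[by apply: sqintegrableZ; exact: sqintegrable_L2].
have := fun_toL2 (sqintegrableZ b (sqintegrable_L2 f)).
by apply: filterS => x ->; rewrite mulrA.
Qed.

Lemma L2scale1 : left_id 1 L2scale.
Proof.
move=> f; rewrite -[RHS]toL2K; congr toL2.
by apply/funext => x; rewrite mul1r.
Qed.

Lemma L2scaleDr : right_distributive L2scale +%R.
Proof.
move=> a f g; apply: toL2_ae.
- by apply: sqintegrableZ; exact: sqintegrable_L2.
- by apply: sqintegrableD; exact: sqintegrable_L2.
have := fun_toL2 (sqintegrableD (sqintegrable_L2 f) (sqintegrable_L2 g)).
have := fun_toL2 (sqintegrableZ a (sqintegrable_L2 f)).
have := fun_toL2 (sqintegrableZ a (sqintegrable_L2 g)).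
by apply: filterS3 => x -> -> ->; rewrite mulrDr.
Qed.

Lemma L2scaleDl (f : L2) : {morph L2scale^~ f : a b / a + b}.
Proof.
move=> a b; apply: toL2_ae.
- by apply: sqintegrableZ; exact: sqintegrable_L2.
- by apply: sqintegrableD; exact: sqintegrable_L2.
have := fun_toL2 (sqintegrableZ a (sqintegrable_L2 f)).
have := fun_toL2 (sqintegrableZ b (sqintegrable_L2 f)).
by apply: filterS2 => x -> ->; rewrite mulrDl.
Qed.

HB.instance Definition _ := GRing.Zmodule_isLmodule.Build R[i] L2
  L2scaleA L2scale1 L2scaleDr L2scaleDl.

Definition dot (f g : L2) : R[i] :=
  Cintegral mu setT (fun x => fun_of_L2 f x * (fun_of_L2 g x)^*).

Definition L2norm (f : L2) : R := Num.sqrt (complex.Re (dot f f)).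

End L2_def.

(* The full Fock space of [L2 mu] is realised as L^2 of the disjoint union of
   the spaces (T^n, mu^n), n >= 0; points of that union are finite sequences. *)

Definition fin_seq (T : Type) : Type := seq T.

Section fin_seq_measurable.
Context d (T : measurableType d).

HB.instance Definition _ := Choice.on (fin_seq T).
HB.instance Definition _ := isPointed.Build (fin_seq T) [::].

Definition fin_seq_measurable : set (set (fin_seq T)) :=
  [set A | forall n, measurable [set t : n.-tuple T | A (tval t)]].

Let fsm0 : fin_seq_measurable set0.
Proof. by move=> n; exact: measurable0. Qed.

Let fsmC A : fin_seq_measurable A -> fin_seq_measurable (~` A).
Proof. by move=> mA n; exact: (measurableC (mA n)). Qed.

Let fsmU (F : (set (fin_seq T))^nat) :
  (forall i, fin_seq_measurable (F i)) -> fin_seq_measurable (\bigcup_i F i).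
Proof.
move=> mF n; rewrite (_ : mkset _ =
    \bigcup_i [set t : n.-tuple T | F i (tval t)]).
  by apply: bigcup_measurable => i _; exact: mF.
by apply/seteqP; split => t [i _ Fi]; exists i.
Qed.

HB.instance Definition _ :=
  @isMeasurable.Build d (fin_seq T) fin_seq_measurable fsm0 fsmC fsmU.

Definition seq_of_tuple n (t : n.-tuple T) : fin_seq T := tval t.

Lemma measurable_seq_of_tuple n : measurable_fun setT (@seq_of_tuple n).
Proof. by move=> _ A mA; rewrite setTI; exact: mA. Qed.

Definition cons_pair n (p : T * n.-tuple T) : n.+1.-tuple T :=
  [tuple of p.1 :: p.2].

Lemma measurable_cons_pair n : measurable_fun setT (@cons_pair n).
Proof. exact: measurable_cons. Qed.

Definition uncons n (t : n.+1.-tuple T) : T * n.-tuple T :=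
  (thead t, [tuple of behead t]).

Lemma measurable_uncons n : measurable_fun setT (@uncons n).
Proof.
by apply: measurable_fun_pair; [exact: measurable_tnth|exact: measurable_behead].
Qed.

Lemma cons_pairK n : cancel (@cons_pair n) (@uncons n).
Proof. by move=> [x t]; congr pair; exact/val_inj. Qed.

End fin_seq_measurable.

Section product_power.
Context d (T : measurableType d) (R : realType).
Variable mu : {sigma_finite_measure set T -> \bar R}.

Section cons_measure.
Context n (nu : {sigma_finite_measure set (n.-tuple T) -> \bar R}).
Local Open Scope ereal_scope.

Definition cons_measure : set (n.+1.-tuple T) -> \bar R :=
  pushforward (mu \x nu) (@cons_pair _ T n).

HB.instance Definition _ := Measure.copy cons_measure
  (measure_function_pushforward__canonical__measure_function_Measure
    (mu \x nu) (measurable_cons_pair (n := n))).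

Let cons_measure_sigma_finite : sigma_finite setT cons_measure.
Proof.
have /sigma_finiteP[F [FT ndF Foo]] := sigma_finiteT mu.
have /sigma_finiteP[G [GT ndG Goo]] := sigma_finiteT nu.
exists (fun k => @uncons _ T n @^-1` (F k `*` G k)).
  rewrite -preimage_bigcup -[LHS](preimage_setT (@uncons _ T n)); congr (_ @^-1` _).
  apply/esym/seteqP; split => // -[x t] _.
  have : [set: T] x by []. have : [set: n.-tuple T] t by [].
  rewrite [in X in X -> _]GT [in X in _ -> X -> _]FT => -[j _ Gj] [i _ Fi].
  exists (maxn i j) => //; split => /=.
    by move: x Fi; exact/subsetPset/ndF/leq_maxl.
  by move: t Gj; exact/subsetPset/ndG/leq_maxr.
move=> k; have [mF Fk] := Foo k; have [mG Gk] := Goo k; split.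
  rewrite -[X in measurable X]setTI; apply: measurable_uncons => //.
  exact: measurableX.
rewrite /cons_measure /pushforward (_ : _ @^-1` _ = F k `*` G k).
  by rewrite product_measure1E// lte_mul_pinfty// ge0_fin_numE.
by rewrite -comp_preimage (_ : _ \o _ = id)//; exact/funext/cons_pairK.
Qed.

HB.instance Definition _ :=
  Measure_isSigmaFinite.Build _ _ _ cons_measure cons_measure_sigma_finite.

End cons_measure.

Fixpoint tuple_measure n : {sigma_finite_measure set (n.-tuple T) -> \bar R} :=
  if n is n'.+1 then cons_measure (tuple_measure n')
  else dirac ([tuple] : 0.-tuple T).

(* The sum over n of the measures mu^n on the disjoint union of the T^n. *)
Definition fock_measure : {measure set (fin_seq T) -> \bar R} :=
  mseries (fun n => measure_function_pushforward__canonical__measure_function_Measure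
    (tuple_measure n) (measurable_seq_of_tuple (n := n))) 0.

End product_power.

Section L2_subspaces.
Context d (T : measurableType d) (R : realType) (mu : {measure set T -> \bar R}).

Definition subspace (K : set (L2 mu)) : Prop :=
  K 0 /\ forall (c : R[i]) f g, K f -> K g -> K (c *: f + g).

Definition L2closed (K : set (L2 mu)) : Prop :=
  forall f, (forall eps : R, 0 < eps -> exists2 g, K g & L2norm (f - g) < eps) ->
  K f.

Definition L2open (U : set (L2 mu)) : Prop :=
  forall f, U f ->
  exists2 r : R, 0 < r & forall g, L2norm (g - f) < r -> U g.

Definition closed_span (S : set (L2 mu)) : set (L2 mu) :=
  smallest [set K | subspace K /\ L2closed K] S.

Definition L2cvg (f_ : nat -> L2 mu) (f : L2 mu) : Prop :=
  (fun n => L2norm (f_ n - f)) @ \oo --> (0 : R).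

(* L^2(D, mu), extended by 0. *)
Definition L2on (D : set T) : set (L2 mu) :=
  [set f | {ae mu, forall x, ~ D x -> fun_of_L2 f x = 0}].

End L2_subspaces.
Arguments L2on {d T R} mu D _.

Section L2_maps.
Context d1 (T1 : measurableType d1) d2 (T2 : measurableType d2) (R : realType).
Context (mu1 : {measure set T1 -> \bar R}) (mu2 : {measure set T2 -> \bar R}).

Definition linear_on (K : set (L2 mu1)) (S : L2 mu1 -> L2 mu2) : Prop :=
  forall (c : R[i]) f g, K f -> K g -> S (c *: f + g) = c *: S f + S g.

Definition bounded_on (K : set (L2 mu1)) (S : L2 mu1 -> L2 mu2) : Prop :=
  exists M : R, forall f, K f -> L2norm (S f) <= M * L2norm f.

Definition unitary_on (K1 : set (L2 mu1)) (K2 : set (L2 mu2))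
    (S : L2 mu1 -> L2 mu2) : Prop :=
  [/\ S @` K1 = K2, linear_on K1 S
    & forall f g, K1 f -> K1 g -> dot (S f) (S g) = dot f g].

End L2_maps.

(* A product system is given by its fibres, subspaces of one L^2 space, and its
   multiplication, whose values matter on the fibres only. *)

Section product_systems.
Context (R : realType) (n : nat).
Local Notation G := 'rV[R]_n.

Record prodsys := Prodsys {
  ps_display : measure_display;
  ps_type : measurableType ps_display;
  ps_measure : {measure set ps_type -> \bar R};
  ps_fibre : G -> set (L2 ps_measure);
  ps_mul : G -> G -> L2 ps_measure -> L2 ps_measure -> L2 ps_measure
}.

Variable P : set G.

Definition ps_total (E : prodsys) : set (G * L2 (ps_measure E)) :=
  [set p | P p.1 /\ ps_fibre p.1 p.2].
Arguments ps_total : clear implicits.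

(* The measurable subsets of the total space: the traces on it of the sets in
   the product of the Borel sigma-algebras of R^n and of the ambient space. *)
Definition ps_measurable (E : prodsys) : set (set (G * L2 (ps_measure E))) :=
  [set W | exists2 M, <<s [set A `*` U | A in open & U in @L2open _ _ _ (ps_measure E)] >> M
                    & W = M `&` ps_total E].
Arguments ps_measurable : clear implicits.

Definition ps_iso (E F : prodsys)
    (Theta : G -> L2 (ps_measure E) -> L2 (ps_measure F)) : Prop :=
  let total p := (p.1, Theta p.1 p.2) in
  [/\ forall a, P a -> unitary_on (@ps_fibre E a) (@ps_fibre F a) (Theta a),
      forall a b f g, P a -> P b -> ps_fibre a f -> ps_fibre b g ->
        Theta (a + b) (ps_mul a b f g) = ps_mul a b (Theta a f) (Theta b g),
      forall W, ps_measurable F W ->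
        ps_measurable E (total @^-1` W `&` ps_total E)
    & forall W, ps_measurable E W -> ps_measurable F (total @` W)].

End product_systems.

Section fock_space.
Context d (T : measurableType d) (R : realType).
Context (mu : {sigma_finite_measure set T -> \bar R}).

(* The orthogonal projection of x_0 (x) ... (x) x_{n-1} on symmetric tensors. *)
Definition sym_tensor n (x : 'I_n -> L2 mu) : L2 (fock_measure mu) :=
  toL2 (fock_measure mu) (fun s : fin_seq T =>
    if insub s is Some t then
      n`!%:R^-1 * \sum_(sigma : 'S_n) \prod_(i < n)
        fun_of_L2 (x i) (tnth (t : n.-tuple T) (sigma i))
    else 0).

(* The exponential vector: the sum of the xi^{(x) n} / sqrt (n!). *)
Definition expvec (xi : L2 mu) : L2 (fock_measure mu) :=
  toL2 (fock_measure mu) (fun s : fin_seq T =>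
    (Num.sqrt (size s)`!%:R : R)^-1%:C * \prod_(y <- s) fun_of_L2 xi y).

Definition fock (K : set (L2 mu)) : set (L2 (fock_measure mu)) :=
  closed_span [set F | exists n (x : 'I_n -> L2 mu),
    (forall i, K (x i)) /\ F = sym_tensor x].

End fock_space.

Section ccr.
Context d (T : measurableType d) (R : realType) (n : nat).
Context (mu : {sigma_finite_measure set T -> \bar R}).
Context (H : set (L2 mu)) (V : 'rV[R]_n -> L2 mu -> L2 mu).

(* The kernel of the adjoint of [V a] seen as an operator on H. *)
Definition ker_adjoint (a : 'rV[R]_n) : set (L2 mu) :=
  [set f | H f /\ forall g, H g -> dot (V a g) f = dot g 0].

Definition ccr_fibre a := fock (ker_adjoint a).

(* The third clause says that [m] induces an isometry on the tensor product of
   the fibres. *)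
Definition is_ccr_mul a b
    (m : L2 (fock_measure mu) -> L2 (fock_measure mu) -> L2 (fock_measure mu))
    : Prop :=
  [/\ forall f, ccr_fibre a f -> linear_on (ccr_fibre b) (m f),
      forall g, ccr_fibre b g -> linear_on (ccr_fibre a) (m^~ g),
      forall f g f' g', ccr_fibre a f -> ccr_fibre b g ->
        ccr_fibre a f' -> ccr_fibre b g' ->
        dot (m f g) (m f' g') = dot f f' * dot g g'
    & forall xi zeta, ker_adjoint a xi -> ker_adjoint b zeta ->
        m (expvec xi) (expvec zeta) = expvec (xi + V a zeta)].

(* Determined by [is_ccr_mul] on the fibres; its other values are irrelevant. *)
Definition ccr_mul a b := xget (fun _ _ => 0) (is_ccr_mul a b).

Definition ccr_prodsys : prodsys R n :=
  @Prodsys R n _ _ (fock_measure mu) ccr_fibre ccr_mul.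

End ccr.

Section poisson.
Context dY (Y : measurableType dY) dO (Omega : measurableType dO) (R : realType).
Context (Pr : probability Omega R) (eta : R.-ker Omega ~> Y).
Implicit Types (lam : {measure set Y -> \bar R}) (B : set Y).

(* A kernel is a family of measures [eta w] for which all the functions
   [eta ^~ B] are measurable. *)
Definition point_process : Prop :=
  forall w, sigma_finite setT (eta w) /\
  forall B, measurable B -> eta w B = +oo%E \/ exists k : nat, eta w B = k%:R%:E.

Definition poisson_law lam : Prop :=
  forall B, measurable B ->
  (lam B = +oo%E -> {ae Pr, forall w, eta w B = +oo%E}) /\
  (forall r : R, lam B = r%:E -> forall k : nat,
     Pr [set w | eta w B = k%:R%:E] = (expR (- r) * r ^+ k / k`!%:R)%:E).

Definition independent_increments : Prop :=
  forall n (B : 'I_n -> set Y) (U : 'I_n -> set (\bar R)),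
  (forall i, measurable (B i)) -> trivIset setT B ->
  (forall i, measurable (U i)) ->
  Pr (\bigcap_(i in setT) [set w | U i (eta w (B i))]) =
    (\prod_(i < n) Pr [set w | U i (eta w (B i))])%E.

Definition poisson_process lam : Prop :=
  [/\ point_process, poisson_law lam & independent_increments].

(* The complete sigma-algebra generated by the eta(B), B a measurable subset of
   D; complete means containing all the Pr-negligible sets. *)
Definition sigma_eta (D : set Y) : set (set Omega) :=
  <<s [set [set w | U (eta w B)] | B in [set B | measurable B /\ B `<=` D]
                                 & U in measurable] `|` Pr.-negligible >>.

Definition L2sub (F : set (set Omega)) : set (L2 Pr) :=
  [set f | exists h : Omega -> R[i],
    [/\ sqintegrable Pr h,
        forall U : set R, measurable U -> F [set w | U (complex.Re (h w))],
        forall U : set R, measurable U -> F [set w | U (complex.Im (h w))]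
      & f = toL2 Pr h]].

End poisson.

Section poisson_product_system.
Context (R : realType) (n : nat).
Context dY (Y : measurableType dY) (act : 'rV[R]_n -> Y -> Y).
Context (lam : {sigma_finite_measure set Y -> \bar R}) (X : set Y).
Context dO (Omega : measurableType dO).
Context (Pr : probability Omega R) (eta : R.-ker Omega ~> Y).
Local Notation G := 'rV[R]_n.
Implicit Types (a b c : G).

Definition translate a (B : set Y) : set Y := act a @` B.

Definition sigma_interval a b : set (set Omega) :=
  sigma_eta Pr eta (translate a X `\` translate b X).

(* [is_shift c a b S] : S is the unitary S_c from L^2(F_{a,b}) onto
   L^2(F_{a+c,b+c}). *)
Definition is_shift c a b (S : L2 Pr -> L2 Pr) : Prop :=
  unitary_on (L2sub (sigma_interval a b))
             (L2sub (sigma_interval (a + c) (b + c))) S /\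
  forall k (B : 'I_k -> set Y) (phi : ('I_k -> \bar R) -> R[i]),
    (forall i, measurable (B i)) ->
    (forall i, B i `<=` translate a X `\` translate b X) ->
    sqintegrable Pr (fun w => phi (fun i => eta w (B i))) ->
    S (toL2 Pr (fun w => phi (fun i => eta w (B i)))) =
      toL2 Pr (fun w => phi (fun i => eta w (translate c (B i)))).

(* Determined by [is_shift] on L^2(F_{a,b}); its other values are irrelevant. *)
Definition shift c a b : L2 Pr -> L2 Pr := xget (fun _ => 0) (is_shift c a b).

Definition eta_fibre a : set (L2 Pr) := L2sub (sigma_interval 0 a).

Definition eta_mul a b (f g : L2 Pr) : L2 Pr :=
  toL2 Pr (fun w => fun_of_L2 f w * fun_of_L2 (shift a 0 b g) w).

Definition eta_prodsys : prodsys R n := @Prodsys R n _ _ Pr eta_fibre eta_mul.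

Definition translation a (f : L2 lam) : L2 lam :=
  toL2 lam (fun y => if act (- a) y \in X then fun_of_L2 f (act (- a) y) else 0).

(* A measurable logarithm on C \ {0}, identified with R^2 \ {0}. *)
Definition log_branch (ell : R[i] -> R[i]) : Prop :=
  [/\ measurable_fun [set p : R * R | p <> (0, 0)]
        (fun p => complex.Re (ell (p.1 +i* p.2))),
      measurable_fun [set p : R * R | p <> (0, 0)]
        (fun p => complex.Im (ell (p.1 +i* p.2))),
      forall z, z <> 0 -> Cexp (ell z) = z
    & forall x : R, 0 < x -> ell x%:C = (ln x)%:C].

Variable ell : R[i] -> R[i].

(* Square integrable simple functions on X (extended by 0) avoiding -1. *)
Definition simpleS : set (Y -> R[i]) :=
  [set f | [/\ sqintegrable lam f, finite_set (range f),
               forall y, ~ X y -> f y = 0 & forall y, X y -> f y <> -1]].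

Definition exp_eta (f : Y -> R[i]) (w : Omega) : R[i] :=
  Cexp (Cintegral (eta w) X (fun y => ell (1 + f y))).

Definition Sigma_simple (f : Y -> R[i]) : L2 Pr :=
  toL2 Pr (fun w => exp_eta f w / Cintegral Pr setT (exp_eta f)).

Definition is_Sigma (f : L2 lam) (g : L2 Pr) : Prop :=
  forall f_ : nat -> Y -> R[i], (forall k, simpleS (f_ k)) ->
  L2cvg (fun k => toL2 lam (f_ k)) f -> L2cvg (fun k => Sigma_simple (f_ k)) g.

Definition Sigma (f : L2 lam) : L2 Pr := xget 0 (is_Sigma f).

End poisson_product_system.
Arguments translation {R n dY Y} act lam X a f.
Arguments Sigma {R dY Y} lam X {dO Omega} Pr eta ell f.

Section cones.
Context (R : realType) (n : nat).

Definition closed_convex_cone (P : set 'rV[R]_n) : Prop :=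
  [/\ closed P, forall x y, P x -> P y -> P (x + y)
    & forall (t : R) x, 0 <= t -> P x -> P (t *: x)].

Definition measurable_action dY (Y : measurableType dY)
    (act : 'rV[R]_n -> Y -> Y) : Prop :=
  [/\ forall y, act 0 y = y, forall a b y, act (a + b) y = act a (act b y)
    & measurable_fun setT
        (fun p : g_sigma_algebraType (@open 'rV[R]_n) * Y => act p.1 p.2)].

End cones.

(* Main.v *)
Require Import Defs.
From mathcomp Require Import all_boot all_order all_algebra.
From mathcomp Require Import complex fingroup perm.
From mathcomp Require Import all_classical all_reals all_analysis.
From mathcomp Require Import measurable_realfun.
From mathcomp Require Import ring lra.

(** For step functions [f] and [g] with values [c_i] and [d_i] on disjoint sets
    [B_i], the vector [Sigma_f] is a multiple of the product of the
    [(1 + c_i) ^ eta(B_i)], so the generating function of the Poisson law gives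
    [E (Sigma_f conj(Sigma_g)) = exp <f, g> = <e(f), e(g)>].  Hence
    [e(f) |-> Sigma_f] extends to one isometry [Theta], independent of [a].

    The range of [Theta] on the fibre at [a] is the closed span of the
    [Sigma_f], [f] supported off [X + a].  It contains the products of the
    [z_i ^ eta(B_i)], [0 < z_i <= 1]; their Taylor coefficients at [z = 0] are the
    indicators of the events [eta(B_i) = k_i], which form a pi-system generating
    the sigma-algebra up to null sets, so the range is the whole of
    [L^2(F_a)].  The same extraction shows that the isometry extending
    [Sigma_f |-> Sigma_{f(. - a)}] is the shift [S_a].

    For disjointly supported [f], [g] one has [Sigma_f Sigma_g = Sigma_{f + g}];
    by independence the product is isometric on the tensor product of the two
    spans, and transporting it through [Theta] yields the multiplication of the
    CCR flow.  Finally [Theta] is isometric and does not depend on [a], so it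
    matches relatively open sets, hence the measurable structures. *)

Set Implicit Arguments.
Unset Strict Implicit.
Unset Printing Implicit Defensive.

Import Order.TTheory GRing.Theory Num.Theory.
Import numFieldNormedType.Exports.

Local Open Scope classical_set_scope.
Local Open Scope ring_scope.

(** * Complex-valued measurable and integrable functions *)

(** The logarithm [ell] is prescribed on the positive reals and is otherwise an arbitrary measurable
    branch, so additivity is available only there. The sets describing an event may overlap, and the
    value of [1 + f] at a point is then a product of several [z_i]; their positivity makes its
    logarithm the sum of the [ln z_i] and keeps [f] away from [-1].

    Three objects of the statement, [shift], [Sigma] and [ccr_mul], are values of a choice operator:
    nothing is known of them until something satisfying their specification has been exhibited, and
    the last two also require uniqueness.

    A product of two vectors of L^2 need not lie in L^2. Square integrability of the products comes
    from the kernel identity: an abstract scaled isometry is constructed first and is then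
    recognised as multiplication, because multiplication by a function is a closed operator.

    The Fock space is defined from symmetric tensors, whereas the isometry is defined on exponential
    vectors; Ryser's formula for the permanent and the extraction of coefficients connect the
    two. *)

Section complex_modulus.
Context {R : realType}.
Implicit Types z w : R[i].
Local Open Scope complex_scope.

(** Real-valued, unlike the norm of [R[i]]; the square stays polynomial in the two parts. *)
Definition nsq z : R := complex.Re z ^+ 2 + complex.Im z ^+ 2.
Definition modc z : R := Num.sqrt (nsq z).

Lemma nsq_ge0 z : 0 <= nsq z.
Proof. by rewrite addr_ge0// sqr_ge0. Qed.

Lemma modc_ge0 z : 0 <= modc z. Proof. exact: sqrtr_ge0. Qed.

Lemma sqr_modc z : modc z ^+ 2 = nsq z.
Proof. by rewrite sqr_sqrtr// nsq_ge0. Qed.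

Lemma nsqM z w : nsq (z * w) = nsq z * nsq w.
Proof. by case: z w => [a b] [c d]; rewrite /nsq/=; ring. Qed.

Lemma modcM z w : modc (z * w) = modc z * modc w.
Proof. by rewrite /modc nsqM sqrtrM// nsq_ge0. Qed.

Lemma modcE z : modc z = Normc.normc z. Proof. by case: z. Qed.

Lemma modcD z w : modc (z + w) <= modc z + modc w.
Proof. by rewrite !modcE; exact: le_normcD. Qed.

Lemma modcN z : modc (- z) = modc z.
Proof. by case: z => a b; rewrite /modc /nsq/= !sqrrN. Qed.

Lemma modcB z w : modc (z - w) = modc (w - z).
Proof. by rewrite -modcN opprB. Qed.

Lemma modc_eq0 z : (modc z == 0) = (z == 0).
Proof.
apply/eqP/eqP => [|->]; first by rewrite modcE; exact: Normc.eq0_normc.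
by rewrite modcE Normc.normc0.
Qed.

Lemma modc0 : modc (0 : R[i]) = 0. Proof. by apply/eqP; rewrite modc_eq0. Qed.

Lemma nsq_eq0 z : (nsq z == 0) = (z == 0).
Proof. by rewrite -sqr_modc sqrf_eq0 modc_eq0. Qed.

Lemma nsq0 : nsq (0 : R[i]) = 0. Proof. by apply/eqP; rewrite nsq_eq0. Qed.

Lemma modc1 : modc (1 : R[i]) = 1. Proof. by rewrite modcE Normc.normc1. Qed.

Lemma modcJ z : modc (z^*) = modc z.
Proof. by case: z => a b; rewrite /modc /nsq/= sqrrN. Qed.

Lemma modc_real (a : R) : modc a%:C = `|a|.
Proof. by rewrite /modc /nsq/= expr0n/= addr0 sqrtr_sqr. Qed.

Lemma nsq_real (a : R) : nsq a%:C = a ^+ 2.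
Proof. by rewrite /nsq/= expr0n/= addr0. Qed.

Lemma modcX z n : modc (z ^+ n) = modc z ^+ n.
Proof. by elim: n => [|n ih]; rewrite ?expr0 ?modc1// !exprS modcM ih. Qed.

Lemma mulcJ z : z * z^* = (nsq z)%:C.
Proof.
by case: z => a b; rewrite /nsq; simpc; congr (_ +i* _); rewrite /=; ring.
Qed.

Lemma nsqD_le z w : nsq (z + w) <= 2 * (nsq z + nsq w).
Proof.
case: z w => [a b] [c d]; rewrite /nsq/= -subr_ge0.
rewrite (_ : _ - _ = (a - c) ^+ 2 + (b - d) ^+ 2); last by ring.
by rewrite addr_ge0// sqr_ge0.
Qed.

Lemma Re_le_modc z : `|complex.Re z| <= modc z.
Proof. by rewrite -sqrtr_sqr ler_wsqrtr// lerDl sqr_ge0. Qed.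

Lemma Im_le_modc z : `|complex.Im z| <= modc z.
Proof. by rewrite -sqrtr_sqr ler_wsqrtr// lerDr sqr_ge0. Qed.

Lemma modc_le z : modc z <= `|complex.Re z| + `|complex.Im z|.
Proof.
rewrite -(@ler_pXn2r _ 2)// ?nnegrE ?modc_ge0 ?addr_ge0//.
rewrite sqr_modc sqrrD !real_normK ?num_real// /nsq.
have : 0 <= `|complex.Re z| * `|complex.Im z| by rewrite mulr_ge0.
by move: (`|_| * `|_|) => t; lra.
Qed.

Lemma cRe_sum I (r : seq I) (P : pred I) (F : I -> R[i]) :
  complex.Re (\sum_(i <- r | P i) F i) = \sum_(i <- r | P i) complex.Re (F i).
Proof. exact: (raddf_sum (@complex.Re R : Rcomplex R -> R)). Qed.

Lemma cIm_sum I (r : seq I) (P : pred I) (F : I -> R[i]) :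
  complex.Im (\sum_(i <- r | P i) F i) = \sum_(i <- r | P i) complex.Im (F i).
Proof. exact: (raddf_sum (@complex.Im R : Rcomplex R -> R)). Qed.

Lemma cReD z w : complex.Re (z + w) = complex.Re z + complex.Re w.
Proof. by case: z w => [? ?] [? ?]. Qed.

Lemma cImD z w : complex.Im (z + w) = complex.Im z + complex.Im w.
Proof. by case: z w => [? ?] [? ?]. Qed.

Lemma cReN z : complex.Re (- z) = - complex.Re z. Proof. by case: z. Qed.
Lemma cImN z : complex.Im (- z) = - complex.Im z. Proof. by case: z. Qed.

Lemma cReM z w : complex.Re (z * w) =
  complex.Re z * complex.Re w - complex.Im z * complex.Im w.
Proof. by case: z w => [? ?] [? ?]. Qed.

Lemma cImM z w : complex.Im (z * w) =
  complex.Re z * complex.Im w + complex.Im z * complex.Re w.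
Proof. by case: z w => [? ?] [? ?]. Qed.

Lemma cReJ z : complex.Re (z^*) = complex.Re z. Proof. by case: z. Qed.
Lemma cImJ z : complex.Im (z^*) = - complex.Im z. Proof. by case: z. Qed.

Lemma complex_ext z w : complex.Re z = complex.Re w ->
  complex.Im z = complex.Im w -> z = w.
Proof. by case: z w => [? ?] [? ?] /= -> ->. Qed.

End complex_modulus.

(** * Limits of complex sequences *)

Section complex_limits.
Context {R : realType}.
Implicit Types (u v : nat -> R[i]) (l m : R[i]).

(** Convergence is stated through a real null sequence, so that estimates reduce to [squeeze0];
    [CcvgP] passes to real and imaginary parts. *)
Definition Ccvg u l := modc (u n - l) @[n --> \oo] --> (0 : R).

Lemma squeeze0 (u v : nat -> R) : (forall n, 0 <= u n) ->
  (forall n, u n <= v n) -> v @ \oo --> (0 : R) -> u @ \oo --> (0 : R).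
Proof.
move=> u0 uv; apply: (@squeeze_cvgr _ _ _ _ (cst 0)) => //; last exact: cvg_cst.
by apply: nearW => n; rewrite u0 uv.
Qed.

Lemma cvg0D (u v : nat -> R) : u @ \oo --> (0 : R) -> v @ \oo --> (0 : R) ->
  u n + v n @[n --> \oo] --> (0 : R).
Proof. by move=> hu hv; rewrite -[X in _ --> X]addr0; exact: cvgD. Qed.

Lemma cvg0M (u v : nat -> R) b : u @ \oo --> (0 : R) -> v @ \oo --> (b : R) ->
  u n * v n @[n --> \oo] --> (0 : R).
Proof. by move=> hu hv; rewrite -(mul0r b); exact: cvgM. Qed.

Lemma cvg0Z (u : nat -> R) (c : R) : u @ \oo --> (0 : R) ->
  c * u n @[n --> \oo] --> (0 : R).
Proof. by move=> hu; rewrite -(mulr0 c); apply: cvgM => //; exact: cvg_cst. Qed.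

Lemma CcvgP u l : Ccvg u l <->
  (complex.Re (u n) @[n --> \oo] --> complex.Re l) /\
  (complex.Im (u n) @[n --> \oo] --> complex.Im l).
Proof.
split => [ul|[Rul Iul]].
  split; apply/subr_cvg0; apply/norm_cvg0P.
    apply: squeeze0 ul => // n; rewrite -cReN -cReD; exact: Re_le_modc.
  apply: squeeze0 ul => // n; rewrite -cImN -cImD; exact: Im_le_modc.
have h : `|complex.Re (u n) - complex.Re l| + `|complex.Im (u n) - complex.Im l|
    @[n --> \oo] --> (0 : R).
  rewrite -[X in _ --> X]addr0.
  by apply: cvgD; apply/norm_cvg0P/subr_cvg0.
apply: squeeze0 h => n; first exact: modc_ge0.
by rewrite -cReN -cImN -cReD -cImD; exact: modc_le.
Qed.

Lemma Ccvg_unique u l m : Ccvg u l -> Ccvg u m -> l = m.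
Proof.
move=> /CcvgP[a b] /CcvgP[c d]; apply: complex_ext.
  by apply: (cvg_unique _ a c).
by apply: (cvg_unique _ b d).
Qed.

Lemma Ccvg_eq u v l : (forall n, u n = v n) -> Ccvg u l -> Ccvg v l.
Proof. by move=> /funext ->. Qed.

Lemma Ccvg_cst l : Ccvg (fun=> l) l.
Proof. by apply/CcvgP; split; exact: cvg_cst. Qed.

Lemma CcvgD u v l m : Ccvg u l -> Ccvg v m -> Ccvg (fun n => u n + v n) (l + m).
Proof.
move=> /CcvgP[a b] /CcvgP[c d]; apply/CcvgP; split.
  by rewrite cReD; under eq_fun do rewrite cReD; exact: cvgD.
by rewrite cImD; under eq_fun do rewrite cImD; exact: cvgD.
Qed.

Lemma CcvgM u v l m : Ccvg u l -> Ccvg v m -> Ccvg (fun n => u n * v n) (l * m).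
Proof.
move=> /CcvgP[a b] /CcvgP[c d]; apply/CcvgP; split.
  rewrite cReM; under eq_fun do rewrite cReM.
  by apply: cvgB; exact: cvgM.
rewrite cImM; under eq_fun do rewrite cImM.
by apply: cvgD; exact: cvgM.
Qed.

End complex_limits.

Section complex_measurable.
Context d (T : measurableType d) {R : realType}.
Implicit Types f g : T -> R[i].
Local Open Scope complex_scope.

(** Measurability by components, matching the two clauses of [L2sub]. The measurable structure of
    the source is a parameter, so a sub-sigma-algebra can be substituted for it. *)
Definition Cmeas f := measurable_fun setT (fun x => complex.Re (f x)) /\
  measurable_fun setT (fun x => complex.Im (f x)).

Lemma Cmeas_cst c : Cmeas (fun=> c).
Proof. by split; exact: measurable_cst. Qed.

Lemma CmeasD f g : Cmeas f -> Cmeas g -> Cmeas (fun x => f x + g x).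
Proof.
move=> [f1 f2] [g1 g2]; split.
  by under eq_fun do rewrite cReD; exact: measurable_funD.
by under eq_fun do rewrite cImD; exact: measurable_funD.
Qed.

Lemma CmeasB f g : Cmeas f -> Cmeas g -> Cmeas (fun x => f x - g x).
Proof.
move=> [f1 f2] [g1 g2]; split.
  by under eq_fun do rewrite cReD cReN; exact: measurable_funB.
by under eq_fun do rewrite cImD cImN; exact: measurable_funB.
Qed.

Lemma CmeasM f g : Cmeas f -> Cmeas g -> Cmeas (fun x => f x * g x).
Proof.
move=> [f1 f2] [g1 g2]; split.
  under eq_fun do rewrite cReM.
  by apply: measurable_funB; exact: measurable_funM.
under eq_fun do rewrite cImM.
by apply: measurable_funD; exact: measurable_funM.
Qed.

Lemma CmeasJ f : Cmeas f -> Cmeas (fun x => (f x)^*).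
Proof.
move=> [f1 f2]; split; first by under eq_fun do rewrite cReJ.
by under eq_fun do rewrite cImJ; exact: measurable_funN.
Qed.

Lemma Cmeas_nsq f : Cmeas f -> measurable_fun setT (fun x => nsq (f x)).
Proof.
by move=> [f1 f2]; apply: measurable_funD; exact: measurable_funX.
Qed.

Lemma Cmeas_sum I (r : seq I) (P : pred I) (F : I -> T -> R[i]) :
  (forall i, P i -> Cmeas (F i)) -> Cmeas (fun x => \sum_(i <- r | P i) F i x).
Proof.
move=> hF; elim: r => [|i r ih].
  by under eq_fun do rewrite big_nil; exact: Cmeas_cst.
under eq_fun do rewrite big_cons; case Pi: (P i) => //.
by apply: CmeasD => //; exact: hF.
Qed.

Lemma Cmeas_prod I (r : seq I) (P : pred I) (F : I -> T -> R[i]) :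
  (forall i, P i -> Cmeas (F i)) -> Cmeas (fun x => \prod_(i <- r | P i) F i x).
Proof.
move=> hF; elim: r => [|i r ih].
  by under eq_fun do rewrite big_nil; exact: Cmeas_cst.
under eq_fun do rewrite big_cons; case Pi: (P i) => //.
by apply: CmeasM => //; exact: hF.
Qed.

Lemma Cmeas_real (f : T -> R) : measurable_fun setT f -> Cmeas (fun x => (f x)%:C).
Proof. by move=> mf; split => //; exact: measurable_cst. Qed.

Lemma Cmeas_indic (A : set T) : measurable A ->
  Cmeas (fun x => (\1_A x : R)%:C).
Proof. by move=> mA; apply: Cmeas_real; exact: measurable_indic. Qed.

End complex_measurable.

Lemma Cmeas_comp d1 d2 (T1 : measurableType d1) (T2 : measurableType d2)
    (R : realType) (f : T2 -> R[i]) (g : T1 -> T2) :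
  Cmeas f -> measurable_fun setT g -> Cmeas (fun x => f (g x)).
Proof. by move=> [f1 f2] mg; split; [exact: (measurableT_comp f1 mg)|exact: (measurableT_comp f2 mg)]. Qed.

Lemma cvg_EFin_nat (R : realType) (u : nat -> R) (l : R) :
  u @ \oo --> l -> (fun n => (u n)%:E) @ \oo --> l%:E.
Proof. by move=> ul; apply: cvg_EFin => //; exact: nearW. Qed.

Section complex_integral.
Context d (T : measurableType d) {R : realType}.
Variable mu : {measure set T -> \bar R}.
Implicit Types f g : T -> R[i].
Local Open Scope complex_scope.

Definition Rintegrable (f : T -> R) := mu.-integrable setT (EFin \o f).

Lemma Rintegrable_meas (f : T -> R) : Rintegrable f -> measurable_fun setT f.
Proof. by move=> /measurable_int/measurable_EFinP. Qed.

Lemma le_Rintegrable (f g : T -> R) : measurable_fun setT f ->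
  (forall x, `|f x| <= g x) -> Rintegrable g -> Rintegrable f.
Proof.
move=> mf fg ig; apply: le_integrable ig => //.
  exact/measurable_EFinP.
by move=> x _ /=; rewrite lee_fin (le_trans (fg x))// ler_norm.
Qed.

Lemma RintegrableD (f g : T -> R) : Rintegrable f -> Rintegrable g ->
  Rintegrable (fun x => f x + g x).
Proof. by move=> h k; have := integrableD measurableT h k. Qed.

Lemma RintegrableB (f g : T -> R) : Rintegrable f -> Rintegrable g ->
  Rintegrable (fun x => f x - g x).
Proof. by move=> h k; have := integrableB measurableT h k. Qed.

Lemma RintegrableZ (c : R) (f : T -> R) : Rintegrable f ->
  Rintegrable (fun x => c * f x).
Proof. by move=> h; have := integrableZl measurableT c h. Qed.

Lemma Rintegral_ae (f g : T -> R) : measurable_fun setT f ->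
  measurable_fun setT g -> {ae mu, forall x, f x = g x} ->
  \int[mu]_x f x = \int[mu]_x g x.
Proof.
move=> mf mg fg; congr fine; apply: ae_eq_integral => //.
- exact/measurable_EFinP.
- exact/measurable_EFinP.
by apply: filterS fg => x /= -> _.
Qed.

Lemma Rintegrable_ge0 (f : T -> R) : measurable_fun setT f ->
  (forall x, 0 <= f x) -> (\int[mu]_x (f x)%:E < +oo)%E -> Rintegrable f.
Proof.
move=> mf f0 foo; apply/integrableP; split; first exact/measurable_EFinP.
by under eq_integral => x _ do rewrite gee0_abs ?lee_fin ?f0//.
Qed.

Lemma EFin_Rintegral (f : T -> R) : Rintegrable f ->
  (\int[mu]_x f x)%:E = (\int[mu]_x (f x)%:E)%E.
Proof. by move=> h; rewrite /Rintegral fineK// integrable_fin_num. Qed.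

Lemma Rdominated (f_ : nat -> T -> R) (f g : T -> R) :
  (forall n, measurable_fun setT (f_ n)) -> measurable_fun setT f ->
  {ae mu, forall x, f_ ^~ x @ \oo --> f x} -> Rintegrable g ->
  (forall n, {ae mu, forall x, `|f_ n x| <= g x}) ->
  (fun n => \int[mu]_x f_ n x) @ \oo --> \int[mu]_x f x.
Proof.
move=> mf_ mf ff ig fg.
have [] := @dominated_convergence _ _ _ mu setT measurableT
    (fun n => EFin \o f_ n) (EFin \o f) (EFin \o g) _ _ _ ig.
- by move=> n; exact/measurable_EFinP.
- exact/measurable_EFinP.
- by apply: filterS ff => x fx _; apply: cvg_EFin => //; exact: nearW.
- have : {ae mu, forall x, forall n, `|f_ n x| <= g x} by exact/ae_foralln.
  by apply: filterS => x fgx n _ /=; rewrite lee_fin.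
by move=> intf _; rewrite -(EFin_Rintegral intf) => /fine_cvg.
Qed.

Definition Cintegrable f := Rintegrable (fun x => complex.Re (f x)) /\
  Rintegrable (fun x => complex.Im (f x)).

Local Notation Cint f := (Cintegral mu setT f).

Lemma Cintegrable_meas f : Cintegrable f -> Cmeas f.
Proof. by move=> [/Rintegrable_meas ? /Rintegrable_meas ?]. Qed.

Lemma Cintegrable_le f (g : T -> R) : Cmeas f -> (forall x, modc (f x) <= g x) ->
  Rintegrable g -> Cintegrable f.
Proof.
move=> [f1 f2] fg ig; split.
  by apply: le_Rintegrable ig => // x; exact: le_trans (Re_le_modc _) (fg x).
by apply: le_Rintegrable ig => // x; exact: le_trans (Im_le_modc _) (fg x).
Qed.

Lemma CintegrableD f g : Cintegrable f -> Cintegrable g ->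
  Cintegrable (fun x => f x + g x).
Proof.
move=> [f1 f2] [g1 g2]; split.
  by under eq_fun do rewrite cReD; exact: RintegrableD.
by under eq_fun do rewrite cImD; exact: RintegrableD.
Qed.

Lemma CintegrableZ c f : Cintegrable f -> Cintegrable (fun x => c * f x).
Proof.
move=> [f1 f2]; split.
  under eq_fun do rewrite cReM.
  by apply: RintegrableB; exact: RintegrableZ.
under eq_fun do rewrite cImM.
by apply: RintegrableD; exact: RintegrableZ.
Qed.

Lemma CintegralD f g : Cintegrable f -> Cintegrable g ->
  Cint (fun x => f x + g x) = Cint f + Cint g.
Proof.
move=> [f1 f2] [g1 g2]; apply: complex_ext => /=.
  by rewrite -RintegralD//; apply: eq_Rintegral => x _ /=; rewrite cReD.
by rewrite -RintegralD//; apply: eq_Rintegral => x _ /=; rewrite cImD.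
Qed.

Lemma CintegralZ c f : Cintegrable f -> Cint (fun x => c * f x) = c * Cint f.
Proof.
move=> [f1 f2]; apply: complex_ext; rewrite ?(cReM, cImM)/=.
  rewrite -!RintegralZl// -RintegralB//; try exact: RintegrableZ.
  by apply: eq_Rintegral => x _ /=; rewrite cReM.
rewrite -!RintegralZl// -RintegralD//; try exact: RintegrableZ.
by apply: eq_Rintegral => x _ /=; rewrite cImM.
Qed.

Lemma CintegralJ f : Cintegrable f -> Cint (fun x => (f x)^*) = (Cint f)^*.
Proof.
move=> [f1 f2]; apply: complex_ext; rewrite ?(cReJ, cImJ)/=.
  by apply: eq_Rintegral => x _ /=; rewrite cReJ.
rewrite -mulN1r -RintegralZl//; apply: eq_Rintegral => x _ /=.
by rewrite cImJ mulN1r.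
Qed.

Lemma Cintegral_ae f g : Cmeas f -> Cmeas g -> {ae mu, forall x, f x = g x} ->
  Cint f = Cint g.
Proof.
move=> [f1 f2] [g1 g2] fg; apply: complex_ext; apply: Rintegral_ae => //.
  by apply: filterS fg => x /= ->.
by apply: filterS fg => x /= ->.
Qed.

Lemma Cintegral_real (f : T -> R) :
  Cint (fun x => (f x)%:C) = (\int[mu]_x f x)%:C.
Proof.
by apply: complex_ext => //=; rewrite /Rintegral/= integral0.
Qed.

Lemma Cintegral0 : Cint (fun=> 0) = 0.
Proof. by apply: complex_ext => /=; rewrite /Rintegral/= integral0. Qed.

Lemma Cintegrable_sum I (r : seq I) (F : I -> T -> R[i]) :
  (forall i, Cintegrable (F i)) -> Cintegrable (fun x => \sum_(i <- r) F i x).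
Proof.
move=> hF; elim: r => [|i r ih].
  under eq_fun do rewrite big_nil.
  by split; exact: (integrable0 mu setT).
by under eq_fun do rewrite big_cons; exact: CintegrableD.
Qed.

Lemma Cintegral_sum I (r : seq I) (F : I -> T -> R[i]) :
  (forall i, Cintegrable (F i)) ->
  Cint (fun x => \sum_(i <- r) F i x) = \sum_(i <- r) Cint (F i).
Proof.
move=> hF; elim: r => [|i r ih].
  rewrite big_nil -[RHS]Cintegral0; congr (Cintegral _ _ _).
  by apply/funext => x; rewrite big_nil.
under eq_fun do rewrite big_cons.
by rewrite CintegralD ?ih ?big_cons//; exact: Cintegrable_sum.
Qed.

End complex_integral.

(** * Square integrable functions *)

Section sqintegrable_theory.
Context d (T : measurableType d) {R : realType}.
Variable mu : {measure set T -> \bar R}.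
Implicit Types f g : T -> R[i].
Local Open Scope complex_scope.
Local Notation Cint f := (Cintegral mu setT f).

Let Lfun2P (g : T -> R) : g \in Lfun mu 2%:E <->
  measurable_fun setT g /\ Rintegrable mu (fun x => g x ^+ 2).
Proof.
split=> [hg|[mg ig]].
  split; last exact: Lfun2_integrable_sqr hg.
  by move: hg; rewrite inE => /andP[/[!inE]/= mg _].
rewrite inE; apply/andP; split; rewrite inE//= /finite_norm unlock /Lnorm.
rewrite poweR_lty//=; move/integrableP : ig => [_].
move=> h; rewrite (le_lt_trans _ h)// le_eqVlt; apply/orP; left; apply/eqP.
apply: eq_integral => x _ /=.
by rewrite powR_mulrn// real_normK ?num_real// ger0_norm// sqr_ge0.
Qed.

Lemma sqintP f : sqintegrable mu f <->
  Cmeas f /\ Rintegrable mu (fun x => nsq (f x)).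
Proof.
split=> [/andP[/Lfun2P[m1 i1] /Lfun2P[m2 i2]]|[[m1 m2] iF]].
  by split; [split|exact: RintegrableD].
apply/andP; split; apply/Lfun2P; split => //; apply: le_Rintegrable iF.
- exact: measurable_funX.
- by move=> x /=; rewrite ger0_norm ?sqr_ge0// lerDl sqr_ge0.
- exact: measurable_funX.
- by move=> x /=; rewrite ger0_norm ?sqr_ge0// lerDr sqr_ge0.
Qed.

Lemma sqint_meas f : sqintegrable mu f -> Cmeas f.
Proof. by case/sqintP. Qed.

Lemma sqint_nsq f : sqintegrable mu f -> Rintegrable mu (fun x => nsq (f x)).
Proof. by case/sqintP. Qed.

Lemma sqint_le f g : Cmeas f -> (forall x, modc (f x) <= modc (g x)) ->
  sqintegrable mu g -> sqintegrable mu f.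
Proof.
move=> mf fg /sqintP[_ ig]; apply/sqintP; split => //.
apply: le_Rintegrable ig => [|x]; first exact: Cmeas_nsq.
by rewrite ger0_norm ?nsq_ge0// -!sqr_modc lerXn2r ?nnegrE ?modc_ge0.
Qed.

(** Measurability of [f] is assumed separately: it passes along an almost everywhere equality when
    the measure is complete ([Cmeas_ae]). *)
Lemma sqint_ae f g : Cmeas f -> {ae mu, forall x, f x = g x} ->
  sqintegrable mu g -> sqintegrable mu f.
Proof.
move=> mf fg /sqintP[mg ig]; apply/sqintP; split => //.
apply: Rintegrable_ge0 => [|x|]; first exact: Cmeas_nsq.
  exact: nsq_ge0.
rewrite (@ae_eq_integral _ _ _ mu setT (fun x => (nsq (g x))%:E))//.
- exact: (integrable_lty measurableT ig).
- by apply/measurable_EFinP; exact: Cmeas_nsq.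
- by apply/measurable_EFinP; exact: Cmeas_nsq.
- by apply: filterS fg => x /= ->.
Qed.

Lemma sqintB f g : sqintegrable mu f -> sqintegrable mu g ->
  sqintegrable mu (fun x => f x - g x).
Proof.
move=> hf hg; rewrite (_ : (fun x => _) = fun x => f x + (-1) * g x).
  by apply: sqintegrableD => //; exact: sqintegrableZ.
by apply/funext => x; rewrite mulN1r.
Qed.

Lemma sqint_mul_Cintegrable f g : sqintegrable mu f -> sqintegrable mu g ->
  Cintegrable mu (fun x => f x * (g x)^*).
Proof.
move=> /sqintP[mf jf] /sqintP[mg jg].
apply: (@Cintegrable_le _ _ _ _ _ (fun x => nsq (f x) + nsq (g x))).
- by apply: CmeasM => //; exact: CmeasJ.
- move=> x; rewrite modcM modcJ -!sqr_modc.
  have := sqr_ge0 (modc (f x) - modc (g x)).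
  have := modc_ge0 (f x); have := modc_ge0 (g x).
  by move: (modc _) (modc _) => a b; nra.
- exact: RintegrableD.
Qed.

Lemma dotE f g : sqintegrable mu f -> sqintegrable mu g ->
  dot (toL2 mu f) (toL2 mu g) = Cint (fun x => f x * (g x)^*).
Proof.
move=> hf hg; have [mf mg] := (sqint_meas hf, sqint_meas hg).
have mm (h : L2 mu) : Cmeas (fun_of_L2 h) by exact/sqint_meas/sqintegrable_L2.
apply: Cintegral_ae; first by apply: CmeasM => //; exact: CmeasJ.
  by apply: CmeasM => //; exact: CmeasJ.
by have := fun_toL2 hf; have := fun_toL2 hg; apply: filterS2 => x -> ->.
Qed.

Lemma dot_funE (f g : L2 mu) :
  dot f g = Cint (fun x => fun_of_L2 f x * (fun_of_L2 g x)^*).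
Proof. by []. Qed.

Lemma toL2D f g : sqintegrable mu f -> sqintegrable mu g ->
  toL2 mu (fun x => f x + g x) = toL2 mu f + toL2 mu g.
Proof.
move=> hf hg; apply: toL2_ae; try exact: sqintegrableD.
  by apply: sqintegrableD; exact: sqintegrable_L2.
by have := fun_toL2 hf; have := fun_toL2 hg; apply: filterS2 => x -> ->.
Qed.

Lemma toL2Z c f : sqintegrable mu f -> toL2 mu (fun x => c * f x) = c *: toL2 mu f.
Proof.
move=> hf; apply: toL2_ae; try exact: sqintegrableZ.
  by apply: sqintegrableZ; exact: sqintegrable_L2.
by have := fun_toL2 hf; apply: filterS => x ->.
Qed.

Lemma toL2B f g : sqintegrable mu f -> sqintegrable mu g ->
  toL2 mu (fun x => f x - g x) = toL2 mu f - toL2 mu g.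
Proof.
move=> hf hg; rewrite (_ : (fun x => _) = fun x => f x + (-1) * g x).
  by rewrite toL2D ?toL2Z ?scaleN1r//; exact: sqintegrableZ.
by apply/funext => x; rewrite mulN1r.
Qed.

Lemma toL20 : toL2 mu (fun=> 0) = 0. Proof. by []. Qed.

Lemma sqint_sum I (r : seq I) (F : I -> T -> R[i]) :
  (forall i, sqintegrable mu (F i)) ->
  sqintegrable mu (fun x => \sum_(i <- r) F i x).
Proof.
move=> hF; elim: r => [|i r ih].
  by under eq_fun do rewrite big_nil; exact: sqintegrable0.
by under eq_fun do rewrite big_cons; exact: sqintegrableD.
Qed.

Lemma toL2_sum I (r : seq I) (F : I -> T -> R[i]) :
  (forall i, sqintegrable mu (F i)) ->
  toL2 mu (fun x => \sum_(i <- r) F i x) = \sum_(i <- r) toL2 mu (F i).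
Proof.
move=> hF; elim: r => [|i r ih].
  by rewrite big_nil; under eq_fun do rewrite big_nil; rewrite toL20.
by under eq_fun do rewrite big_cons; rewrite toL2D ?ih ?big_cons//; exact: sqint_sum.
Qed.

Lemma toL2_inj f g : sqintegrable mu f -> sqintegrable mu g ->
  toL2 mu f = toL2 mu g -> {ae mu, forall x, f x = g x}.
Proof.
move=> hf hg fg; have := fun_toL2 hf; have := fun_toL2 hg; rewrite fg.
by apply: filterS2 => x -> ->.
Qed.

Lemma fun_of_L2D (f g : L2 mu) :
  {ae mu, forall x, fun_of_L2 (f + g) x = fun_of_L2 f x + fun_of_L2 g x}.
Proof. by apply: fun_toL2; apply: sqintegrableD; exact: sqintegrable_L2. Qed.

Lemma fun_of_L2Z c (f : L2 mu) :
  {ae mu, forall x, fun_of_L2 (c *: f) x = c * fun_of_L2 f x}.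
Proof. by apply: fun_toL2; apply: sqintegrableZ; exact: sqintegrable_L2. Qed.

End sqintegrable_theory.

Section inner_product.
Context d (T : measurableType d) {R : realType}.
Variable mu : {measure set T -> \bar R}.
Implicit Types f g h : L2 mu.
Local Open Scope complex_scope.

Lemma dotDl f g h : dot (f + g) h = dot f h + dot g h.
Proof.
rewrite -{1}(toL2K f) -{1}(toL2K g) -{1}(toL2K h) -toL2D; try exact: sqintegrable_L2.
rewrite dotE; try (try apply: sqintegrableD; exact: sqintegrable_L2).
under eq_fun do rewrite mulrDl.
by rewrite CintegralD//; apply: sqint_mul_Cintegrable; exact: sqintegrable_L2.
Qed.

Lemma dotZl c f g : dot (c *: f) g = c * dot f g.
Proof.
rewrite -{1}(toL2K f) -{1}(toL2K g) -toL2Z; try exact: sqintegrable_L2.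
rewrite dotE; try (try apply: sqintegrableZ; exact: sqintegrable_L2).
under eq_fun do rewrite -mulrA.
by rewrite CintegralZ//; apply: sqint_mul_Cintegrable; exact: sqintegrable_L2.
Qed.

Lemma dotC f g : dot g f = (dot f g)^*.
Proof.
rewrite [in RHS]dot_funE -CintegralJ; last first.
  by apply: sqint_mul_Cintegrable; exact: sqintegrable_L2.
rewrite dot_funE; congr (Cintegral _ _ _); apply/funext => x.
by rewrite rmorphM /= conjcK mulrC.
Qed.

Lemma dot0l f : dot 0 f = 0.
Proof. by rewrite -(scale0r (0 : L2 mu)) dotZl mul0r. Qed.

Lemma dot_nsq f : dot f f = (\int[mu]_x nsq (fun_of_L2 f x))%:C.
Proof.
rewrite -Cintegral_real dot_funE; congr (Cintegral _ _ _).
by apply/funext => x; rewrite mulcJ.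
Qed.

Lemma L2norm_ge0 f : 0 <= L2norm f. Proof. exact: sqrtr_ge0. Qed.

Lemma sqr_L2norm f : L2norm f ^+ 2 = \int[mu]_x nsq (fun_of_L2 f x).
Proof.
rewrite sqr_sqrtr dot_nsq//=; apply: Rintegral_ge0 => x _; exact: nsq_ge0.
Qed.

Lemma L2norm0 : L2norm (0 : L2 mu) = 0.
Proof. by rewrite /L2norm dot0l /= sqrtr0. Qed.

Lemma dotff f : dot f f = (L2norm f ^+ 2)%:C.
Proof. by rewrite dot_nsq sqr_L2norm. Qed.

Lemma sqr_L2norm_toL2 (f : T -> R[i]) : sqintegrable mu f ->
  L2norm (toL2 mu f) ^+ 2 = \int[mu]_x nsq (f x).
Proof.
move=> hf; apply: complexI; rewrite -dotff dotE// -Cintegral_real.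
by congr (Cintegral _ _ _); apply/funext => x; rewrite mulcJ.
Qed.

Lemma EFin_L2norm_toL2 (f : T -> R[i]) : sqintegrable mu f ->
  (L2norm (toL2 mu f) ^+ 2)%:E = (\int[mu]_x (nsq (f x))%:E)%E.
Proof.
by move=> hf; rewrite sqr_L2norm_toL2// EFin_Rintegral//; exact: sqint_nsq.
Qed.

Lemma L2norm_eq0 f : L2norm f = 0 -> f = 0.
Proof.
move=> f0; rewrite -(toL2K f); apply: toL2_ae; first exact: sqintegrable_L2.
  exact: sqintegrable0.
have mf := sqint_meas (sqintegrable_L2 f).
have : (\int[mu]_x `|(nsq (fun_of_L2 f x))%:E| = 0)%E.
  under eq_integral => x _ do rewrite gee0_abs ?lee_fin ?nsq_ge0//.
  by rewrite -EFin_L2norm_toL2 ?toL2K ?f0 ?expr0n//; exact: sqintegrable_L2.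
move/(ae_eq_integral_abs mu measurableT).
have h : measurable_fun setT (fun x => (nsq (fun_of_L2 f x))%:E).
  by apply/measurable_EFinP; exact: Cmeas_nsq.
move=> /(_ h); apply: filterS => x /(_ Logic.I)[] /eqP.
by rewrite nsq_eq0 => /eqP.
Qed.


Lemma L2normB_fun f g : (L2norm (f - g) ^+ 2)%:E =
  (\int[mu]_x (nsq (fun_of_L2 f x - fun_of_L2 g x))%:E)%E.
Proof.
have hf := sqintegrable_L2 f; have hg := sqintegrable_L2 g.
by rewrite -{1}(toL2K f) -{1}(toL2K g) -toL2B// EFin_L2norm_toL2//; exact: sqintB.
Qed.

End inner_product.

(** * Fatou's lemma and the completeness of L^2 *)

Section fatou_limit.
Context d (T : measurableType d) {R : realType}.
Variable mu : {measure set T -> \bar R}.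
Local Open Scope ereal_scope.

(** The lower limit of a convergent sequence is its limit, so Fatou's lemma transfers a uniform
    bound on the integrals to the pointwise limit. *)
Lemma fatou_bound (g_ : nat -> T -> R) (g : T -> R) (c : \bar R) :
  (forall n, measurable_fun setT (g_ n)) -> (forall n x, (0 <= g_ n x)%R) ->
  (forall x, (g_ n x @[n --> \oo] --> g x)%R) ->
  (forall n, \int[mu]_x (g_ n x)%:E <= c) -> \int[mu]_x (g x)%:E <= c.
Proof.
move=> mg g0 gg gc.
have -> : \int[mu]_x (g x)%:E = \int[mu]_x limn_einf (fun n => (g_ n x)%:E).
  apply: eq_integral => x _.
  have h := cvg_EFin_nat (gg x).
  by rewrite is_cvg_limn_einfE; [exact/esym/cvg_lim|apply/cvg_ex; exists (g x)%:E].
apply: le_trans (@fatou _ _ _ mu setT measurableT (fun n x => (g_ n x)%:E) _ _) _.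
- by move=> n; exact/measurable_EFinP.
- by move=> n x _; rewrite lee_fin.
rewrite limn_einf_lim; apply: lime_le; first exact: is_cvg_einfs.
by apply: nearW => n; apply: le_trans (gc n); apply: ereal_inf_lbound; exists n => /=.
Qed.

Lemma nneseries_le (a : nat -> \bar R) (c : \bar R) : (forall n, 0 <= a n) ->
  (forall n, \sum_(0 <= k < n) a k <= c) -> \sum_(k <oo) a k <= c.
Proof.
move=> a0 ac; apply: lime_le; first by apply: is_cvg_nneseries.
exact: nearW.
Qed.

Lemma nneseries_summable (a : nat -> R) : (forall n, (0 <= a n)%R) ->
  \sum_(k <oo) (a k)%:E < +oo -> cvgn (series a).
Proof.
move=> a0 aoo; apply: nondecreasing_is_cvgn.
  apply/nondecreasing_seqP => n; rewrite /series/= big_nat_recr//= lerDl.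
  exact: a0.
exists (fine (\sum_(k <oo) (a k)%:E)) => _ [n _ <-].
rewrite -lee_fin fineK; last first.
  by rewrite ge0_fin_numE// nneseries_ge0// => k _ _; rewrite lee_fin.
rewrite /series/= -sumEFin; apply: nneseries_lim_ge => k _ _.
by rewrite lee_fin.
Qed.

End fatou_limit.

Section completeness.
Context d (T : measurableType d) {R : realType}.
Variable mu : {measure set T -> \bar R}.
Implicit Types f : L2 mu.
Local Open Scope complex_scope.

Let sum_half n : \sum_(0 <= k < n) (2^-1 : R) ^+ k <= 2.
Proof.
suff -> : \sum_(0 <= k < n) (2^-1 : R) ^+ k = 2 - 2 * 2^-1 ^+ n.
  by rewrite gerBl mulr_ge0// exprn_ge0.
elim: n => [|n ih]; first by rewrite big_geq// expr0; lra.
by rewrite big_nat_recr//= ih exprS; lra.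
Qed.

(* The weights: [|d_k| <= 2^-k + 2^k |d_k|^2], and the second term is summable
   almost everywhere as soon as [||d_k||_2^2 <= 4^-k]. *)
Let summable_of_sq (d_ : nat -> R) : (\sum_(k <oo) (2 ^+ k * d_ k ^+ 2)%:E < +oo)%E ->
  cvgn (series d_).
Proof.
move=> h; apply: normed_cvg; apply: nneseries_summable => [n|] /=; first by [].
apply: (@le_lt_trans _ _ (\sum_(k <oo) ((2^-1 ^+ k)%:E + (2 ^+ k * d_ k ^+ 2)%:E))%E).
  apply: lee_nneseries => [k _ _|k _]; rewrite -?EFinD lee_fin//.
  have p0 : (0 : R) < 2 ^+ k by rewrite exprn_gt0.
  rewrite exprVn -(real_normK (num_real (d_ k))).
  have := normr_ge0 (d_ k); move: (`|_|) => t t0.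
  have [t1|t1] := leP t (2 ^+ k)^-1.
    by rewrite (le_trans t1)// lerDl mulr_ge0// ?sqr_ge0 ?ltW.
  have t2 : 1 <= 2 ^+ k * t by rewrite mulrC -ler_pdivrMr// div1r ltW.
  have : t <= 2 ^+ k * t ^+ 2 by rewrite expr2 mulrA ler_peMl.
  by move=> /le_trans; apply; rewrite lerDr invr_ge0 ltW.
rewrite nneseriesD; last 2 first.
- by move=> k _ _; rewrite lee_fin exprn_ge0.
- by move=> k _ _; rewrite lee_fin mulr_ge0 ?sqr_ge0 ?exprn_ge0.
rewrite lte_add_pinfty//; apply: le_lt_trans (ltry 2%R).
apply: nneseries_le => n; first by rewrite lee_fin exprn_ge0.
by rewrite sumEFin lee_fin.
Qed.

(** Riesz-Fischer with a rate. The squared increments integrate to at most [4^-k], so with weights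
    [2^k] their sum has integral at most 2 and is finite almost everywhere; there [summable_of_sq]
    gives pointwise convergence, and Fatou's lemma gives the distance to the limit. *)
Lemma L2_fast_cvg (f_ : nat -> L2 mu) :
  (forall m k, (m <= k)%N -> L2norm (f_ k - f_ m) ^+ 2 <= 4^-1 ^+ m) ->
  exists f, (forall m, L2norm (f - f_ m) ^+ 2 <= 4^-1 ^+ m) /\
    {ae mu, forall x, Ccvg (fun n => fun_of_L2 (f_ n) x) (fun_of_L2 f x)}.
Proof.
move=> hf; set u := fun n => fun_of_L2 (f_ n).
have su n : sqintegrable mu (u n) by exact: sqintegrable_L2.
have mu_ n : Cmeas (u n) by exact: sqint_meas (su n).
pose d_ k x := u k.+1 x - u k x.
have md k : Cmeas (d_ k) by apply: sqint_meas; exact: sqintB.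
pose a k x := (2 ^+ k * nsq (d_ k x))%:E.
have a0 k x : (0 <= a k x)%E by rewrite lee_fin mulr_ge0 ?nsq_ge0 ?exprn_ge0.
have ma k : measurable_fun setT (a k).
  by apply/measurable_EFinP; apply: measurable_funM => //; exact: Cmeas_nsq.
pose S x := (\sum_(k <oo) a k x)%E.
have mS : measurable_fun setT S by apply: ge0_emeasurable_sum.
have S0 x : (0 <= S x)%E by apply: nneseries_ge0.
have intS : mu.-integrable setT S.
  apply/integrableP; split => //.
  under eq_integral => x _ do rewrite gee0_abs//.
  rewrite integral_nneseries//.
  apply: (@le_lt_trans _ _ 2%:E); last exact: ltry.
  apply: nneseries_le => [k|n]; first exact: integral_ge0.
  apply: (@le_trans _ _ (\sum_(0 <= k < n) (2^-1 ^+ k)%:E)%E); last first.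
    by rewrite sumEFin lee_fin.
  apply: lee_sum => k _; rewrite /a.
  under eq_integral => x _ do rewrite EFinM.
  rewrite ge0_integralZl_EFin ?exprn_ge0//; last 2 first.
  - by move=> x _; rewrite lee_fin nsq_ge0.
  - by apply/measurable_EFinP; exact: Cmeas_nsq.
  rewrite -L2normB_fun -EFinM lee_fin.
  have -> : 2^-1 ^+ k = 2 ^+ k * 4^-1 ^+ k :> R.
    by rewrite -exprMn; congr (_ ^+ _); lra.
  by rewrite ler_pM2l ?exprn_gt0//; apply: hf.
have Sfin : {ae mu, forall x, S x \is a fin_num}.
  by have := integrable_ae measurableT intS; apply: filterS => x; exact.
pose E := [set x | S x \is a fin_num].
have mE : measurable E.
  by rewrite -[E]setTI; exact: emeasurable_fin_num.
(* Cutting off outside [E] makes the sequence converge at every point, so that the limit is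
   measurable. *)
pose v n x := (\1_E x : R)%:C * u n x.
have mv n : Cmeas (v n) by apply: CmeasM => //; exact: Cmeas_indic.
have vu : {ae mu, forall x, forall n, v n x = u n x}.
  by apply: filterS Sfin => x Sx n; rewrite /v indicE mem_set// mul1r.
have cv x : cvgn (fun n => complex.Re (v n x)) /\ cvgn (fun n => complex.Im (v n x)).
  have [Sx|Sx] := pselect (E x); last first.
    rewrite /v indicE memNset//; split; under eq_fun do rewrite mul0r;
    exact: is_cvg_cst.
  rewrite /v indicE mem_set//; split; under eq_fun do rewrite mul1r.
    have : cvgn (series (fun k => complex.Re (d_ k x))).
      apply: summable_of_sq; move: Sx; rewrite /E/= ge0_fin_numE//; apply: le_lt_trans.
      apply: lee_nneseries => [k _ _|k _]; rewrite lee_fin.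
        by rewrite mulr_ge0 ?sqr_ge0 ?exprn_ge0.
      by rewrite ler_pM2l ?exprn_gt0// lerDl sqr_ge0.
    move=> /cvg_ex[l hl]; apply/cvg_ex; exists (complex.Re (u 0%N x) + l).
    rewrite (_ : (fun n => _) = fun n => complex.Re (u 0%N x) +
        series (fun k => complex.Re (d_ k x)) n).
      by apply: cvgD => //; exact: cvg_cst.
    apply/funext => n; rewrite /series/= -cRe_sum /d_ telescope_sumr//.
    by rewrite cReD cReN addrC subrK.
  have : cvgn (series (fun k => complex.Im (d_ k x))).
    apply: summable_of_sq; move: Sx; rewrite /E/= ge0_fin_numE//; apply: le_lt_trans.
    apply: lee_nneseries => [k _ _|k _]; rewrite lee_fin.
      by rewrite mulr_ge0 ?sqr_ge0 ?exprn_ge0.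
    by rewrite ler_pM2l ?exprn_gt0// lerDr sqr_ge0.
  move=> /cvg_ex[l hl]; apply/cvg_ex; exists (complex.Im (u 0%N x) + l).
  rewrite (_ : (fun n => _) = fun n => complex.Im (u 0%N x) +
      series (fun k => complex.Im (d_ k x)) n).
    by apply: cvgD => //; exact: cvg_cst.
  apply/funext => n; rewrite /series/= -cIm_sum /d_ telescope_sumr//.
  by rewrite cImD cImN addrC subrK.
pose h x := limn (fun n => complex.Re (v n x)) +i* limn (fun n => complex.Im (v n x)).
have vh x : Ccvg (v ^~ x) (h x) by apply/CcvgP; have [] := cv x.
have mh : Cmeas h.
  split; apply: (@measurable_fun_cvg _ _ _ setT).
  - by move=> n; exact: (mv n).1.
  - by move=> x _; have [] := cv x.
  - by move=> n; exact: (mv n).2.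
  - by move=> x _; have [] := cv x.
have bound m : (\int[mu]_x (nsq (h x - u m x))%:E <= (4^-1 ^+ m)%:E)%E.
  apply: (@fatou_bound _ _ _ mu (fun n x => nsq (v (n + m)%N x - u m x))).
  - by move=> n; apply: Cmeas_nsq; exact: CmeasB.
  - by move=> n x; exact: nsq_ge0.
  - move=> x; apply: (@cvg_comp _ _ _ (fun n => (n + m)%N) (fun n => nsq (v n x - u m x)) _ \oo).
      exact: cvg_addnr.
    have /CcvgP[] : Ccvg (fun n => v n x - u m x) (h x - u m x).
      by apply: CcvgD (Ccvg_cst _).
    by move=> h1 h2; apply: cvgD; rewrite expr2; under eq_fun do rewrite expr2; exact: cvgM.
  - move=> n; have := hf m (n + m)%N (leq_addl _ _); rewrite -lee_fin L2normB_fun.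
    apply: le_trans; rewrite le_eqVlt; apply/orP; left; apply/eqP.
    apply: ae_eq_integral => //.
    + by apply/measurable_EFinP; apply: Cmeas_nsq; exact: CmeasB.
    + apply/measurable_EFinP; apply: Cmeas_nsq; apply: sqint_meas; by apply: sqintB; exact: sqintegrable_L2.
    + by apply: filterS vu => x /(_ (n + m)%N) ->.
have hu m : sqintegrable mu (fun x => h x - u m x).
apply/sqintP; split; first exact: CmeasB.
  apply: Rintegrable_ge0.
  - by apply: Cmeas_nsq; exact: CmeasB.
  - by move=> x; exact: nsq_ge0.
  - by apply: le_lt_trans (bound m) _; exact: ltry.
have sh : sqintegrable mu h.
  rewrite (_ : h = fun x => (h x - u 0%N x) + u 0%N x); first exact: sqintegrableD.
  by apply/funext => x; rewrite subrK.
exists (toL2 mu h); split=> [m|].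
  rewrite -lee_fin -(toL2K (f_ m)) -toL2B //; last exact: sqintegrable_L2.
  rewrite EFin_L2norm_toL2; [exact: bound|exact: hu].
have := fun_toL2 sh; apply: filterS2 vu => x vux ->.
by rewrite (_ : (fun n => _) = v ^~ x)//; apply/funext => n; rewrite vux.
Qed.

End completeness.

(** * Hilbert spaces and extension of isometries *)

(** An abstract Hilbert space, so that one argument on spans and extensions serves L^2 of the
    intensity, the Fock space and L^2 of the probability. Completeness is stated for geometrically
    fast Cauchy sequences, the form delivered by [L2_fast_cvg]. *)
Record ipSpace (R : realType) := IpSpace {
  ip_car :> lmodType R[i];
  ip : ip_car -> ip_car -> R[i];
  ipDl : forall f g h, ip (f + g) h = ip f h + ip g h;
  ipZl : forall c f g, ip (c *: f) g = c * ip f g;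
  ipC : forall f g, ip g f = (ip f g)^*%C;
  ip_ge0 : forall f, 0 <= complex.Re (ip f f);
  ip_eq0 : forall f, complex.Re (ip f f) = 0 -> f = 0;
  ip_complete : forall fs : nat -> ip_car,
    (forall m k, (m <= k)%N -> complex.Re (ip (fs k - fs m) (fs k - fs m)) <= 4^-1 ^+ m) ->
    exists f, forall m, complex.Re (ip (f - fs m) (f - fs m)) <= 4^-1 ^+ m }.

Section inner_product.
Context {R : realType} {E : ipSpace R}.
Implicit Types f g h : E.
Local Open Scope complex_scope.

Definition ipnorm f : R := Num.sqrt (complex.Re (ip f f)).

Lemma ipDr f g h : ip f (g + h) = ip f g + ip f h.
Proof. by rewrite ipC ipDl rmorphD /= (ipC g f) (ipC h f). Qed.

Lemma ipZr c f g : ip f (c *: g) = c^* * ip f g.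
Proof. by rewrite ipC ipZl rmorphM /= (ipC g f). Qed.

Lemma ip0l f : ip 0 f = 0.
Proof. by rewrite -(scale0r (0 : E)) ipZl mul0r. Qed.

Lemma ip0r f : ip f 0 = 0.
Proof. by rewrite ipC ip0l conjc0. Qed.

Lemma ipNl f g : ip (- f) g = - ip f g.
Proof. by rewrite -scaleN1r ipZl mulN1r. Qed.

Lemma ipNr f g : ip f (- g) = - ip f g.
Proof. by rewrite ipC ipNl rmorphN /= (ipC g f). Qed.

Lemma ipBl f g h : ip (f - g) h = ip f h - ip g h.
Proof. by rewrite ipDl ipNl. Qed.

Lemma ipBr f g h : ip f (g - h) = ip f g - ip f h.
Proof. by rewrite ipDr ipNr. Qed.

Lemma ip_suml I (r : seq I) (F : I -> E) f :
  ip (\sum_(i <- r) F i) f = \sum_(i <- r) ip (F i) f.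
Proof.
elim: r => [|i r ih]; first by rewrite !big_nil ip0l.
by rewrite !big_cons ipDl ih.
Qed.

Lemma ip_sumr I (r : seq I) (F : I -> E) f :
  ip f (\sum_(i <- r) F i) = \sum_(i <- r) ip f (F i).
Proof.
elim: r => [|i r ih]; first by rewrite !big_nil ip0r.
by rewrite !big_cons ipDr ih.
Qed.

Lemma ipnorm_ge0 f : 0 <= ipnorm f. Proof. exact: sqrtr_ge0. Qed.

Lemma sqr_ipnorm f : ipnorm f ^+ 2 = complex.Re (ip f f).
Proof. by rewrite sqr_sqrtr// ip_ge0. Qed.

Lemma ipff f : ip f f = (ipnorm f ^+ 2)%:C.
Proof.
rewrite sqr_ipnorm; apply: complex_ext => //=.
by have := congr1 (@complex.Im R) (ipC f f); rewrite cImJ; lra.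
Qed.

Lemma ipnorm0 : ipnorm 0 = 0.
Proof. by rewrite /ipnorm ip0l /= sqrtr0. Qed.

Lemma ipnorm_eq0 f : ipnorm f = 0 -> f = 0.
Proof. by move=> f0; apply: ip_eq0; rewrite -sqr_ipnorm f0 expr0n. Qed.

Lemma ipnormZ c f : ipnorm (c *: f) = modc c * ipnorm f.
Proof.
apply/eqP; rewrite -(@eqrXn2 _ 2)// ?ipnorm_ge0 ?mulr_ge0 ?modc_ge0 ?ipnorm_ge0//.
rewrite exprMn sqr_modc !sqr_ipnorm ipZl ipZr mulrA mulcJ.
by rewrite cReM /= mul0r subr0.
Qed.

Lemma ipnormN f : ipnorm (- f) = ipnorm f.
Proof. by rewrite -scaleN1r ipnormZ modcN modc1 mul1r. Qed.

Lemma ipnormB f g : ipnorm (f - g) = ipnorm (g - f).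
Proof. by rewrite -ipnormN opprB. Qed.

(** The expansion of the squared norm of [b f - a g], with [b] and [F] the squared norms of [g] and
    [f] and [a] their inner product. *)
Let CauchySchwarz_identity (b F : R) (a : R[i]) :
  complex.Re (b%:C * ((b%:C)^* * F%:C) - b%:C * (a^* * a) -
    (a * ((b%:C)^* * a^*) - a * (a^* * b%:C))) = b * (b * F - nsq a).
Proof. by case: a => p q; rewrite /nsq/=; ring. Qed.

Lemma CauchySchwarz f g : modc (ip f g) <= ipnorm f * ipnorm g.
Proof.
have [g0|g0] := eqVneq (ipnorm g) 0.
  by rewrite (ipnorm_eq0 g0) ip0r modc0 ipnorm0 mulr0.
rewrite -(@ler_pXn2r _ 2)// ?nnegrE ?modc_ge0 ?mulr_ge0 ?ipnorm_ge0//.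
have gp : 0 < ipnorm g ^+ 2 by rewrite exprn_gt0// lt_neqAle eq_sym g0 ipnorm_ge0.
have := ip_ge0 ((ipnorm g ^+ 2)%:C *: f - ip f g *: g).
rewrite ipBl !ipBr !ipZl !ipZr !ipff (ipC f g) CauchySchwarz_identity.
by rewrite pmulr_rge0// subr_ge0 exprMn sqr_modc mulrC.
Qed.

Lemma sqr_ipnormD f g :
  ipnorm (f + g) ^+ 2 = ipnorm f ^+ 2 + 2 * complex.Re (ip f g) + ipnorm g ^+ 2.
Proof.
rewrite sqr_ipnorm ipDl !ipDr !ipff (ipC f g) !cReD cReJ /=.
by move: (complex.Re _) => t; ring.
Qed.

Lemma ipnormD f g : ipnorm (f + g) <= ipnorm f + ipnorm g.
Proof.
rewrite -(@ler_pXn2r _ 2)// ?nnegrE ?addr_ge0 ?ipnorm_ge0// sqr_ipnormD sqrrD.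
have h : complex.Re (ip f g) <= ipnorm f * ipnorm g.
  apply: le_trans (CauchySchwarz f g); apply: le_trans (Re_le_modc _).
  exact: ler_norm.
lra.
Qed.

Lemma ipnorm_triangle g f h : ipnorm (f - h) <= ipnorm (f - g) + ipnorm (g - h).
Proof. by rewrite (le_trans _ (ipnormD _ _))// addrA subrK. Qed.

Definition ipcvg (fs : nat -> E) f := ipnorm (fs n - f) @[n --> \oo] --> (0 : R).

Lemma ipcvg_cst f : ipcvg (fun=> f) f.
Proof. by rewrite /ipcvg subrr ipnorm0; exact: cvg_cst. Qed.

Lemma ipcvgD fs f gs g : ipcvg fs f -> ipcvg gs g ->
  ipcvg (fun n => fs n + gs n) (f + g).
Proof.
move=> ff gg; have h0 := cvg0D ff gg; apply: squeeze0 h0 => n.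
  exact: ipnorm_ge0.
by rewrite opprD addrACA ipnormD.
Qed.

Lemma ipcvgZ c fs f : ipcvg fs f -> ipcvg (fun n => c *: fs n) (c *: f).
Proof.
move=> ff; have h0 := cvg0Z (modc c) ff.
by apply: squeeze0 h0 => n; [exact: ipnorm_ge0|rewrite -scalerBr ipnormZ].
Qed.

Lemma ipcvg_unique fs f g : ipcvg fs f -> ipcvg fs g -> f = g.
Proof.
move=> ff fg; apply/eqP; rewrite -subr_eq0; apply/eqP/ipnorm_eq0.
have h : (fun=> ipnorm (f - g)) @ \oo --> (0 : R).
  have h0 := cvg0D ff fg; apply: squeeze0 h0 => n; first exact: ipnorm_ge0.
  by rewrite (ipnormB (fs n) f) ipnorm_triangle.
exact: (cvg_unique _ (cvg_cst (ipnorm (f - g))) h).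
Qed.

Lemma ipcvg_norm fs f : ipcvg fs f -> ipnorm (fs n) @[n --> \oo] --> ipnorm f.
Proof.
move=> ff; apply/subr_cvg0; apply/norm_cvg0P; apply: squeeze0 ff => // n.
rewrite ler_norml; apply/andP; split.
  by rewrite lerNl opprB lerBlDr ipnormB -{1}(subrK (fs n) f) ipnormD.
by rewrite lerBlDr -{1}(subrK f (fs n)) ipnormD.
Qed.

Lemma ipcvg_ip fs f gs g : ipcvg fs f -> ipcvg gs g ->
  Ccvg (fun n => ip (fs n) (gs n)) (ip f g).
Proof.
move=> ff gg; have h1 := cvg0M ff (ipcvg_norm gg).
have h2 := cvg0Z (ipnorm f) gg.
have h0 := cvg0D h1 h2; apply: squeeze0 h0 => n; first exact: modc_ge0.
have -> : ip (fs n) (gs n) - ip f g = ip (fs n - f) (gs n) + ip f (gs n - g).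
  by rewrite ipBl ipBr addrA subrK.
by rewrite (le_trans (modcD _ _))// lerD// CauchySchwarz.
Qed.

Lemma ipcvg_eps fs f : (forall n, ipnorm (fs n - f) <= 2^-1 ^+ n) -> ipcvg fs f.
Proof.
move=> h; apply: (@squeeze0 _ _ (fun n => 2^-1 ^+ n)) => [n|//|].
  exact: ipnorm_ge0.
by apply: cvg_expr; rewrite ger0_norm//; lra.
Qed.

Lemma ipcomplete (fs : nat -> E) :
  (forall m k, (m <= k)%N -> ipnorm (fs k - fs m) <= 2^-1 ^+ m) ->
  exists f, forall m, ipnorm (f - fs m) <= 2^-1 ^+ m.
Proof.
have e4 m : 4^-1 ^+ m = (2^-1 ^+ m) ^+ 2 :> R.
  by rewrite exprAC; congr (_ ^+ _); lra.
move=> hf; have [m k mk|f hfm] := @ip_complete R E fs.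
  by rewrite -sqr_ipnorm e4 lerXn2r ?nnegrE ?ipnorm_ge0 ?exprn_ge0//; exact: hf.
exists f => m; rewrite -(@ler_pXn2r _ 2)// ?nnegrE ?ipnorm_ge0 ?exprn_ge0//.
by rewrite -e4 sqr_ipnorm.
Qed.

Definition ipsub (K : set E) := K 0 /\ forall c f g, K f -> K g -> K (c *: f + g).

Definition ipclosed (K : set E) := forall f,
  (forall eps : R, 0 < eps -> exists2 g, K g & ipnorm (f - g) < eps) -> K f.

(** Convertible with [closed_span] when the space is [L2ip mu], so facts on abstract spans apply to
    [fock] as they stand. *)
Definition ipspan (S : set E) := smallest [set K | ipsub K /\ ipclosed K] S.

Lemma ipclosedP K fs f : ipclosed K -> (forall n, K (fs n)) -> ipcvg fs f -> K f.
Proof.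
move=> cK Kf ff; apply: cK => eps eps0.
have /cvgr0_norm_lt /(_ _ eps0)[N _ hN] := ff.
exists (fs N) => //; have := hN N (leqnn N).
by rewrite /= ger0_norm ?ipnorm_ge0// ipnormB.
Qed.

Lemma ipclosed_seq K f : (forall eps : R, 0 < eps -> exists2 g, K g & ipnorm (f - g) < eps) ->
  exists fs, (forall n, K (fs n)) /\ ipcvg fs f.
Proof.
move=> h; have /choice[fs hf] : forall n, exists g, K g /\ ipnorm (g - f) <= 2^-1 ^+ n.
  move=> n; have [|g Kg fg] := h (2^-1 ^+ n); first by rewrite exprn_gt0.
  by exists g; split => //; rewrite ipnormB ltW.
by exists fs; split => [n|]; [case: (hf n)|apply: ipcvg_eps => n; case: (hf n)].
Qed.

Lemma ipsub_sum K I (r : seq I) (F : I -> E) : ipsub K -> (forall i, K (F i)) ->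
  K (\sum_(i <- r) F i).
Proof.
move=> [K0 KD] KF; elim: r => [|i r ih]; first by rewrite big_nil.
by rewrite big_cons -[F i]scale1r; exact: KD.
Qed.

Lemma ipsubZ K c f : ipsub K -> K f -> K (c *: f).
Proof. by move=> [K0 KD] Kf; rewrite -[_ *: _]addr0; exact: KD. Qed.

Lemma ipsubD K f g : ipsub K -> K f -> K g -> K (f + g).
Proof. by move=> [K0 KD] Kf Kg; rewrite -[f]scale1r; exact: KD. Qed.

Lemma ipsubB K f g : ipsub K -> K f -> K g -> K (f - g).
Proof. by move=> [K0 KD] Kf Kg; rewrite addrC -scaleN1r; exact: KD. Qed.

Lemma ipspan_sub S : ipsub (ipspan S).
Proof.
split=> [K [[[]]]//|c f g hf hg K h]; case: (h) => [[[K0 KD]] _] _.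
by apply: KD; [exact: hf|exact: hg].
Qed.

Lemma ipspan_closed S : ipclosed (ipspan S).
Proof.
move=> f hf K h; case: (h) => [[_ cK] _]; apply: cK => eps /hf[g gS fg].
by exists g => //; exact: gS.
Qed.

Lemma ipspan_incl S : S `<=` ipspan S.
Proof. by move=> f Sf K [_]; exact. Qed.

Lemma ipspan_min S K : ipsub K -> ipclosed K -> S `<=` K -> ipspan S `<=` K.
Proof. by move=> sK cK SK f; apply. Qed.

Lemma ipspanS S S' : S `<=` S' -> ipspan S `<=` ipspan S'.
Proof.
move=> SS; apply: ipspan_min; [exact: ipspan_sub|exact: ipspan_closed|].
by move=> f /SS; exact: ipspan_incl.
Qed.

End inner_product.

Section isometries.
Context {R : realType} {E F : ipSpace R}.
Local Open Scope complex_scope.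

Definition ipbounded (K : set E) (T : E -> F) := exists M : R, forall f, K f ->
  ipnorm (T f) <= M * ipnorm f.

Definition iplinear (K : set E) (T : E -> F) := forall c f g, K f -> K g ->
  T (c *: f + g) = c *: T f + T g.

Lemma iplinear0 K T : ipsub K -> iplinear K T -> T 0 = 0.
Proof.
move=> [K0 _] /(_ (-1) 0 0 K0 K0).
by rewrite scaler0 addr0 scaleN1r addNr.
Qed.

Lemma iplinearB K T f g : iplinear K T -> K f -> K g -> T (f - g) = T f - T g.
Proof. by move=> lT Kf Kg; rewrite addrC -scaleN1r lT// scaleN1r addrC. Qed.

Lemma iplinearZ K T c f : ipsub K -> iplinear K T -> K f -> T (c *: f) = c *: T f.
Proof.
move=> sK lT Kf; rewrite -[_ *: _]addr0 lT//; last exact: sK.1.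
by rewrite (iplinear0 sK lT) addr0.
Qed.

Lemma ipbounded_cvg K T fs f : ipsub K -> iplinear K T -> ipbounded K T ->
  (forall n, K (fs n)) -> K f -> ipcvg fs f -> ipcvg (T \o fs) (T f).
Proof.
move=> sK lT [M hM] Kfs Kf ff.
have h0 := cvg0Z `|M| ff; apply: squeeze0 h0 => n.
  exact: ipnorm_ge0.
rewrite /= -(iplinearB lT)//; apply: le_trans (hM _ _) _; first exact: ipsubB.
by rewrite ler_wpM2r ?ipnorm_ge0 ?ler_norm.
Qed.

(** By linearity and continuity, the vectors of the span on which [T] and [T'] agree form a closed
    subspace. *)
Lemma ipspan_eq (S : set E) (T T' : E -> F) (K : set E) :
  ipsub K -> iplinear K T -> iplinear K T' -> ipbounded K T -> ipbounded K T' ->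
  ipspan S `<=` K -> (forall f, S f -> T f = T' f) ->
  forall f, ipspan S f -> T f = T' f.
Proof.
move=> sK lT lT' bT bT' SK TT' f.
(* Membership in the span is carried along because the two maps are controlled only on [K]. *)
suff : ipspan S `<=` [set f | ipspan S f /\ T f = T' f] by move=> /[apply] -[].
apply: ipspan_min => /= [|g hg|g Sg]; last first.
- by split; [exact: ipspan_incl|exact: TT'].
- have [gs [/= hgs gg]] := ipclosed_seq hg.
  have Sg : ipspan S g.
    by apply: ipclosedP gg; [exact: ipspan_closed|move=> n; case: (hgs n)].
  split=> //; apply: ipcvg_unique.
    apply: (ipbounded_cvg sK lT bT _ _ gg); last exact: SK.
    by move=> n; apply: SK; case: (hgs n).
  have := ipbounded_cvg sK lT' bT' (fun n => SK _ (hgs n).1) (SK _ Sg) gg.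
  by congr ipcvg; apply/funext => n /=; case: (hgs n).
split=> /=.
  split; first by have [] := ipspan_sub S.
  by rewrite (iplinear0 sK lT) (iplinear0 sK lT').
move=> c h1 h2 [S1 e1] [S2 e2]; split; first by apply: (ipspan_sub S).2.
by rewrite lT ?lT' ?e1 ?e2//; exact: SK.
Qed.

Definition ipisometric (K : set E) (T : E -> F) := forall f g, K f -> K g ->
  ip (T f) (T g) = ip f g.

Lemma ipscaled_bounded K (T : E -> F) (r : R) :
  (forall f g, K f -> K g -> ip (T f) (T g) = r%:C * ip f g) -> ipbounded K T.
Proof.
move=> h; exists (Num.sqrt `|r|) => f Kf.
rewrite -(@ler_pXn2r _ 2)// ?nnegrE ?mulr_ge0 ?sqrtr_ge0 ?ipnorm_ge0//.
rewrite exprMn (sqr_sqrtr (normr_ge0 r)) sqr_ipnorm h// ipff -rmorphM /=.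
by rewrite ler_wpM2r ?sqr_ge0 ?ler_norm.
Qed.

Lemma ipisometric_norm K T f : ipisometric K T -> K f -> ipnorm (T f) = ipnorm f.
Proof. by move=> iT Kf; rewrite /ipnorm iT. Qed.

Lemma ipisometric_bounded K T : ipisometric K T -> ipbounded K T.
Proof. by move=> iT; exists 1 => f Kf; rewrite mul1r (ipisometric_norm iT). Qed.

Lemma ipisometric_inj K T f g : ipsub K -> iplinear K T -> ipisometric K T ->
  K f -> K g -> T f = T g -> f = g.
Proof.
move=> sK lT iT Kf Kg fg; apply/eqP; rewrite -subr_eq0; apply/eqP/ipnorm_eq0.
rewrite -(ipisometric_norm iT); last exact: ipsubB.
by rewrite (iplinearB lT)// fg subrr ipnorm0.
Qed.

(** Preimages of a fast approximating sequence are fast Cauchy, since [T] preserves distances; their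
    limit is a preimage of the given point. *)
Lemma ipisometric_closed K T : ipsub K -> ipclosed K -> iplinear K T ->
  ipisometric K T -> ipsub (T @` K) /\ ipclosed (T @` K).
Proof.
move=> sK cK lT iT; split.
  split; first by exists 0; [exact: sK.1|exact: iplinear0 lT].
  move=> c _ _ [f Kf <-] [g Kg <-]; exists (c *: f + g); last exact: lT.
  exact: sK.2.
(* The exponent [n.+1] makes the sum of two errors at most [2^-m], as [ipcomplete] requires. *)
move=> g hg; have /choice[fs hf] : forall n, exists f, K f /\ ipnorm (g - T f) <= 2^-1 ^+ n.+1.
  move=> n; have [|_ [f Kf <-] gf] := hg (2^-1 ^+ n.+1); first by rewrite exprn_gt0.
  by exists f; split => //; exact: ltW.
have Kf n : K (fs n) by case: (hf n).
have [m k mk|f ff] := @ipcomplete R E fs.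
  rewrite -(ipisometric_norm iT); last exact: ipsubB.
  rewrite (iplinearB lT)// (le_trans (ipnorm_triangle g _ _))//.
  have h1 := (hf m).2; have h2 := (hf k).2.
  rewrite ipnormB (le_trans (lerD h2 h1))// !exprS.
  have : (2^-1 : R) ^+ k <= 2^-1 ^+ m by rewrite ler_wiXn2l//; lra.
  lra.
have cf : ipcvg fs f by apply: ipcvg_eps => n; rewrite ipnormB.
have Kf0 : K f by apply: ipclosedP cf.
exists f => //; apply: ipcvg_unique (ipbounded_cvg sK lT (ipisometric_bounded iT) Kf Kf0 cf) _.
apply: ipcvg_eps => n /=; rewrite ipnormB (le_trans (hf n).2)// exprS.
by rewrite ler_piMl ?exprn_ge0//; lra.
Qed.

(** One inclusion is continuity of [T], the other the closedness of its image. This computes the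
    ranges of the isometry and of the shifts from generators alone. *)
Lemma ipisometric_span K T S : ipsub K -> iplinear K T -> ipisometric K T ->
  ipspan S `<=` K -> T @` (ipspan S) = ipspan (T @` S).
Proof.
move=> sK lT iT SK; apply/seteqP; split; last first.
  have l1 : iplinear (ipspan S) T by move=> c f g /SK Kf /SK Kg; exact: lT.
  have i1 : ipisometric (ipspan S) T by move=> f g /SK Kf /SK Kg; exact: iT.
  have [h1 h2] := ipisometric_closed (ipspan_sub S) (ipspan_closed (S := S)) l1 i1.
  by apply: ipspan_min => // _ [f Sf <-]; exists f => //; exact: ipspan_incl.
move=> _ [f Sf <-].
suff : ipspan S `<=` [set f | ipspan S f /\ ipspan (T @` S) (T f)] by move=> /(_ f Sf)[].
apply: ipspan_min => /= [|g hg|g Sg]; last first.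
- by split; [|apply: ipspan_incl; exists g]; rewrite //; exact: ipspan_incl.
- have [gs [/= hgs gg]] := ipclosed_seq hg.
  have Sg : ipspan S g.
    by apply: ipclosedP gg; [exact: ipspan_closed|move=> n; case: (hgs n)].
  split=> //; apply: (@ipclosedP _ _ _ (T \o gs)); first exact: ipspan_closed.
    by move=> n; case: (hgs n).
  apply: (ipbounded_cvg sK lT (ipisometric_bounded iT) _ _ gg); last exact: SK.
  by move=> n; apply: SK; case: (hgs n).
split=> /=.
  split; first by have [] := ipspan_sub S.
  by rewrite (iplinear0 sK lT); have [] := ipspan_sub (T @` S).
move=> c h1 h2 [S1 e1] [S2 e2]; split; first by apply: (ipspan_sub S).2.
by rewrite lT; [exact: (ipspan_sub (T @` S)).2|exact: SK|exact: SK].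
Qed.

(** * Extension of maps that preserve inner products up to a factor *)

Section extension.
Context (I : Type) (s : I -> E) (t : I -> F) (r : R).
Hypothesis st : forall i j, ip (t i) (t j) = r%:C * ip (s i) (s j).
Hypothesis r0 : 0 <= r.

(** A relation rather than a function: the [s i] may be linearly dependent, and single-valuedness
    follows only from [st]. The factor [r] is 1 for isometries and the squared norm of a vector for
    multiplication by that vector. *)
Inductive span_graph : E -> F -> Prop :=
| span_graph0 : span_graph 0 0
| span_graphS c i f g : span_graph f g -> span_graph (c *: s i + f) (c *: t i + g).

Let graphD c f g f' g' : span_graph f g -> span_graph f' g' ->
  span_graph (c *: f + f') (c *: g + g').
Proof.
move=> h h'; elim: h => [|c0 i f0 g0 _ ih]; first by rewrite !scaler0 !add0r.
by rewrite !scalerDr !scalerA -!addrA; exact: span_graphS.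
Qed.

Let graph_ip f g f' g' : span_graph f g -> span_graph f' g' ->
  ip g g' = r%:C * ip f f'.
Proof.
move=> h h'; elim: h => [|c i f0 g0 _ ih]; first by rewrite !ip0l mulr0.
rewrite !ipDl !ipZl ih mulrDr; congr (_ + _); rewrite mulrCA; congr (_ * _).
elim: h' => [|c' j f1 g1 _ ih']; first by rewrite !ip0r mulr0.
by rewrite !ipDr !ipZr ih' st mulrDr; congr (_ + _); rewrite mulrCA.
Qed.

Definition closed_graph f g := exists fs gs,
  [/\ forall n, span_graph (fs n) (gs n), ipcvg fs f & ipcvg gs g].

Let cgraphD c f g f' g' : closed_graph f g -> closed_graph f' g' ->
  closed_graph (c *: f + f') (c *: g + g').
Proof.
move=> [fs [gs [fg ff gg]]] [fs' [gs' [fg' ff' gg']]].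
exists (fun n => c *: fs n + fs' n), (fun n => c *: gs n + gs' n); split.
- by move=> n; exact: graphD.
- by apply: ipcvgD => //; exact: ipcvgZ.
- by apply: ipcvgD => //; exact: ipcvgZ.
Qed.

Let cgraph_ip f g f' g' : closed_graph f g -> closed_graph f' g' ->
  ip g g' = r%:C * ip f f'.
Proof.
move=> [fs [gs [fg ff gg]]] [fs' [gs' [fg' ff' gg']]].
apply: (Ccvg_unique (ipcvg_ip gg gg')).
have -> : (fun n => ip (gs n) (gs' n)) = fun n => r%:C * ip (fs n) (fs' n).
  by apply/funext => n; exact: graph_ip.
by apply: CcvgM (ipcvg_ip ff ff'); exact: Ccvg_cst.
Qed.

(** The difference of the two pairs is [(0, g - g')], whose second component has squared norm
    [r * 0]. *)
Let cgraph_fun f g g' : closed_graph f g -> closed_graph f g' -> g = g'.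
Proof.
move=> h h'; apply/eqP; rewrite -subr_eq0; apply/eqP; apply: ip_eq0.
have hh := cgraphD (-1) h' h.
have -> : g - g' = -1 *: g' + g by rewrite scaleN1r addrC.
by rewrite (cgraph_ip hh hh) scaleN1r addNr ip0l mulr0.
Qed.

Let cgraph_closed f :
  (forall eps : R, 0 < eps -> exists2 f', (exists g', closed_graph f' g') & ipnorm (f - f') < eps) ->
  exists g, closed_graph f g.
Proof.
move=> h; have rp := r0.
(* Chosen so that both components are fast Cauchy: the second has squared increments at most
   [r (2 e_m)^2 = r 4^-m / (1 + r)^2 <= 4^-m], without dividing by [r], which may be 0. *)
pose e n : R := 2^-1 ^+ n / (2 * (1 + r)).
have e0 n : 0 < e n.
  have q : 0 < 2 * (1 + r) by move: r0; lra.
  by rewrite divr_gt0 ?exprn_gt0// invr_gt0.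
have /choice[p hp] : forall n, exists p, span_graph p.1 p.2 /\ ipnorm (f - p.1) <= e n.
  move=> n; have [|f' [g' [fs [gs [fg ff _]]]] ff'] := h (e n / 2); first by rewrite divr_gt0.
  have /cvgr0_norm_lt /(_ (e n / 2)) := ff.
  case; first by rewrite divr_gt0.
  move=> N _ /(_ N (leqnn N)) /=; rewrite ger0_norm ?ipnorm_ge0// => hN.
  exists (fs N, gs N); split => //=; rewrite (le_trans (ipnorm_triangle f' _ _))//.
  by rewrite (ipnormB f'); lra.
have [m k mk|g hg] := @ipcomplete R F (fun n => (p n).2).
  have := graphD (-1) (hp m).1 (hp k).1; rewrite !scaleN1r ![- _ + _]addrC => hmk.
  rewrite -(@ler_pXn2r _ 2)// ?nnegrE ?ipnorm_ge0 ?exprn_ge0//.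
  rewrite sqr_ipnorm (graph_ip hmk hmk) ipff -rmorphM /=.
  have h1 : ipnorm ((p k).1 - (p m).1) <= 2 * e m.
    rewrite (le_trans (ipnorm_triangle f _ _))// ipnormB.
    rewrite (le_trans (lerD (hp k).2 (hp m).2))//.
    have : e k <= e m.
      by rewrite ler_wpM2r ?invr_ge0 ?ler_wiXn2l//; lra.
    lra.
  have h2 : ipnorm ((p k).1 - (p m).1) ^+ 2 <= (2 * e m) ^+ 2.
    by rewrite lerXn2r ?nnegrE ?ipnorm_ge0// mulr_ge0// ltW.
  rewrite (le_trans (ler_wpM2l r0 h2))//.
  have -> : 2 * e m = 2^-1 ^+ m / (1 + r) by rewrite /e; field; lra.
  rewrite exprMn mulrCA ler_piMr ?sqr_ge0// exprVn.
  by rewrite ler_pdivrMr ?mul1r ?exprn_gt0//; nra.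
exists g, (fun n => (p n).1), (fun n => (p n).2); split.
- by move=> n; case: (hp n).
- apply: ipcvg_eps => n; rewrite ipnormB (le_trans (hp n).2)// ler_piMr ?exprn_ge0//.
  by rewrite invf_le1; lra.
- by apply: ipcvg_eps => n; rewrite ipnormB.
Qed.

Lemma isometric_extension : exists T : E -> F,
  [/\ iplinear (ipspan (range s)) T,
      forall f g, ipspan (range s) f -> ipspan (range s) g ->
        ip (T f) (T g) = r%:C * ip f g
    & forall i, T (s i) = t i].
Proof.
have g1 i : closed_graph (s i) (t i).
  exists (fun=> s i), (fun=> t i); split; try exact: ipcvg_cst.
  by move=> _; have := span_graphS 1 i span_graph0; rewrite !scale1r !addr0.
have dom : ipspan (range s) `<=` [set f | exists g, closed_graph f g].
  apply: ipspan_min => [|f|_ [i _ <-]]; last by exists (t i).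
    split; first by exists 0, (fun=> 0), (fun=> 0); split => [n||];
      [exact: span_graph0|exact: ipcvg_cst|exact: ipcvg_cst].
    by move=> c f f' [g hg] [g' hg']; exists (c *: g + g'); exact: cgraphD.
  exact: cgraph_closed.
pose T f := xget 0 [set g | closed_graph f g].
have TP f : ipspan (range s) f -> closed_graph f (T f).
  by move=> /dom[g hg]; exact: (@xgetPex _ 0 [set g | closed_graph f g] (ex_intro _ g hg)).
exists T; split.
- move=> c f g hf hg; apply: (@cgraph_fun (c *: f + g)).
    by apply: TP; exact: (ipspan_sub _).2.
  by apply: cgraphD; exact: TP.
- by move=> f g hf hg; apply: cgraph_ip; exact: TP.
- by move=> i; apply: (@cgraph_fun (s i)) => //; apply: TP; apply: ipspan_incl; exists i.
Qed.

End extension.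

End isometries.

Import HBNNSimple.

Section L2_ipSpace.
Context d (T : measurableType d) {R : realType}.
Variable mu : {measure set T -> \bar R}.
Local Open Scope complex_scope.

Let L2_ge0 (f : L2 mu) : 0 <= complex.Re (dot f f).
Proof. by rewrite dotff /= sqr_ge0. Qed.

Let L2_eq0 (f : L2 mu) : complex.Re (dot f f) = 0 -> f = 0.
Proof.
by rewrite dotff /= => /eqP; rewrite sqrf_eq0 => /eqP; exact: L2norm_eq0.
Qed.

Let L2_complete (f_ : nat -> L2 mu) :
  (forall m k, (m <= k)%N -> complex.Re (dot (f_ k - f_ m) (f_ k - f_ m)) <= 4^-1 ^+ m) ->
  exists f, forall m, complex.Re (dot (f - f_ m) (f - f_ m)) <= 4^-1 ^+ m.
Proof.
move=> h; have [m k mk|f [hf _]] := @L2_fast_cvg _ _ _ mu f_.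
  by have := h m k mk; rewrite dotff.
by exists f => m; rewrite dotff; exact: hf.
Qed.

Definition L2ip : ipSpace R := @IpSpace R (L2 mu) (@dot _ _ _ mu) (@dotDl _ _ _ mu)
  (@dotZl _ _ _ mu) (@dotC _ _ _ mu) L2_ge0 L2_eq0 L2_complete.

Lemma dotZr c (f g : L2 mu) : dot f (c *: g) = c^* * dot f g.
Proof. exact: (@ipZr _ L2ip). Qed.

Lemma cvg_subseq_id (u : nat -> R) (l : R) (s : nat -> nat) : (forall n, (n <= s n)%N) ->
  u @ \oo --> l -> (u \o s) @ \oo --> l.
Proof.
move=> hs ul; apply: (@cvg_comp _ _ _ s u _ \oo) => //.
move=> A [N _ hN]; exists N => // n /= Nn; apply: hN => /=.
exact: leq_trans Nn (hs n).
Qed.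

(** A fast subsequence converges almost everywhere by [L2_fast_cvg], and uniqueness of norm limits
    identifies its limit with [f]. The bound [n <= s n] lets other limits be taken along [s]. *)
Lemma L2cvg_ae_subseq (f_ : nat -> L2 mu) f : L2cvg f_ f ->
  exists s : nat -> nat, (forall n, (n <= s n)%N) /\
    {ae mu, forall x, Ccvg (fun n => fun_of_L2 (f_ (s n)) x) (fun_of_L2 f x)}.
Proof.
move=> ff.
have /choice[s hs] : forall n, exists N, (n <= N)%N /\ L2norm (f_ N - f) <= 2^-1 ^+ n.+1.
  move=> n; have e0 : (0 : R) < 2^-1 ^+ n.+1 by rewrite exprn_gt0.
  have /cvgr0_norm_lt /(_ _ e0)[N _ hN] := ff.
  exists (maxn n N); split; first exact: leq_maxl.
  by have := hN (maxn n N) (leq_maxr _ _); rewrite /= => /ltW; apply: le_trans; exact: ler_norm.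
have [m k mk|g [gs gae]] := @L2_fast_cvg _ _ _ mu (f_ \o s).
  have -> : 4^-1 ^+ m = (2^-1 ^+ m) ^+ 2 :> R.
    by rewrite exprAC; congr (_ ^+ _); lra.
  rewrite lerXn2r ?nnegrE ?L2norm_ge0 ?exprn_ge0//=.
  have t := @ipnorm_triangle R L2ip f (f_ (s k)) (f_ (s m)).
  apply: le_trans t _.
  have -> : ipnorm (E := L2ip) (f - f_ (s m)) = L2norm (f_ (s m) - f) by exact: (@ipnormB _ L2ip).
  rewrite (le_trans (lerD (hs k).2 (hs m).2))// !exprS.
  have : (2^-1 : R) ^+ k <= 2^-1 ^+ m by rewrite ler_wiXn2l//; lra.
  lra.
exists s; split; first by move=> n; case: (hs n).
suff -> : f = g by [].
apply: (@ipcvg_unique R L2ip (f_ \o s)).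
  by have := cvg_subseq_id (fun n => (hs n).1) ff.
apply: ipcvg_eps => n; rewrite ipnormB /=.
rewrite -(@ler_pXn2r _ 2)// ?nnegrE ?ipnorm_ge0 ?exprn_ge0//.
rewrite exprAC (_ : 2^-1 ^+ 2 = 4^-1 :> R); last by lra.
exact: gs.
Qed.

Lemma sqr_cvg0 (u : nat -> R) : (forall n, 0 <= u n) ->
  u n ^+ 2 @[n --> \oo] --> (0 : R) -> u @ \oo --> (0 : R).
Proof.
move=> u0 h; apply/cvgr0Pnorm_lt => e e0.
have e20 : 0 < e ^+ 2 by rewrite exprn_gt0.
have /cvgr0_norm_lt /(_ _ e20)[N _ hN] := h.
exists N => // n /= Nn; have := hN n Nn; rewrite /= !ger0_norm ?sqr_ge0//.
by rewrite ltr_pXn2r ?nnegrE// ltW.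
Qed.

Lemma sqint_Ccvg_dominated (h_ : nat -> T -> R[i]) (h g : T -> R[i]) :
  (forall n, Cmeas (h_ n)) -> Cmeas h ->
  (forall n x, modc (h_ n x) <= modc (g x)) -> (forall x, modc (h x) <= modc (g x)) ->
  sqintegrable mu g -> {ae mu, forall x, Ccvg (h_ ^~ x) (h x)} ->
  L2cvg (fun n => toL2 mu (h_ n)) (toL2 mu h).
Proof.
move=> mh_ mh hg_ hg ig ch; apply: sqr_cvg0 => [n|]; first exact: L2norm_ge0.
have ih_ n : sqintegrable mu (h_ n) by exact: sqint_le (hg_ n) ig.
have ih : sqintegrable mu h by exact: sqint_le hg ig.
rewrite (_ : (fun n => _) = fun n => \int[mu]_x nsq (h_ n x - h x)); last first.
  by apply/funext => n; rewrite -toL2B// sqr_L2norm_toL2//; exact: sqintB.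
have -> : (0 : R) = \int[mu]_(x in setT) (fun=> 0) x.
  by rewrite /Rintegral integral0.
(* [nsqD_le] bounds the integrand by [2 (|h_n|^2 + |h|^2)], hence by [4 |g|^2]. *)
apply: (@Rdominated _ _ _ mu _ _ (fun x => 4 * nsq (g x))).
- by move=> n; apply: Cmeas_nsq; exact: CmeasB.
- exact: measurable_cst.
- apply: filterS ch => x /CcvgP[c1 c2].
  rewrite -[X in _ --> X]addr0; apply: cvgD.
    rewrite -[X in _ --> X](expr0n R 2); under eq_fun do rewrite cReD cReN expr2.
    by rewrite expr2 -(subrr (complex.Re (h x))); apply: cvgM; apply: cvgB => //; exact: cvg_cst.
  rewrite -[X in _ --> X](expr0n R 2); under eq_fun do rewrite cImD cImN expr2.
  by rewrite expr2 -(subrr (complex.Im (h x))); apply: cvgM; apply: cvgB => //; exact: cvg_cst.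
- by apply: RintegrableZ; exact: sqint_nsq.
- move=> n; apply: aeW => x; rewrite ger0_norm ?nsq_ge0//.
  rewrite (le_trans (nsqD_le _ _))//.
  have e w : modc w <= modc (g x) -> nsq w <= nsq (g x).
    by move=> le; rewrite -!sqr_modc lerXn2r ?nnegrE ?modc_ge0.
  have := e _ (hg_ n x); have := hg x; rewrite -modcN => /e; lra.
Qed.

End L2_ipSpace.

(** * Approximation by functions with finite range *)

Section simple_approximation.
Context d (T : measurableType d) {R : realType}.
Local Open Scope complex_scope.

Let nonneg_approx (g : T -> R) : measurable_fun setT g -> (forall x, 0 <= g x) ->
  exists s : nat -> T -> R, [/\ forall n, measurable_fun setT (s n),
    forall n, finite_set (range (s n)), forall n x, 0 <= s n x <= g x
    & forall x, s ^~ x @ \oo --> g x].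
Proof.
move=> mg g0; have mg' : measurable_fun setT (EFin \o g) by exact/measurable_EFinP.
pose a := nnsfun_approx measurableT mg'.
have ca x : a ^~ x @ \oo --> g x.
  have /fine_cvg := @cvg_nnsfun_approx _ _ _ setT measurableT _ mg' (fun x _ => g0 x) x Logic.I.
  by [].
exists (fun n => a n); split=> //.
move=> n x; apply/andP; split; first exact: fun_ge0.
have nd : nondecreasing_seq (a ^~ x).
  move=> m k mk; have /lefP := @nd_nnsfun_approx _ _ _ setT measurableT _ mg' _ _ mk; exact.
have := nondecreasing_cvgn_le nd (cvgP _ (ca x)) n.
by rewrite (cvg_lim _ (ca x)).
Qed.

Let real_approx (g : T -> R) : measurable_fun setT g ->
  exists s : nat -> T -> R, [/\ forall n, measurable_fun setT (s n),
    forall n, finite_set (range (s n)), forall n x, `|s n x| <= `|g x|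
    & forall x, s ^~ x @ \oo --> g x].
Proof.
move=> mg.
have mp : measurable_fun setT (fun x => Num.max (g x) 0).
  by apply: measurable_maxr => //; exact: measurable_cst.
have mn : measurable_fun setT (fun x => Num.max (- g x) 0).
  by apply: measurable_maxr; [exact: measurable_funN|exact: measurable_cst].
have [|a [ma fa a0 ca]] := nonneg_approx mp; first by move=> x; rewrite le_max lexx orbT.
have [|b [mb fb b0 cb]] := nonneg_approx mn; first by move=> x; rewrite le_max lexx orbT.
exists (fun n x => a n x - b n x); split.
- by move=> n; exact: measurable_funB.
- move=> n; apply: (@sub_finite_set _ _ [set x - y | x in range (a n) & y in range (b n)]).
    by move=> _ [x _ <-]; exists (a n x); [exists x|exists (b n x); [exists x|]].
  exact: finite_image2.
- move=> n x; have /andP[a1 a2] := a0 n x; have /andP[b1 b2] := b0 n x.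
  have [gx|gx] := leP 0 (g x).
    rewrite (ger0_norm gx); rewrite (max_idPl gx) in a2.
    have gn : - g x <= 0 by lra.
    rewrite (max_idPr gn) in b2; rewrite ger0_norm; lra.
  rewrite (ltr0_norm gx); rewrite (max_idPr (ltW gx)) in a2.
  have gn : 0 <= - g x by lra.
  rewrite (max_idPl gn) in b2; rewrite ler0_norm; lra.
- move=> x; have -> : g x = Num.max (g x) 0 - Num.max (- g x) 0.
    by case: (leP (g x) 0) => ?; case: (leP (- g x) 0) => ?; lra.
  by apply: cvgB.
Qed.

(** The approximants stay below [f] in modulus, so [f] itself dominates them in L^2; this is why
    positive and negative parts are approximated separately. *)
Lemma Cmeas_simple_approx (f : T -> R[i]) : Cmeas f ->
  exists s : nat -> T -> R[i], [/\ forall n, Cmeas (s n),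
    forall n, finite_set (range (s n)), forall n x, modc (s n x) <= modc (f x)
    & forall x, Ccvg (s ^~ x) (f x)].
Proof.
move=> [f1 f2]; have [a [ma fa ba ca]] := real_approx f1.
have [b [mb fb bb cb]] := real_approx f2.
exists (fun n x => a n x +i* b n x); split.
- by move=> n; split => /=; [exact: ma|exact: mb].
- move=> n; apply: (@sub_finite_set _ _ [set x +i* y | x in range (a n) & y in range (b n)]).
    by move=> _ [x _ <-]; exists (a n x); [exists x|exists (b n x); [exists x|]].
  exact: finite_image2.
- move=> n x; rewrite ler_wsqrtr// lerD//=.
    by rewrite -(real_normK (num_real (a n x))) -(real_normK (num_real (complex.Re (f x)))) lerXn2r ?nnegrE.
  by rewrite -(real_normK (num_real (b n x))) -(real_normK (num_real (complex.Im (f x)))) lerXn2r ?nnegrE.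
- by move=> x; apply/CcvgP; split; [exact: ca|exact: cb].
Qed.

End simple_approximation.

(** * The exponential series *)

Section exponential_sums.
Context {K : numFieldType}.
Implicit Types z w : K.

Definition expsum n z : K := \sum_(0 <= k < n) z ^+ k / k`!%:R.

Lemma expsumD n z w : expsum n (z + w) =
  \sum_(0 <= i < n) \sum_(0 <= j < n - i) (z ^+ i / i`!%:R) * (w ^+ j / j`!%:R).
Proof.
elim: n => [|n ih]; first by rewrite /expsum !big_geq.
rewrite /expsum big_nat_recr//= -/(expsum n (z + w)) ih.
rewrite big_nat_recr//= subSnn big_nat1.
under [in RHS]eq_big_nat => i /andP[_ ni].
  rewrite subSn ?(ltnW ni)// big_nat_recr//=.
  over.
rewrite big_split/= -addrA; congr (_ + _).
rewrite addrC [z + w]addrC exprDn -(big_mkord xpredT (fun i => w ^+ (n - i) * z ^+ i *+ 'C(n, i))).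
rewrite big_nat_recr//= mulrDl addrC mulr_suml; congr (_ + _).
  apply: eq_big_nat => i /andP[_ ni].
  have := bin_fact (ltnW ni) => /(congr1 (fun k => k%:R : K)).
  rewrite !natrM => e.
  have h1 : (i`!%:R : K) != 0 by rewrite pnatr_eq0 -lt0n fact_gt0.
  have h2 : ((n - i)`!%:R : K) != 0 by rewrite pnatr_eq0 -lt0n fact_gt0.
  have h3 : ('C(n, i)%:R : K) != 0 by rewrite pnatr_eq0 -lt0n bin_gt0 ltnW.
  by rewrite -e -mulr_natr; field; rewrite h1 h2 h3.
by rewrite subnn expr0 mul1r binn fact0 invr1 !mulr1.
Qed.

(** The error is a polynomial in [z] and [w] with nonnegative coefficients, so for complex arguments
    its modulus is at most its value at the moduli. Working over any [numFieldType] gives the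
    complex and the real version at once. *)
Lemma expsumM n z w : expsum n z * expsum n w - expsum n (z + w) =
  \sum_(0 <= i < n) \sum_(n - i <= j < n) (z ^+ i / i`!%:R) * (w ^+ j / j`!%:R).
Proof.
rewrite expsumD mulr_suml -sumrB; apply: eq_big_nat => i /andP[_ ni].
rewrite mulr_sumr (@big_cat_nat _ _ _ (n - i)%N 0 n) ?leq_subr//=.
by rewrite [LHS]addrC addKr.
Qed.

End exponential_sums.

Section complex_exponential_series.
Context {R : realType}.
Implicit Types (z w : R[i]) (x : R).
Local Open Scope complex_scope.

Lemma modcV z : modc z^-1 = (modc z)^-1.
Proof. by rewrite !modcE Normc.normcV. Qed.

Lemma natrC n : (n%:R : R[i]) = (n%:R : R)%:C.
Proof. by rewrite rmorph_nat. Qed.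

Lemma modc_nat n : modc (n%:R : R[i]) = n%:R.
Proof. by rewrite natrC modc_real ger0_norm. Qed.

Lemma modc_sum I (r : seq I) (P : pred I) (F : I -> R[i]) :
  modc (\sum_(i <- r | P i) F i) <= \sum_(i <- r | P i) modc (F i).
Proof.
elim/big_rec2: _ => [|i y x _ h]; first by rewrite modc0.
by rewrite (le_trans (modcD _ _))// lerD2l.
Qed.

Lemma modc_expterm z k : modc (z ^+ k / k`!%:R) = modc z ^+ k / k`!%:R.
Proof. by rewrite modcM modcX modcV modc_nat. Qed.

(** The exponential as a power series, the form produced by the levels of the Fock space and by the
    Poisson generating function; [Cexp], built from cosine and sine, enters through the values of
    [ell]. *)
Definition cexps z : R[i] := limn (fun n => complex.Re (expsum n z)) +i*
  limn (fun n => complex.Im (expsum n z)).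

Lemma expsum_expR x : expsum n x @[n --> \oo] --> expR x.
Proof. exact: (is_cvg_series_exp_coeff x). Qed.

Lemma cexps_cvg z : Ccvg (fun n => expsum n z) (cexps z).
Proof.
have dom (u : nat -> R) : (forall k, `|u k| <= modc z ^+ k / k`!%:R) -> cvgn (series u).
  move=> hu; apply: normed_cvg.
  apply: (@series_le_cvg _ _ (exp_coeff (modc z))) => //.
  - by move=> n /=; exact: normr_ge0.
  - by move=> n; apply: exp_coeff_ge0; exact: modc_ge0.
  - exact: is_cvg_series_exp_coeff.
apply/CcvgP; split.
  rewrite /expsum /=; under eq_fun do rewrite cRe_sum.
  by apply: dom => k; rewrite -modc_expterm Re_le_modc.
rewrite /expsum /=; under eq_fun do rewrite cIm_sum.
by apply: dom => k; rewrite -modc_expterm Im_le_modc.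
Qed.

(** [expsumM] bounds the error at [z], [w] by the error at their moduli, which tends to 0 because
    [expR] is multiplicative. *)
Lemma cexpsD z w : cexps (z + w) = cexps z * cexps w.
Proof.
have h := CcvgM (cexps_cvg z) (cexps_cvg w).
have h' := CcvgD h (CcvgM (Ccvg_cst (-1)) (cexps_cvg (z + w))).
suff h0 : Ccvg (fun n => expsum n z * expsum n w + -1 * expsum n (z + w)) 0.
  have := Ccvg_unique h' h0; rewrite mulN1r => /eqP.
  by rewrite subr_eq0 => /eqP.
have r0 : expsum n (modc z) * expsum n (modc w) - expsum n (modc z + modc w)
    @[n --> \oo] --> (0 : R).
  rewrite -(subrr (expR (modc z + modc w))) {1}expRD.
  by apply: cvgB; [apply: cvgM|]; exact: expsum_expR.
apply: squeeze0 r0 => n; first exact: modc_ge0.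
rewrite subr0 mulN1r !expsumM.
rewrite (le_trans (modc_sum _ _ _))//; apply: ler_sum => i _.
rewrite (le_trans (modc_sum _ _ _))//; apply: ler_sum => j _.
by rewrite modcM !modc_expterm.
Qed.

Lemma expsumJ n z : expsum n (z^*) = (expsum n z)^*.
Proof.
rewrite /expsum rmorph_sum; apply: eq_bigr => k _.
by rewrite rmorphM rmorphXn /= conjc_inv conjc_nat.
Qed.

Lemma CcvgJ (u : nat -> R[i]) l : Ccvg u l -> Ccvg (fun n => (u n)^*) (l^*).
Proof.
by apply: squeeze0 => n; [exact: modc_ge0|rewrite -rmorphB modcJ].
Qed.

Lemma cexpsJ z : cexps (z^*) = (cexps z)^*.
Proof.
apply: (Ccvg_unique (cexps_cvg _)).
by under eq_fun do rewrite expsumJ; apply: CcvgJ; exact: cexps_cvg.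
Qed.

Lemma cexps_real x : cexps x%:C = (expR x)%:C.
Proof.
apply: (Ccvg_unique (cexps_cvg _)); apply: squeeze0 (_ : `|expsum n x - expR x| @[n --> \oo] --> (0 : R)) => [n|n|].
- exact: modc_ge0.
- rewrite (_ : expsum n x%:C = (expsum n x)%:C) -?rmorphB ?modc_real//.
  rewrite /expsum rmorph_sum; apply: eq_bigr => k _.
  by rewrite rmorphM rmorphXn fmorphV rmorph_nat.
- by apply/norm_cvg0P/subr_cvg0; exact: expsum_expR.
Qed.

Lemma cexps0 : cexps 0 = 1.
Proof. by have := cexps_real 0; rewrite expR0. Qed.

Lemma cexps_neq0 z : cexps z != 0.
Proof.
apply/eqP => z0; have := cexpsD z (- z).
rewrite subrr z0 mul0r cexps0 => /eqP.
by rewrite oner_eq0.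
Qed.

Lemma cexps_sub1 z : modc (cexps z - 1) <= expR (modc z) - 1.
Proof.
have h1 : modc (expsum n z - 1) @[n --> \oo] --> modc (cexps z - 1).
  have := CcvgD (cexps_cvg z) (Ccvg_cst (- 1)) => h.
  apply/subr_cvg0; apply/norm_cvg0P; apply: squeeze0 h => // n.
  rewrite ler_norml; apply/andP; split.
    rewrite lerNl opprB lerBlDr modcB -{1}(subrK (expsum n z - 1) (cexps z - 1)).
    exact: modcD.
  by rewrite lerBlDr -{1}(subrK (cexps z - 1) (expsum n z - 1)); exact: modcD.
have h2 : expsum n (modc z) - 1 @[n --> \oo] --> expR (modc z) - 1.
  by apply: cvgB; [exact: expsum_expR|exact: cvg_cst].
(* From one term on, the constant terms cancel and the remaining sums compare termwise. *)
apply: ler_cvg_to h1 h2 _; exists 1%N => // n /= n1.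
rewrite -(prednK n1) /expsum !big_nat_recl// !expr0 fact0 !divr1 ![1 + _]addrC !addrK.
by rewrite (le_trans (modc_sum _ _ _))//; apply: ler_sum => k _; rewrite modc_expterm.
Qed.

Lemma Ccvg_cexps (u : nat -> R[i]) l : Ccvg u l -> Ccvg (fun n => cexps (u n)) (cexps l).
Proof.
move=> ul.
have h : modc (cexps l) * (expR (modc (u n - l)) - 1) @[n --> \oo] --> (0 : R).
  have e : expR (modc (u n - l)) @[n --> \oo] --> expR (0 : R).
    by apply: (@cvg_comp _ _ _ (fun n => modc (u n - l)) expR _ _ _ ul); exact: continuous_expR.
  apply: cvg0Z; rewrite expR0 in e; rewrite -(subrr (1 : R)).
  by apply: cvgB => //; exact: cvg_cst.
apply: squeeze0 h => n; first exact: modc_ge0.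
rewrite (_ : cexps (u n) - cexps l = cexps l * (cexps (u n - l) - 1)).
  by rewrite modcM ler_wpM2l ?modc_ge0 ?cexps_sub1.
by rewrite mulrBr mulr1 -cexpsD [l + _]addrC subrK.
Qed.

Lemma cexps_sum I (r : seq I) (F : I -> R[i]) :
  cexps (\sum_(i <- r) F i) = \prod_(i <- r) cexps (F i).
Proof.
elim: r => [|i r ih]; first by rewrite !big_nil cexps0.
by rewrite !big_cons cexpsD ih.
Qed.

Lemma CexpD z w : Cexp (z + w) = Cexp z * Cexp w.
Proof.
case: z w => [a b] [c d]; rewrite /Cexp/= expRD cosD sinD.
by apply: complex_ext => /=; ring.
Qed.

Lemma Cexp0 : Cexp (0 : R[i]) = 1.
Proof. by apply: complex_ext; rewrite /Cexp/= expR0 cos0 sin0; ring. Qed.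

Lemma Cexp_sum I (r : seq I) (F : I -> R[i]) :
  Cexp (\sum_(i <- r) F i) = \prod_(i <- r) Cexp (F i).
Proof.
elim: r => [|i r ih]; first by rewrite !big_nil Cexp0.
by rewrite !big_cons CexpD ih.
Qed.

(** Counts are natural numbers, so the value of [Cexp (ell z * n)] is [z ^+ n] whatever the branch
    [ell]. *)
Lemma Cexp_natmul n z : Cexp (z * n%:R) = Cexp z ^+ n.
Proof.
elim: n => [|n ih]; first by rewrite mulr0 Cexp0 expr0.
by rewrite -[n.+1]addn1 natrD mulrDr mulr1 CexpD ih exprD expr1.
Qed.

End complex_exponential_series.
Arguments cexps : simpl never.

(** * Integrals of products over product measures and powers *)

Section product_integral.
Context d1 d2 (T1 : measurableType d1) (T2 : measurableType d2) {R : realType}.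
Variables (m1 : {sigma_finite_measure set T1 -> \bar R}).
Variables (m2 : {sigma_finite_measure set T2 -> \bar R}).
Local Open Scope complex_scope.

Lemma ge0_integral_prodM (f : T1 -> R) (g : T2 -> R) :
  measurable_fun setT f -> measurable_fun setT g ->
  (forall x, 0 <= f x) -> (forall y, 0 <= g y) ->
  (\int[m1 \x m2]_p (f p.1 * g p.2)%:E =
    (\int[m1]_x (f x)%:E) * (\int[m2]_y (g y)%:E))%E.
Proof.
move=> mf mg f0 g0; rewrite fubini_tonelli1/=.
- rewrite /fubini_F/=.
  transitivity (\int[m1]_x ((f x)%:E * \int[m2]_y (g y)%:E))%E.
    apply: eq_integral => x _; under eq_integral do rewrite EFinM.
    rewrite ge0_integralZl_EFin//; last exact/measurable_EFinP.
    by move=> y _; rewrite lee_fin.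
  rewrite ge0_integralZr//; first exact/measurable_EFinP.
    by move=> x _; rewrite lee_fin.
  by apply: integral_ge0 => y _; rewrite lee_fin.
- apply/measurable_EFinP; apply: measurable_funM; exact: measurableT_comp.
- by move=> p; rewrite lee_fin mulr_ge0.
Qed.

Lemma Rintegrable_prodM (f : T1 -> R) (g : T2 -> R) :
  Rintegrable m1 f -> Rintegrable m2 g ->
  Rintegrable (m1 \x m2)%E (fun p => f p.1 * g p.2) /\
  Rintegral (m1 \x m2)%E setT (fun p => f p.1 * g p.2) =
    (Rintegral m1 setT f) * (Rintegral m2 setT g).
Proof.
move=> jf jg; have mf := Rintegrable_meas jf; have mg := Rintegrable_meas jg.
have int : Rintegrable (m1 \x m2)%E (fun p => f p.1 * g p.2).
  apply/integrableP; split.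
    by apply/measurable_EFinP; apply: measurable_funM; exact: measurableT_comp.
  under eq_integral => p _ do rewrite /= normrM.
  rewrite (ge0_integral_prodM (f := fun x => `|f x|) (g := fun x => `|g x|))//; last 2 first.
  - exact: measurableT_comp.
  - exact: measurableT_comp.
  have [/integrableP[_ h1] /integrableP[_ h2]] := (jf, jg).
  by apply: lte_mul_pinfty => //; [exact: integral_ge0|rewrite ge0_fin_numE ?integral_ge0].
split => //; apply: EFin_inj; rewrite EFin_Rintegral// -integral12_prod_meas1// EFinM.
rewrite (EFin_Rintegral jf) /fubini_F/= -integralZr//.
apply: eq_integral => x _; rewrite EFin_Rintegral// -integralZl//.
Qed.

Lemma Cintegrable_prodM (f : T1 -> R[i]) (g : T2 -> R[i]) :
  Cintegrable m1 f -> Cintegrable m2 g ->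
  Cintegrable (m1 \x m2)%E (fun p => f p.1 * g p.2) /\
  Cintegral (m1 \x m2)%E setT (fun p => f p.1 * g p.2) =
    Cintegral m1 setT f * Cintegral m2 setT g.
Proof.
move=> [f1 f2] [g1 g2].
have [a1 b1] := Rintegrable_prodM f1 g1; have [a2 b2] := Rintegrable_prodM f2 g2.
have [a3 b3] := Rintegrable_prodM f1 g2; have [a4 b4] := Rintegrable_prodM f2 g1.
split.
  split; first by under eq_fun do rewrite cReM; exact: RintegrableB.
  by under eq_fun do rewrite cImM; exact: RintegrableD.
apply: complex_ext; rewrite ?(cReM, cImM) /= -?(b1, b2, b3, b4).
  by rewrite -RintegralB//; apply: eq_Rintegral => p _ /=; rewrite cReM.
by rewrite -RintegralD//; apply: eq_Rintegral => p _ /=; rewrite cImM.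
Qed.

End product_integral.

Section tuple_measure_integral.
Context d (T : measurableType d) {R : realType}.
Variable mu : {sigma_finite_measure set T -> \bar R}.
Local Open Scope complex_scope.

Lemma Cmeas_tuple_prod n (f : T -> R[i]) : Cmeas f ->
  Cmeas (fun t : n.-tuple T => \prod_(y <- t) f y).
Proof.
move=> mf; under eq_fun do rewrite big_tuple.
by apply: Cmeas_prod => i _; apply: Cmeas_comp => //; exact: measurable_tnth.
Qed.

Lemma measurable_tuple_prod n (f : T -> R) : measurable_fun setT f ->
  measurable_fun setT (fun t : n.-tuple T => \prod_(y <- t) f y).
Proof.
move=> mf; have [h _] := Cmeas_tuple_prod n (Cmeas_real mf).
apply: eq_measurable_fun h => t _ /=.
by rewrite -rmorph_prod.
Qed.

Lemma ge0_integral_tuple_prod n (f : T -> R) : measurable_fun setT f ->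
  (forall x, 0 <= f x) ->
  (\int[tuple_measure mu n]_t (\prod_(y <- t) f y)%:E = (\int[mu]_x (f x)%:E) ^+ n)%E.
Proof.
move=> mf f0; elim: n => [|n ih].
  rewrite /= integral_dirac//; last first.
    by apply/measurable_EFinP; exact: measurable_tuple_prod.
  by rewrite big_nil diracT mul1e.
rewrite expeS -ih /=.
rewrite (ge0_integral_pushforward (measurable_cons_pair (n := n)))//; last 2 first.
- by apply/measurable_EFinP; exact: measurable_tuple_prod.
- by move=> t _; rewrite lee_fin prodr_ge0.
rewrite -(ge0_integral_prodM mu (tuple_measure mu n) mf)//; last 2 first.
- exact: measurable_tuple_prod.
- by move=> t; rewrite prodr_ge0.
by apply: eq_integral => p _ /=; rewrite big_cons.
Qed.

Lemma Cintegral_tuple_prod n (f : T -> R[i]) : Cintegrable mu f ->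
  Cintegrable (tuple_measure mu n) (fun t => \prod_(y <- t) f y) /\
  Cintegral (tuple_measure mu n) setT (fun t => \prod_(y <- t) f y) =
    (Cintegral mu setT f) ^+ n.
Proof.
move=> jf; have mf := Cintegrable_meas jf; elim: n => [|n [ih1 ih2]].
  have [m1 m2] := Cmeas_tuple_prod 0 mf.
  split.
    split; apply/integrableP; split; try exact/measurable_EFinP.
      rewrite /= integral_dirac//; first by rewrite diracT mul1e ltry.
      by do 2 apply: measurableT_comp => //.
    rewrite /= integral_dirac//; first by rewrite diracT mul1e ltry.
    by do 2 apply: measurableT_comp => //.
  apply: complex_ext; rewrite /= /Rintegral/= integral_dirac//;
    try exact/measurable_EFinP.
    by rewrite diracT mul1e big_nil.
  by rewrite diracT mul1e big_nil.
have [h1 h2] := Cintegrable_prodM jf ih1.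
have [p1 p2] := Cmeas_tuple_prod n.+1 mf.
have e : (fun p : T * n.-tuple T => \prod_(y <- cons_pair p) f y) =
    fun p => f p.1 * \prod_(y <- p.2) f y.
  by apply/funext => p; rewrite /= big_cons.
have [h3 h4] : Cintegrable (mu \x tuple_measure mu n)%E
    (fun p => \prod_(y <- cons_pair p) f y).
  by rewrite e.
split.
  split; apply: integrable_pushforward => //; try exact/measurable_EFinP;
  exact: measurable_cons_pair.
rewrite exprS -ih2 -h2.
transitivity (Cintegral (mu \x tuple_measure mu n)%E setT
    (fun p => \prod_(y <- cons_pair p) f y)).
  apply: complex_ext; rewrite /= /Rintegral/=;
  rewrite (integral_pushforward (measurable_cons_pair (n := n)))//;
  exact/measurable_EFinP.
by rewrite e.
Qed.

(** The exceptional set follows the recursion of [tuple_measure]: either the head lies in the null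
    set or the tail is exceptional. *)
Lemma tuple_measure_ae n (Q : T -> Prop) : {ae mu, forall x, Q x} ->
  {ae tuple_measure mu n, forall t, forall y, y \in (tval t : seq T) -> Q y}.
Proof.
move=> [N [mN N0 QN]].
suff h m : exists A : set (m.-tuple T), [/\ measurable A, tuple_measure mu m A = 0 &
    forall t, ~ (forall y, y \in (tval t : seq T) -> Q y) -> A t].
  by have [A [mA A0 hA]] := h n; exists A; split.
elim: m => [|m [A [mA A0 hA]]].
  by exists set0; split => // t h; apply: h => y; rewrite tuple0.
exists (@uncons _ T m @^-1` (N `*` setT `|` setT `*` A)); split.
- rewrite -[X in measurable X]setTI; apply: measurable_uncons => //.
  by apply: measurableU; exact: measurableX.
- rewrite /= /cons_measure /pushforward -comp_preimage.
  rewrite (_ : _ \o _ = id); last exact/funext/cons_pairK.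
  apply/eqP; rewrite eq_le measure_ge0 andbT.
  apply: (le_trans (measureU2 _ _ _)); rewrite ?preimage_id; try exact: measurableX.
  have e1 := product_measure1E mu (tuple_measure mu m) mN measurableT.
  have e2 := product_measure1E mu (tuple_measure mu m) measurableT mA.
  suff : ((mu \x tuple_measure mu m) (N `*` setT) +
      (mu \x tuple_measure mu m) (setT `*` A) <= 0)%E by [].
  rewrite (etrans e1 (etrans (congr1 (fun z => z * _)%E N0) (mul0e _))).
  rewrite (etrans e2 (etrans (congr1 (fun z => _ * z)%E A0) (mule0 _))).
  by rewrite adde0.
- move=> t ht; rewrite /uncons /=; apply: contrapT => /not_orP[/= n1 n2]; apply: ht => y.
  case/tupleP: t n1 n2 => x t /= n1 n2.
  rewrite inE => /orP[/eqP ->|yt].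
    by apply: contrapT => nQ; apply: n1; split => //; apply: QN; rewrite /= theadE.
  apply: contrapT => nQ; apply: n2; split => //=; apply: hA => h; apply: nQ; apply: h.
  by rewrite /= .
Qed.

End tuple_measure_integral.

(** * Extraction of Taylor coefficients *)

Section coefficient_extraction.
Context {R : realType} {E F : ipSpace R}.
Local Open Scope complex_scope.

(* The n-th coefficient is the limit, as t tends to 0, of
   [t^-n (e t - \sum_(k < n) t^k u_k)]. *)
Lemma power_extraction (K : set E) (T : E -> F) (e : R -> E) (u : nat -> E)
    (e' : R -> F) (u' : nat -> F) :
  ipsub K -> ipclosed K -> iplinear K T -> ipbounded K T ->
  (forall t, 0 < t <= 1 -> K (e t) /\ T (e t) = e' t) ->
  (forall n, exists C : R, forall t, 0 < t <= 1 ->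
    ipnorm (e t - \sum_(0 <= k < n) t%:C ^+ k *: u k) <= C * t ^+ n) ->
  (forall n, exists C : R, forall t, 0 < t <= 1 ->
    ipnorm (e' t - \sum_(0 <= k < n) t%:C ^+ k *: u' k) <= C * t ^+ n) ->
  forall n, K (u n) /\ T (u n) = u' n.
Proof.
move=> sK cK lT bT Ke hu hu' n; elim/ltn_ind: n => n ih.
(* Admissible parameters tending to 0. With one more term subtracted, the remainder is of order
   [t^(n+1)], so division by [t^n] leaves an error of order [t]. *)
pose tj j : R := 2^-1 ^+ j.
have tj0 j : 0 < tj j by rewrite exprn_gt0.
have tj1 j : 0 < tj j <= 1 by rewrite tj0 exprn_ile1//; lra.
have tjC j : (tj j)%:C ^+ n != 0 by rewrite expf_neq0// eq_complex /= negb_and gt_eqF.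
have approx (V : ipSpace R) (f : R -> V) (v : nat -> V) :
    (exists C : R, forall t, 0 < t <= 1 ->
      ipnorm (f t - \sum_(0 <= k < n.+1) t%:C ^+ k *: v k) <= C * t ^+ n.+1) ->
    ipcvg (fun j => ((tj j)%:C ^+ n)^-1 *:
      (f (tj j) - \sum_(0 <= k < n) (tj j)%:C ^+ k *: v k)) (v n).
  move=> [C hC].
  have h0 : `|C| * tj j @[j --> \oo] --> (0 : R).
    by apply: cvg0Z; apply: cvg_expr; rewrite ger0_norm//; lra.
  apply: squeeze0 h0 => j; first exact: ipnorm_ge0.
  set x := f _; set y := (\sum_(0 <= k < n) _).
  have -> : ((tj j)%:C ^+ n)^-1 *: (x - y) - v n =
      ((tj j)%:C ^+ n)^-1 *: (x - \sum_(0 <= k < n.+1) (tj j)%:C ^+ k *: v k).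
    rewrite big_nat_recr//= -/y opprD addrA scalerBr [RHS]scalerBr scalerA mulVf//.
    by rewrite scale1r scalerBr.
  rewrite ipnormZ modcV modcX modc_real ger0_norm; last exact: ltW.
  have tn : 0 < tj j ^+ n by rewrite exprn_gt0.
  rewrite ler_pdivrMl//; apply: le_trans (hC _ (tj1 j)) _.
  rewrite exprSr -subr_ge0 (_ : _ - _ = tj j ^+ n * tj j * (`|C| - C)); last by ring.
  by apply: mulr_ge0; [apply: mulr_ge0; exact: ltW|rewrite subr_ge0 ler_norm].
have Kv j : K (((tj j)%:C ^+ n)^-1 *: (e (tj j) - \sum_(0 <= k < n) (tj j)%:C ^+ k *: u k)).
  apply: ipsubZ => //; apply: ipsubB => //; first by case: (Ke _ (tj1 j)).
  rewrite big_nat_cond.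
  elim/big_ind : _ => [|x y|k /andP[/andP[_ kn] _]]; first exact: sK.1.
    exact: ipsubD.
  by apply: ipsubZ => //; case: (ih k kn).
have Ku : K (u n) by apply: ipclosedP (approx _ _ _ (hu n.+1)).
split=> //; apply: (ipcvg_unique (ipbounded_cvg sK lT bT Kv Ku (approx _ _ _ (hu n.+1)))).
have := approx _ _ _ (hu' n.+1); congr ipcvg; apply/funext => j /=.
have Ks m : (m <= n)%N -> K (\sum_(0 <= k < m) (tj j)%:C ^+ k *: u k) /\
    T (\sum_(0 <= k < m) (tj j)%:C ^+ k *: u k) = \sum_(0 <= k < m) (tj j)%:C ^+ k *: u' k.
  elim: m => [|m ihm] mn.
    by rewrite !big_geq//; split; [exact: sK.1|exact: iplinear0 lT].
  have [K1 T1] := ihm (ltnW mn); have [K2 T2] := ih m mn.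
  rewrite !big_nat_recr//= ![_ + _ *: _]addrC; split; first exact: sK.2.
  by rewrite lT// T1 T2.
have [K1 T1] := Ks n (leqnn n); have [K2 T2] := Ke _ (tj1 j).
rewrite (iplinearZ _ sK lT); last exact: ipsubB.
by rewrite (iplinearB lT)// T1 T2.
Qed.

(** The squared distance of [e (fs n)] and [e f] is a combination of four values of the kernel with
    signs adding up to 0, and the kernel is continuous. *)
Lemma cexps_kernel_cvg (e : E -> F) (D : set E) (fs : nat -> E) f :
  (forall f g, D f -> D g -> ip (e f) (e g) = cexps (ip f g)) ->
  (forall n, D (fs n)) -> D f -> ipcvg fs f -> ipcvg (e \o fs) (e f).
Proof.
move=> he Dfs Df ff; apply: sqr_cvg0 => [n|]; first exact: ipnorm_ge0.
have h := CcvgD (CcvgD (Ccvg_cexps (ipcvg_ip ff ff))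
    (CcvgM (Ccvg_cst (-1)) (Ccvg_cexps (ipcvg_ip ff (ipcvg_cst f)))))
  (CcvgD (CcvgM (Ccvg_cst (-1)) (Ccvg_cexps (ipcvg_ip (ipcvg_cst f) ff)))
    (Ccvg_cst (cexps (ip f f)))).
have l0 (l : R[i]) : l + -1 * l + (-1 * l + l) = 0 by ring.
have {}h := eq_ind _ (Ccvg _) h _ (l0 _); move/CcvgP : h => [h1 _]; apply: cvg_trans h1; apply: near_eq_cvg; apply: nearW => n.
rewrite sqr_ipnorm ipBl !ipBr !he//; apply: (congr1 (@complex.Re R)).
by move: (cexps _) (cexps _) (cexps _) (cexps _) => p q r s; ring.
Qed.

End coefficient_extraction.

(** * Ryser's formula for the permanent *)

Section ryser.
Context {K : comRingType}.

(** Expanding the products on the right gives a sum over all maps of ['I_n] to itself, each weighted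
    by the signed number of sets [S] containing its range; this weight is 1 for surjective maps and
    0 for the others, and surjective means injective here. *)
Lemma ryser_permanent n (a : 'I_n -> 'I_n -> K) :
  \sum_(s : 'S_n) \prod_(i < n) a i (s i) =
  \sum_(S : {set 'I_n}) (-1) ^+ #|~: S| * \prod_(j < n) \sum_(i in S) a i j.
Proof.
transitivity (\sum_(f : {ffun 'I_n -> 'I_n} | injectiveb f) \prod_(j < n) a (f j) j).
  (* Inverting the permutation indexes the products by columns; permutations then become injective
     finite functions. *)
  rewrite (reindex_inj invg_inj)/=.
  rewrite [RHS](reindex_onto (fun s : 'S_n => pval s) (fun f => insubd (1%g : 'S_n) f)) /=.
    apply: eq_big => [s|s _].
      rewrite (valP s) /=; apply/esym/eqP; apply: val_inj.
      by rewrite /= insubdK//; exact: (valP s).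
    rewrite (reindex_inj (@perm_inj _ s))/=; apply: eq_bigr => i _.
    by rewrite permK pvalE.
  by move=> f If; rewrite insubdK.
symmetry; under eq_bigr => S _ do rewrite bigA_distr_big big_distrr/=.
transitivity (\sum_(S : {set 'I_n}) \sum_(f : {ffun 'I_n -> 'I_n})
    (if f \in ffun_on (mem S) then (-1) ^+ #|~: S| * \prod_(j < n) a (f j) j else 0)).
  by apply: eq_bigr => S _; rewrite big_mkcond.
rewrite exchange_big [RHS]big_mkcond/=; apply: eq_bigr => f _.
rewrite -big_mkcond -big_distrl/=.
(* Expanding the product over [i] chooses a complement of [S]; the factor at a point of the range
   vanishes as soon as that point is placed in the complement. *)
have -> : \sum_(S : {set 'I_n} | f \in ffun_on (mem S)) (-1) ^+ #|~: S| =
    \prod_(i < n) (1 - (i \notin codom f)%:R) :> K.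
  rewrite bigA_distr big_mkcond/=; apply: eq_bigr => S _.
  case: ifPn => [/ffun_onP fS|/ffun_onP fS].
    rewrite (eq_bigr (fun i => if i \in ~: S then -1 else 1)) => [|i _].
      by rewrite -big_mkcond/= prodr_const.
    rewrite inE; case: ifPn => // iS.
    by rewrite (_ : i \notin codom f)//; apply: contra iS => /codomP[j ->]; exact: fS.
  have /existsP[j /negP fj] : [exists j, f j \notin S].
    apply/existsP; apply: contrapT => h; apply: fS => j.
    by apply: contrapT => /negP fj; apply: h; exists j.
  by rewrite (bigD1 (f j))//= ifN ?codom_f ?oppr0 ?mul0r//; exact/negP.
case: ifPn => [/injectiveP inj|ninj].
  rewrite big1 ?mul1r// => i _.
  have /codomP[j ->] : i \in codom f.
    by rewrite (injF_onto inj).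
  by rewrite codom_f subr0.
have [i iN] : exists i, i \notin codom f.
  apply: contrapT => h; move/negP: ninj; apply.
  rewrite /injectiveb /dinjectiveb; apply/card_uniqP.
  rewrite size_map -cardE; apply: eq_card => i; rewrite !inE; apply/idP.
  by apply: contrapT => /negP fi; apply: h; exists i.
by rewrite (bigD1 i)//= iN subrr !mul0r.
Qed.

End ryser.

(** * Exponential vectors in Fock space *)

Section fock_integral.
Context d (T : measurableType d) {R : realType}.
Variable mu : {sigma_finite_measure set T -> \bar R}.
Local Open Scope complex_scope.
Local Notation FM := (fock_measure mu).

Lemma measurable_fin_seqP d' (U : measurableType d') (F : fin_seq T -> U) :
  (forall n, measurable_fun setT (fun t : n.-tuple T => F (tval t))) ->
  measurable_fun setT F.
Proof.
move=> h _ A mA; rewrite setTI; suff : fin_seq_measurable (F @^-1` A) by [].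
by move=> n; have := h n measurableT A mA; rewrite setTI.
Qed.

Lemma Cmeas_fin_seqP (F : fin_seq T -> R[i]) :
  (forall n, Cmeas (fun t : n.-tuple T => F (tval t))) -> Cmeas F.
Proof.
by move=> h; split; apply: measurable_fin_seqP => n; [exact: (h n).1|exact: (h n).2].
Qed.

Lemma measurable_fin_seq_tuple d' (U : measurableType d') (F : fin_seq T -> U) n :
  measurable_fun setT F -> measurable_fun setT (fun t : n.-tuple T => F (tval t)).
Proof. by move=> h; exact: (measurableT_comp h (@measurable_seq_of_tuple _ T n)). Qed.

Lemma ge0_integral_fock (F : fin_seq T -> \bar R) : measurable_fun setT F ->
  (forall s, (0 <= F s)%E) ->
  (\int[FM]_s F s = \sum_(n <oo) \int[tuple_measure mu n]_t F (tval t))%E.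
Proof.
move=> mF F0; rewrite ge0_integral_measure_series//.
apply: eq_eseriesr => n _.
by rewrite (ge0_integral_pushforward (@measurable_seq_of_tuple _ T n)).
Qed.

Lemma ge0_integral_level (n : nat) (F : fin_seq T -> \bar R) : measurable_fun setT F ->
  (forall s, (0 <= F s)%E) -> (forall s, size s != n -> F s = 0%E) ->
  (\int[FM]_s F s = \int[tuple_measure mu n]_t F (tval t))%E.
Proof.
move=> mF F0 Fn; rewrite ge0_integral_fock// (@nneseriesD1 _ _ n)//; last first.
  by move=> k _; exact: integral_ge0.
rewrite eseries0 ?adde0// => k _ kn /=.
by rewrite integral0_eq// => t _; rewrite Fn// size_tuple.
Qed.

Lemma integral_level (n : nat) (F : fin_seq T -> \bar R) : measurable_fun setT F ->
  (forall s, size s != n -> F s = 0%E) ->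
  (\int[FM]_s F s = \int[tuple_measure mu n]_t F (tval t))%E.
Proof.
move=> mF Fn; rewrite integralE [RHS]integralE; congr (_ - _)%E.
  rewrite (@ge0_integral_level n (F^\+)%E)//.
  - by apply: eq_integral => t _; rewrite !funeposE.
  - exact: measurable_funepos.
  - by move=> s sn; rewrite funeposE Fn// maxxx.
rewrite (@ge0_integral_level n (F^\-)%E)//.
- by apply: eq_integral => t _; rewrite !funenegE.
- exact: measurable_funeneg.
- by move=> s sn; rewrite funenegE Fn// oppe0 maxxx.
Qed.

(** The n-th tensor power of [f], extended by 0 to the other levels of the disjoint union. *)
Definition tpow n (f : T -> R[i]) : fin_seq T -> R[i] :=
  fun s => if size s == n then \prod_(y <- s) f y else 0.

Lemma Cmeas_seq_prod (f : T -> R[i]) : Cmeas f ->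
  Cmeas (fun s : fin_seq T => \prod_(y <- s) f y).
Proof. by move=> mf; apply: Cmeas_fin_seqP => n; exact: Cmeas_tuple_prod. Qed.

Lemma Cmeas_level (P : pred nat) (F : fin_seq T -> R[i]) : Cmeas F ->
  Cmeas (fun s : fin_seq T => if P (size s) then F s else 0).
Proof.
move=> [F1 F2]; apply: Cmeas_fin_seqP => n.
rewrite (_ : (fun t => _) = fun t : n.-tuple T => if P n then F (tval t) else 0); last first.
  by apply/funext => t; rewrite size_tuple.
case: (P n); last exact: Cmeas_cst.
by split; [exact: (@measurable_fin_seq_tuple _ _ _ n F1)|exact: (@measurable_fin_seq_tuple _ _ _ n F2)].
Qed.

Lemma Cmeas_tpow n f : Cmeas f -> Cmeas (tpow n f).
Proof. by move=> mf; apply: (@Cmeas_level (pred1 n)); exact: Cmeas_seq_prod. Qed.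

Lemma Cintegral_tpow n f : Cintegrable mu f ->
  Cintegrable FM (tpow n f) /\
  Cintegral FM setT (tpow n f) = (Cintegral mu setT f) ^+ n.
Proof.
move=> jf; have [m1 m2] := Cmeas_tpow n (Cintegrable_meas jf).
have [[i1 i2] e] := Cintegral_tuple_prod n jf.
have tE (t : n.-tuple T) : tpow n f (tval t) = \prod_(y <- t) f y.
  by rewrite /tpow size_tuple eqxx.
have t0 s : size s != n -> tpow n f s = 0 by rewrite /tpow => /negbTE ->.
split.
  split; apply/integrableP; split; try exact/measurable_EFinP.
    rewrite (@ge0_integral_level n)//=; last 2 first.
    - by apply/measurable_EFinP; exact: measurableT_comp.
    - by move=> s /t0 ->; rewrite normr0.
    by under eq_integral do rewrite tE; have /integrableP[] := i1.
  rewrite (@ge0_integral_level n)//=; last 2 first.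
  - by apply/measurable_EFinP; exact: measurableT_comp.
  - by move=> s /t0 ->; rewrite normr0.
  by under eq_integral do rewrite tE; have /integrableP[] := i2.
rewrite -e; apply: complex_ext; rewrite /= /Rintegral; congr fine.
  rewrite (@integral_level n)/=; first by under eq_integral do rewrite tE.
    exact/measurable_EFinP.
  by move=> s /t0 ->.
rewrite (@integral_level n)/=; first by under eq_integral do rewrite tE.
  exact/measurable_EFinP.
by move=> s /t0 ->.
Qed.

Lemma nsq_prod (f : T -> R[i]) (s : seq T) :
  nsq (\prod_(y <- s) f y) = \prod_(y <- s) nsq (f y).
Proof.
elim: s => [|y s ih]; last by rewrite !big_cons nsqM ih.
by rewrite !big_nil -sqr_modc modc1 expr1n.
Qed.

Lemma sqint_tpow n f : sqintegrable mu f -> sqintegrable FM (tpow n f).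
Proof.
move=> /sqintP[mf jf]; apply/sqintP; split; first exact: Cmeas_tpow.
have jr : Cintegrable mu (fun x => (nsq (f x))%:C).
  by split => //=; exact: integrable0.
have [[h _] _] := Cintegral_tpow n jr.
rewrite (_ : (fun s => _) = fun s => complex.Re (tpow n (fun x => (nsq (f x))%:C) s))//.
apply/funext => s; rewrite /tpow; case: ifP => _; last exact: nsq0.
by rewrite -rmorph_prod nsq_prod.
Qed.

Lemma dot_tpow n (f g : T -> R[i]) : sqintegrable mu f -> sqintegrable mu g ->
  dot (toL2 FM (tpow n f)) (toL2 FM (tpow n g)) =
    (dot (toL2 mu f) (toL2 mu g)) ^+ n.
Proof.
move=> hf hg; rewrite !dotE//; try exact: sqint_tpow.
have [_ <-] := Cintegral_tpow n (sqint_mul_Cintegrable hf hg).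
congr (Cintegral _ _ _); apply/funext => s; rewrite /tpow; case: ifP => _.
  by rewrite rmorph_prod -big_split.
by rewrite mul0r.
Qed.

Lemma dot_tpow0 n m (f g : T -> R[i]) : sqintegrable mu f -> sqintegrable mu g ->
  n != m -> dot (toL2 FM (tpow n f)) (toL2 FM (tpow m g)) = 0.
Proof.
move=> hf hg nm; rewrite !dotE//; try exact: sqint_tpow.
rewrite -[RHS](Cintegral0 FM); congr (Cintegral _ _ _); apply/funext => s.
rewrite /tpow; case: (eqVneq (size s) n) => [->|_]; last by rewrite mul0r.
by rewrite (negbTE nm) rmorph0 mulr0.
Qed.

(** The function behind [expvec], before passing to classes, so that it can be evaluated
    pointwise. *)
Definition fexp (f : T -> R[i]) : fin_seq T -> R[i] :=
  fun s => (Num.sqrt (size s)`!%:R : R)^-1%:C * \prod_(y <- s) f y.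

Lemma expvecE xi : expvec xi = toL2 FM (fexp (fun_of_L2 xi)). Proof. by []. Qed.

Lemma Cmeas_fexp f : Cmeas f -> Cmeas (fexp f).
Proof.
move=> mf; apply: Cmeas_fin_seqP => n; rewrite /fexp.
apply: CmeasM; last exact: Cmeas_tuple_prod.
rewrite (_ : (fun t => _) = fun=> (Num.sqrt n`!%:R : R)^-1%:C); first exact: Cmeas_cst.
by apply/funext => t; rewrite size_tuple.
Qed.

Lemma nsq_fexp f s : nsq (fexp f s) = (size s)`!%:R^-1 * \prod_(y <- s) nsq (f y).
Proof.
by rewrite /fexp nsqM nsq_prod nsq_real exprVn sqr_sqrtr.
Qed.

(** With [I] the squared norm of [f], level [n] contributes [I^n / n!], and the sum is at most
    [expR I]. *)
Lemma sqint_fexp f : sqintegrable mu f -> sqintegrable FM (fexp f).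
Proof.
move=> /sqintP[mf jf]; apply/sqintP; have mF := Cmeas_fexp mf; split => //.
have mn := Cmeas_nsq mF.
apply: Rintegrable_ge0 => //; first by move=> s; exact: nsq_ge0.
rewrite ge0_integral_fock; last 2 first.
- exact/measurable_EFinP.
- by move=> s; rewrite lee_fin nsq_ge0.
set I := \int[mu]_x nsq (f x).
have I0 : 0 <= I by apply: Rintegral_ge0 => x _; exact: nsq_ge0.
apply: (@le_lt_trans _ _ (expR I)%:E); last exact: ltry.
have eN n : (\int[tuple_measure mu n]_t (nsq (fexp f (tval t)))%:E =
    (exp_coeff I n)%:E)%E.
  under eq_integral do rewrite nsq_fexp size_tuple EFinM.
  rewrite ge0_integralZl_EFin//; last 2 first.
  - by move=> t _; rewrite lee_fin prodr_ge0// => y _; exact: nsq_ge0.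
  - by apply/measurable_EFinP; apply: measurable_tuple_prod; exact: Cmeas_nsq.
  rewrite ge0_integral_tuple_prod; last 2 first.
  - exact: Cmeas_nsq.
  - by move=> x; exact: nsq_ge0.
  by rewrite -EFin_Rintegral// -/I -EFin_expe -EFinM /exp_coeff/= mulrC.
apply: nneseries_le => [n|n]; first by rewrite eN lee_fin exp_coeff_ge0.
under eq_bigr do rewrite eN.
rewrite sumEFin lee_fin; apply: nondecreasing_cvgn_le.
  apply/nondecreasing_seqP => k; rewrite /series/= big_nat_recr//= lerDl.
  exact: exp_coeff_ge0.
exact: is_cvg_series_exp_coeff.
Qed.

Lemma fexp_sum N f s : \sum_(0 <= k < N) (Num.sqrt k`!%:R : R)^-1%:C * tpow k f s =
  if (size s < N)%N then fexp f s else 0.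
Proof.
case: ifPn => sN.
  rewrite (bigD1_seq (size s)) ?iota_uniq ?mem_index_iota//= /tpow eqxx.
  rewrite [X in _ + X]big1 ?addr0// => k /negbTE; rewrite eq_sym => ->.
  by rewrite mulr0.
rewrite big_nat_cond big1// => k /andP[/andP[_ kN] _]; rewrite /tpow.
by rewrite gtn_eqF ?mulr0// (leq_trans kN)// leqNgt.
Qed.

Let cn k : R[i] := (Num.sqrt k`!%:R : R)^-1%:C.

(** The partial sums are the restrictions of [fexp f] to sequences of length less than [N], so
    [fexp f] dominates them. *)
Lemma fexp_cvg f : sqintegrable mu f ->
  ipcvg (E := L2ip FM) (fun N => \sum_(0 <= k < N) cn k *: toL2 FM (tpow k f))
    (toL2 FM (fexp f)).
Proof.
move=> hf.
have -> : (fun N => \sum_(0 <= k < N) cn k *: toL2 FM (tpow k f) : L2ip FM) =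
    fun N => toL2 FM (fun s => if (size s < N)%N then fexp f s else 0).
  apply/funext => N; under eq_bigr do rewrite -toL2Z ?sqint_tpow//.
  rewrite -toL2_sum; last by move=> k; apply: sqintegrableZ; exact: sqint_tpow.
  by congr (toL2 _ _); apply/funext => s; exact: fexp_sum.
apply: (sqint_Ccvg_dominated (g := fexp f)).
- by move=> N; apply: (@Cmeas_level (fun k => (k < N)%N)); apply: Cmeas_fexp; exact: sqint_meas hf.
- by apply: Cmeas_fexp; exact: sqint_meas hf.
- by move=> N s; case: ifP => _ //; rewrite modc0 modc_ge0.
- by [].
- exact: sqint_fexp.
- apply: aeW => s; apply: cvg_near_cst; exists (size s).+1 => // N /= sN.
  by rewrite sN subrr modc0.
Qed.

(** Different levels are orthogonal, so the truncations of the two vectors at [N] have inner product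
    exactly [expsum N]. *)
Lemma dot_fexp f g : sqintegrable mu f -> sqintegrable mu g ->
  dot (toL2 FM (fexp f)) (toL2 FM (fexp g)) = cexps (dot (toL2 mu f) (toL2 mu g)).
Proof.
move=> hf hg; apply: (Ccvg_unique (ipcvg_ip (fexp_cvg hf) (fexp_cvg hg))).
have := cexps_cvg (dot (toL2 mu f) (toL2 mu g)); congr Ccvg; apply/funext => N.
rewrite (@ip_suml _ (L2ip FM)) /expsum big_nat [RHS]big_nat.
apply: eq_bigr => k /andP[_ kN].
rewrite (@ip_sumr _ (L2ip FM)) (bigD1_seq k) ?iota_uniq ?mem_index_iota//=.
rewrite big1 => [|j jk]; last first.
  by rewrite dotZl dotZr dot_tpow0 ?mulr0// eq_sym.
rewrite addr0 dotZl dotZr dot_tpow// mulrA [RHS]mulrC; congr (_ * _).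
rewrite /cn mulcJ nsq_real exprVn sqr_sqrtr//.
by rewrite fmorphV rmorph_nat.
Qed.

Lemma dot_expvec (xi zeta : L2 mu) :
  dot (expvec xi) (expvec zeta) = cexps (dot xi zeta).
Proof. by rewrite !expvecE dot_fexp ?toL2K//; exact: sqintegrable_L2. Qed.

(** This makes [tpow] and [fexp] independent of the representative of a class, up to null sets. *)
Lemma fock_ae (Q : T -> Prop) : {ae mu, forall x, Q x} ->
  {ae FM, forall s : fin_seq T, forall y, y \in (s : seq T) -> Q y}.
Proof.
move=> aQ; have h0 : forall n, exists A : set (n.-tuple T), [/\ measurable A,
    tuple_measure mu n A = 0%E & forall t, ~ (forall y, y \in (tval t : seq T) -> Q y) -> A t].
  by move=> n; have [A [mA A0 hA]] := tuple_measure_ae n aQ; exists A; split.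
pose A n := sval (cid (h0 n)); have hA n := svalP (cid (h0 n)).
(* Quantifying over all tuples with underlying sequence [s] avoids transporting the sets [A n] along
   an equality of sizes. *)
pose B : set (fin_seq T) := [set s | forall n (t : n.-tuple T), tval t = s -> A n t].
have BA n : [set t : n.-tuple T | B (tval t)] = A n.
  apply/seteqP; split => t /=; first by apply.
  move=> At m t' tt'; have mn : m = n by rewrite -(size_tuple t) -tt' size_tuple.
  by subst m; have -> : t' = t by apply: val_inj.
exists B; split.
- by move=> n; rewrite BA; have [] := hA n.
- rewrite /fock_measure /= /mseries /=.
  rewrite eseries0// => n _ _; rewrite /pushforward.
  by rewrite -[X in tuple_measure mu n X]/[set t : n.-tuple T | B (tval t)] BA; have [] := hA n.
- move=> s hs n t ts; have [_ _] := hA n; apply => h; apply: hs => y; rewrite -ts; exact: h.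
Qed.

Lemma toL2_tpow_ae n f g : sqintegrable mu f -> sqintegrable mu g ->
  {ae mu, forall x, f x = g x} -> toL2 FM (tpow n f) = toL2 FM (tpow n g).
Proof.
move=> hf hg fg; apply: toL2_ae; try exact: sqint_tpow.
apply: filterS (fock_ae fg) => s hs; rewrite /tpow; case: ifP => // _.
by apply: eq_big_seq => y ys; exact: hs.
Qed.

Lemma toL2_fexp_ae f g : sqintegrable mu f -> sqintegrable mu g ->
  {ae mu, forall x, f x = g x} -> toL2 FM (fexp f) = toL2 FM (fexp g).
Proof.
move=> hf hg fg; apply: toL2_ae; try exact: sqint_fexp.
apply: filterS (fock_ae fg) => s hs; rewrite /fexp; congr (_ * _).
by apply: eq_big_seq => y ys; exact: hs.
Qed.

Lemma expvec_cvg (xs : nat -> L2 mu) xi : L2cvg xs xi ->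
  L2cvg (fun n => expvec (xs n)) (expvec xi).
Proof.
move=> h; apply: (@cexps_kernel_cvg _ (L2ip mu) (L2ip FM) (@expvec _ _ _ mu) setT) => //.
by move=> f g _ _; exact: dot_expvec.
Qed.

End fock_integral.

Section L2_sums.
Context d (T : measurableType d) {R : realType}.
Variable mu : {measure set T -> \bar R}.

Lemma L2norm_toL2_le (h g : T -> R[i]) (c : R) : 0 <= c ->
  Cmeas h -> sqintegrable mu g -> (forall x, modc (h x) <= c * modc (g x)) ->
  sqintegrable mu h /\ L2norm (toL2 mu h) <= c * L2norm (toL2 mu g).
Proof.
move=> c0 mh ig hg.
have icg : sqintegrable mu (fun x => c%:C%C * g x) by exact: sqintegrableZ.
have ih : sqintegrable mu h.
  apply: sqint_le mh _ icg => x.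
  by rewrite modcM modc_real ger0_norm.
split=> //; rewrite -(@ler_pXn2r _ 2)// ?nnegrE ?mulr_ge0 ?L2norm_ge0//.
rewrite exprMn !sqr_L2norm_toL2//.
have sg := sqint_nsq ig; rewrite -RintegralZl//.
apply: le_Rintegral => //; [exact: sqint_nsq|exact: RintegrableZ|].
by move=> x _; rewrite -!sqr_modc -exprMn lerXn2r ?nnegrE ?mulr_ge0 ?modc_ge0.
Qed.

Lemma fun_of_L2_sum I (r : seq I) (F : I -> L2 mu) :
  {ae mu, forall x, fun_of_L2 (\sum_(i <- r) F i) x = \sum_(i <- r) fun_of_L2 (F i) x}.
Proof.
elim: r => [|i r ih].
  have := fun_toL2 (sqintegrable0 mu); apply: filterS => x.
  by rewrite !big_nil.
have := fun_of_L2D (F i) (\sum_(j <- r) F j); apply: filterS2 ih => x h1 h2.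
by rewrite !big_cons h2 h1.
Qed.

End L2_sums.

(** * The Fock space as the closed span of exponential vectors *)

Section fock_span.
Context d (T : measurableType d) {R : realType}.
Variable mu : {sigma_finite_measure set T -> \bar R}.
Local Open Scope complex_scope.
Local Notation FM := (fock_measure mu).

Definition symf n (f : 'I_n -> T -> R[i]) : fin_seq T -> R[i] := fun s =>
  if insub s is Some t then
    n`!%:R^-1 * \sum_(sigma : 'S_n) \prod_(i < n) f i (tnth (t : n.-tuple T) (sigma i))
  else 0.

Lemma symf_cst n (f : T -> R[i]) : symf (fun _ : 'I_n => f) = tpow n f.
Proof.
apply/funext => s; rewrite /symf /tpow; case: insubP => [t st ts|/negbTE -> //].
rewrite st -ts big_tuple (eq_bigr (fun=> \prod_(i < n) f (tnth t i))) => [|sg _].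
  rewrite sumr_const card_Sn -[X in _ * X]mulr_natl mulrA mulVf ?mul1r//.
by rewrite [RHS](reindex_inj (@perm_inj _ sg)).
Qed.

(** Polarization: pointwise, the sum over permutations is a permanent, and Ryser's formula writes it
    with tensor powers of partial sums. *)
Lemma symf_ryser n (f : 'I_n -> T -> R[i]) : symf f = fun s =>
  \sum_(S : {set 'I_n}) (n`!%:R^-1 * (-1) ^+ #|~: S|) *
    tpow n (fun y => \sum_(i <- enum S) f i y) s.
Proof.
apply/funext => s; rewrite /symf /tpow; case: insubP => [t st ts|/negbTE st].
  rewrite st -ts (ryser_permanent (fun i j => f i (tnth t j))) mulr_sumr.
  apply: eq_bigr => S _; rewrite mulrA big_tuple; congr (_ * _).
  by apply: eq_bigr => j _; rewrite big_enum.
by rewrite st big1// => S _; rewrite mulr0.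
Qed.

Lemma sqint_sumL2 I (r : seq I) (F : I -> L2 mu) :
  sqintegrable mu (fun y => \sum_(i <- r) fun_of_L2 (F i) y).
Proof. by apply: sqint_sum => i; exact: sqintegrable_L2. Qed.

Lemma sym_tensorE n (x : 'I_n -> L2 mu) : sym_tensor x =
  \sum_(S : {set 'I_n}) (n`!%:R^-1 * (-1) ^+ #|~: S|) *:
    toL2 FM (tpow n (fun_of_L2 (\sum_(i <- enum S) x i))).
Proof.
rewrite -[LHS]/(toL2 FM (symf (fun i => fun_of_L2 (x i)))) symf_ryser.
rewrite toL2_sum => [|S]; last first.
  by apply: sqintegrableZ; apply: sqint_tpow; exact: sqint_sumL2.
apply: eq_bigr => S _; rewrite toL2Z; last by apply: sqint_tpow; exact: sqint_sumL2.
congr (_ *: _); apply: toL2_tpow_ae.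
- exact: sqint_sumL2.
- exact: sqintegrable_L2.
- by have := fun_of_L2_sum (enum S) x; apply: filterS => y ->.
Qed.

Let cn k : R[i] := (Num.sqrt k`!%:R : R)^-1%:C.

Let cn_neq0 k : cn k != 0.
Proof.
rewrite /cn eq_complex /= negb_and invr_eq0 sqrtr_eq0 -ltNge ltr0n fact_gt0.
by [].
Qed.

Lemma fexpZ (f : T -> R[i]) c s :
  fexp (fun y => c * f y) s = c ^+ size s * fexp f s.
Proof.
rewrite /fexp mulrCA; congr (_ * _).
elim: s => [|y s ih]; first by rewrite !big_nil mulr1.
by rewrite !big_cons ih exprS mulrACA.
Qed.

(** [expvec (t xi)] is a power series in [t] whose coefficients are nonzero multiples of the tensor
    powers. Only membership is wanted, so the extraction is applied with the identity map. *)
Lemma tpow_in_span (K : set (L2 mu)) xi n : (forall c, K (c *: xi)) ->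
  closed_span [set expvec x | x in K] (toL2 FM (tpow n (fun_of_L2 xi))).
Proof.
move=> Kc; set f := fun_of_L2 xi; have hf : sqintegrable mu f by exact: sqintegrable_L2.
set S := [set expvec x | x in K].
have sS := @ipspan_sub _ (L2ip FM) S; have cS := @ipspan_closed _ (L2ip FM) S.
have bound m : exists C : R, forall t, 0 < t <= 1 ->
    ipnorm (E := L2ip FM) (expvec (t%:C *: xi) -
      \sum_(0 <= k < m) t%:C ^+ k *: (cn k *: toL2 FM (tpow k f))) <= C * t ^+ m.
  exists (L2norm (toL2 FM (fexp f))) => t /andP[t0 t1].
  have -> : expvec (t%:C *: xi) = toL2 FM (fexp (fun y => t%:C * f y)).
    apply: toL2_fexp_ae; [exact: sqintegrable_L2|exact: sqintegrableZ|].
    exact: fun_of_L2Z.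
  have hk k : sqintegrable FM (fun s => t%:C ^+ k * (cn k * tpow k f s)).
    by do 2 apply: sqintegrableZ; exact: sqint_tpow.
  have -> : \sum_(0 <= k < m) t%:C ^+ k *: (cn k *: toL2 FM (tpow k f)) =
      toL2 FM (fun s => \sum_(0 <= k < m) t%:C ^+ k * (cn k * tpow k f s)).
    rewrite toL2_sum//; apply: eq_bigr => k _.
    by rewrite !toL2Z//; [exact: sqint_tpow|apply: sqintegrableZ; exact: sqint_tpow].
  have htf : sqintegrable FM (fexp (fun y => t%:C * f y)).
    by apply: sqint_fexp; exact: sqintegrableZ.
  rewrite -toL2B//; last exact: sqint_sum.
  rewrite mulrC; apply: (L2norm_toL2_le _ _ (sqint_fexp hf) _).2.
  - by rewrite exprn_ge0// ltW.
  - by apply: CmeasB; [exact: sqint_meas htf|exact: sqint_meas (sqint_sum _ hk)].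
  move=> s.
  have -> : \sum_(0 <= k < m) t%:C ^+ k * (cn k * tpow k f s) =
      t%:C ^+ size s * \sum_(0 <= k < m) cn k * tpow k f s.
    rewrite mulr_sumr; apply: eq_bigr => k _; rewrite /tpow.
    by case: eqVneq => [->//|_]; rewrite !mulr0.
  rewrite fexp_sum fexpZ -mulrBr modcM modcX modc_real ger0_norm; last exact: ltW.
  (* Lengths less than [m] cancel; on the others the remainder is [t ^+ size s] times [fexp f], and
     [t <= 1] gives [t ^+ m]. *)
  case: ltnP => sm; first by rewrite subrr modc0 mulr0 mulr_ge0 ?modc_ge0 ?exprn_ge0// ltW.
  rewrite subr0 ler_wpM2r ?modc_ge0//.
  by rewrite ler_wiXn2l// ltW.
have [] := @power_extraction _ (L2ip FM) (L2ip FM) (ipspan (E := L2ip FM) S) id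
    (fun t => expvec (t%:C *: xi)) (fun k => cn k *: toL2 FM (tpow k f))
    (fun t => expvec (t%:C *: xi)) (fun k => cn k *: toL2 FM (tpow k f))
    sS cS _ _ _ bound bound n.
- by [].
- by exists 1 => g _ /=; rewrite mul1r.
- move=> t _; split => //; apply: (@ipspan_incl _ (L2ip FM)).
  by exists (t%:C *: xi).
move=> h _; have := @ipsubZ _ (L2ip FM) _ (cn n)^-1 _ sS h.
rewrite [X in ipspan _ X](_ : _ = toL2 FM (tpow n f))//.
by rewrite /= scalerA mulVf ?scale1r.
Qed.

(** Polarization and [tpow_in_span] give one inclusion, convergence of the exponential series the
    other. *)
Lemma fock_expvec (K : set (L2 mu)) : Defs.subspace K ->
  fock K = closed_span [set expvec xi | xi in K].
Proof.
move=> sK; have sK' : @ipsub _ (L2ip mu) K := sK.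
apply/seteqP; split.
  apply: (@ipspan_min _ (L2ip FM)).
  - exact: (@ipspan_sub _ (L2ip FM)).
  - exact: (@ipspan_closed _ (L2ip FM)).
  set S := [set expvec xi | xi in K]; have sS := @ipspan_sub _ (L2ip FM) S.
  move=> _ [n [x [Kx ->]]]; rewrite sym_tensorE.
  apply: (@ipsub_sum _ (L2ip FM) (closed_span S) _ _ _ sS) => A.
  apply: (@ipsubZ _ (L2ip FM) (closed_span S) _ _ sS).
  apply: tpow_in_span => c; apply: (@ipsubZ _ (L2ip mu) K _ _ sK').
  exact: (@ipsub_sum _ (L2ip mu) K _ _ _ sK').
apply: (@ipspan_min _ (L2ip FM)).
- exact: (@ipspan_sub _ (L2ip FM)).
- exact: (@ipspan_closed _ (L2ip FM)).
have sF := @ipspan_sub _ (L2ip FM) [set F | exists n (x : 'I_n -> L2 mu),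
  (forall i, K (x i)) /\ F = sym_tensor x].
move=> _ [xi Kxi <-].
have hf : sqintegrable mu (fun_of_L2 xi) by exact: sqintegrable_L2.
apply: (@ipclosedP _ (L2ip FM) (fock K) _ _ _ _ (fexp_cvg hf)).
  exact: (@ipspan_closed _ (L2ip FM)).
move=> N; apply: (@ipsub_sum _ (L2ip FM) (fock K) _ _ _ sF) => k.
apply: (@ipsubZ _ (L2ip FM) (fock K) _ _ sF).
apply: (@ipspan_incl _ (L2ip FM)); exists k, (fun=> xi); split => //.
by rewrite -[sym_tensor _]/(toL2 FM (symf (fun _ : 'I_k => fun_of_L2 xi))) symf_cst.
Qed.

End fock_span.

(** * Poisson counts *)

Section independent_counts.
Context d (Omega : measurableType d) {R : realType} (Pr : probability Omega R).
Context (n : nat) (N : 'I_n -> Omega -> nat).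
Hypothesis mN : forall i (U : set nat), measurable [set w | U (N i w)].
Local Open Scope complex_scope.

Lemma measurable_count d' (T : measurableType d') i (g : nat -> T) :
  measurable_fun setT (fun w => g (N i w)).
Proof. by move=> _ A mA; rewrite setTI; exact: (mN i (g @^-1` A)). Qed.

Lemma Cmeas_count i (g : nat -> R[i]) : Cmeas (fun w => g (N i w)).
Proof.
split; first exact: (@measurable_count _ _ i (fun k => complex.Re (g k))).
exact: (@measurable_count _ _ i (fun k => complex.Im (g k))).
Qed.

Let at_count i k := [set w | N i w = k].

Let m_at i k : measurable (at_count i k).
Proof. exact: (mN i [set k]). Qed.

Lemma ge0_integral_count i (g : nat -> R) : (forall k, 0 <= g k) ->
  (\int[Pr]_w (g (N i w))%:E =
    \sum_(k <oo) (g k)%:E * Pr [set w | N i w = k])%E.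
Proof.
move=> g0; transitivity (\int[Pr]_w (\sum_(k <oo) ((g k)%:E * (\1_(at_count i k) w)%:E)))%E.
  apply: eq_integral => w _; rewrite (@nneseriesD1 _ _ (N i w))//; last first.
    by move=> k _; rewrite -EFinM lee_fin mulr_ge0.
  rewrite eseries0 ?adde0 ?indicE ?mem_set ?mule1// => k _ /= kN.
  by rewrite indicE memNset ?mule0// => /esym/eqP; rewrite (negbTE kN).
rewrite integral_nneseries//; last 2 first.
- move=> k; apply: measurable_funeM; apply/measurable_EFinP.
  by apply: measurable_indic; exact: m_at.
- by move=> k w _; rewrite -EFinM lee_fin mulr_ge0.
apply: eq_eseriesr => k _; rewrite ge0_integralZl_EFin//; last first.
  by apply/measurable_EFinP; apply: measurable_indic; exact: m_at.
by rewrite integral_indic ?setIT//; exact: m_at.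
Qed.

Hypothesis ind : forall U : 'I_n -> set nat,
  Pr (\bigcap_(i in setT) [set w | U i (N i w)]) =
  (\prod_(i < n) Pr [set w | U i (N i w)])%E.

Let upd (T : Type) (g : 'I_n -> T) (m : 'I_n) (x : T) : 'I_n -> T :=
  fun i => if i == m then x else g i.

Let indics (g : nat -> R) := exists U : set nat, g = \1_U.

(** Induction on the number [m] of coordinates carrying an arbitrary function, the others carrying
    indicators. The case 0 is independence; at each step one function is split as the countable sum
    of its values times indicators of points. *)
Lemma ge0_integral_indep (g : 'I_n -> nat -> R) : (forall i k, 0 <= g i k) ->
  (forall i, (\int[Pr]_w (g i (N i w))%:E < +oo)%E) ->
  (\int[Pr]_w (\prod_(i < n) g i (N i w))%:E =
    \prod_(i < n) \int[Pr]_w (g i (N i w))%:E)%E.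
Proof.
suff h m : (m <= n)%N -> forall g : 'I_n -> nat -> R, (forall i k, 0 <= g i k) ->
    (forall i, (\int[Pr]_w (g i (N i w))%:E < +oo)%E) ->
    (forall i : 'I_n, (m <= i)%N -> indics (g i)) ->
    (\int[Pr]_w (\prod_(i < n) g i (N i w))%:E =
      \prod_(i < n) \int[Pr]_w (g i (N i w))%:E)%E.
  by move=> g0 goo; apply: (h n) => // i; rewrite leqNgt ltn_ord.
elim: m => [_ {}g g0 _ hg|m ih mn {}g g0 goo hg].
  have /choice[U hU] : forall i, indics (g i) by move=> i; exact: hg.
  have e i w : g i (N i w) = \1_[set w | U i (N i w)] w by rewrite hU.
  have mU i : measurable [set w | U i (N i w)] by exact: mN.
  transitivity (\int[Pr]_w (\1_(\bigcap_(i in setT) [set w | U i (N i w)]) w)%:E)%E.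
    apply: eq_integral => w _; congr EFin; rewrite indicE.
    have [h|h] := boolP (w \in _).
      rewrite big1// => i _; rewrite e indicE mem_set//.
      by move: h; rewrite inE => /(_ i Logic.I).
    have [i hi] : exists i, ~ U i (N i w).
      apply: contrapT => h'; move/negP: h; apply; rewrite inE => i _ /=.
      by apply: contrapT => h2; apply: h'; exists i.
    by rewrite (bigD1 i)//= e indicE memNset// mul0r.
  rewrite integral_indic ?setIT//; last first.
    by apply: fin_bigcap_measurable => // i _; exact: mU.
  apply: (etrans (ind U)); apply: eq_bigr => i _; under eq_integral do rewrite e.
  by rewrite integral_indic ?setIT.
pose M := Ordinal mn.
pose gk k := upd g M (\1_[set k]).
have gk0 k i j : 0 <= gk k i j by rewrite /gk /upd; case: eqP.
have hgk k (i : 'I_n) : (m <= i)%N -> indics (gk k i).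
  rewrite /gk /upd; case: eqP => [_ _|/eqP iM mi]; first by exists [set k].
  by apply: hg; rewrite ltn_neqAle mi andbT eq_sym.
have gkoo k i : (\int[Pr]_w (gk k i (N i w))%:E < +oo)%E.
  rewrite /gk /upd; case: eqP => // ->.
  rewrite -[X in (X < _)%E]/(\int[Pr]_w (\1_(at_count M k) w)%:E)%E.
  rewrite integral_indic ?setIT//.
  by apply: (le_lt_trans (probability_le1 _ (m_at M k))); rewrite ltry.
have ihk k := ih (ltnW mn) _ (gk0 k) (gkoo k) (hgk k).
have mg (g' : 'I_n -> nat -> R) : measurable_fun setT (fun w => (\prod_(i < n) g' i (N i w))%:E).
  by apply/measurable_EFinP; apply: measurable_prod => i _; exact: measurable_count.
transitivity (\int[Pr]_w (\sum_(k <oo) ((g M k)%:E * (\prod_(i < n) gk k i (N i w))%:E)))%E.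
  apply: eq_integral => w _; rewrite (@nneseriesD1 _ _ (N M w))//; last first.
    by move=> k _; rewrite -EFinM lee_fin mulr_ge0// prodr_ge0.
  rewrite eseries0 ?adde0 => [|k _ /= kN].
    rewrite -EFinM; congr EFin; rewrite (bigD1 M)//= [in RHS](bigD1 M)//=.
    rewrite {1}/gk /upd eqxx indicE mem_set// mul1r; congr (_ * _).
    by apply: eq_bigr => i /negbTE iM; rewrite /gk /upd iM.
  rewrite (bigD1 M)//= /gk /upd eqxx indicE memNset ?mul0r ?mule0//.
  by move=> /= /esym/eqP; rewrite (negbTE kN).
rewrite integral_nneseries//; last 2 first.
- by move=> k; exact: measurable_funeM.
- by move=> k w _; rewrite -EFinM lee_fin mulr_ge0// prodr_ge0.
pose c := (\prod_(i < n | i != M) \int[Pr]_w (g i (N i w))%:E)%E.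
have c0 : (0 <= c)%E.
  by apply: prode_ge0 => i _; apply: integral_ge0 => w _; rewrite lee_fin.
transitivity (\sum_(k <oo) c * ((g M k)%:E * Pr [set w | N M w = k]))%E.
  apply: eq_eseriesr => k _; rewrite ge0_integralZl_EFin//; last first.
    by move=> w _; rewrite lee_fin prodr_ge0.
  rewrite ihk muleCA; congr (_ * _)%E; rewrite (bigD1 M)//= muleC; congr (_ * _)%E.
    by apply: eq_bigr => i /negbTE iM; rewrite /gk /upd iM.
  rewrite /gk /upd eqxx -(setIT [set w | N M w = k]) -integral_indic//; exact: m_at.
(* Finiteness of the individual integrals allows this factor to be taken out of the series. *)
have cfin : c \is a fin_num.
  apply: prode_fin_num => i _; rewrite ge0_fin_numE//.
  by apply: integral_ge0 => w _; rewrite lee_fin.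
rewrite -(fineK cfin) nneseriesZl; last by move=> k _; rewrite mule_ge0// lee_fin.
rewrite fineK//.
by rewrite -ge0_integral_count// [RHS](bigD1 M)//= muleC.
Qed.

Lemma sqint_indep (g : 'I_n -> nat -> R[i]) :
  (forall i, sqintegrable Pr (fun w => g i (N i w))) ->
  sqintegrable Pr (fun w => \prod_(i < n) g i (N i w)).
Proof.
move=> hg; apply/sqintP; split.
  by apply: Cmeas_prod => i _; exact: Cmeas_count.
have e w : nsq (\prod_(i < n) g i (N i w)) = \prod_(i < n) nsq (g i (N i w)).
  elim/big_rec2: _ => [|i x y _ <-]; first by rewrite -sqr_modc modc1 expr1n.
  by rewrite nsqM.
apply: Rintegrable_ge0 => [|w|]; last 2 first.
- exact: nsq_ge0.
- under eq_integral do rewrite e.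
  have h i : (\int[Pr]_w (nsq (g i (N i w)))%:E)%E \is a fin_num.
    exact: (integrable_fin_num measurableT (sqint_nsq (hg i))).
  have h0 i : (0 <= \int[Pr]_w (nsq (g i (N i w)))%:E)%E.
    by apply: integral_ge0 => w _; rewrite lee_fin nsq_ge0.
  rewrite (ge0_integral_indep (g := fun i k => nsq (g i k))).
  + by rewrite -ge0_fin_numE ?prode_ge0// prode_fin_num.
  + by move=> i k; exact: nsq_ge0.
  + by move=> i; rewrite -ge0_fin_numE.
apply: Cmeas_nsq; apply: Cmeas_prod => i _; exact: Cmeas_count.
Qed.

Let Cint f := Cintegral Pr setT f.

Lemma sqint_cst1 : sqintegrable Pr (fun=> 1).
Proof.
apply/sqintP; split; first exact: Cmeas_cst.
apply: Rintegrable_ge0 => [|w|]; first exact: measurable_cst.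
  exact: nsq_ge0.
rewrite integral_cst// [X in (_ * X)%E](_ : _ = 1%E) ?mule1 ?ltry//.
exact: (@probability_setT _ _ _ Pr).
Qed.

Lemma Cintegral_dot f : sqintegrable Pr f -> Cint f = dot (toL2 Pr f) (toL2 Pr (fun=> 1)).
Proof.
move=> hf; rewrite dotE//; last exact: sqint_cst1.
by congr (Cintegral _ _ _); apply/funext => w; rewrite rmorph1 mulr1.
Qed.

Lemma sqint_Cintegrable f : sqintegrable Pr f -> Cintegrable Pr f.
Proof.
move=> hf; have := sqint_mul_Cintegrable hf sqint_cst1.
by rewrite (_ : (fun w => _) = f)//; apply/funext => w; rewrite rmorph1 mulr1.
Qed.

(** Cutting at a bounded count turns series over the values of a count into finite sums, which
    linearity of the complex integral can handle. *)
Lemma Ccvg_Cintegral_cut (M : Omega -> nat) f : sqintegrable Pr f ->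
  (forall U : set nat, measurable [set w | U (M w)]) ->
  Ccvg (fun j => Cint (fun w => if (M w < j)%N then f w else 0)) (Cint f).
Proof.
move=> hf mM; have [f1 f2] := sqint_meas hf.
have mf_ j : Cmeas (fun w => if (M w < j)%N then f w else 0).
  have -> : (fun w => if (M w < j)%N then f w else 0) =
      fun w => (\1_[set w | (M w < j)%N] w : R)%:C * f w.
    apply/funext => w; rewrite indicE; case: ifPn => h; first by rewrite mem_set// mul1r.
    by rewrite memNset ?mul0r//; exact/negP.
  apply: CmeasM => //; apply: Cmeas_indic.
  exact: (mM [set k | (k < j)%N]).
have le j w : modc (if (M w < j)%N then f w else 0) <= modc (f w).
  by case: ifP => // _; rewrite modc0 modc_ge0.
have h : L2cvg (fun j => toL2 Pr (fun w => if (M w < j)%N then f w else 0)) (toL2 Pr f).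
  apply: (sqint_Ccvg_dominated (g := f)) => //; apply: aeW => w.
  by apply: cvg_near_cst; exists (M w).+1 => // j /= ->; rewrite subrr modc0.
have c := @ipcvg_ip _ (L2ip Pr) _ _ _ _ h (ipcvg_cst (toL2 Pr (fun=> 1) : L2ip Pr)).
rewrite (Cintegral_dot hf); apply: Ccvg_eq c => j.
exact: esym (Cintegral_dot (sqint_le (mf_ j) (le j) hf)).
Qed.

Lemma Rintegral_indep (g : 'I_n -> nat -> R) : (forall i k, 0 <= g i k) ->
  (forall i, (\int[Pr]_w (g i (N i w))%:E < +oo)%E) ->
  \int[Pr]_w (\prod_(i < n) g i (N i w)) = \prod_(i < n) \int[Pr]_w g i (N i w).
Proof.
move=> g0 goo; rewrite [LHS]/Rintegral ge0_integral_indep//.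
rewrite (eq_bigr (fun i => (\int[Pr]_w g i (N i w))%:E)) ?prodEFin// => i _.
rewrite /Rintegral fineK// ge0_fin_numE//.
by apply: integral_ge0 => w _; rewrite lee_fin.
Qed.

Let Cindics (g : nat -> R[i]) := exists U : set nat, g = fun k => (\1_U k : R)%:C.

Let sqint_indics g i : Cindics g -> sqintegrable Pr (fun w => g (N i w)).
Proof.
move=> [U ->]; apply: sqint_le sqint_cst1; first exact: (@Cmeas_count i (fun k => (\1_U k : R)%:C)).
move=> w; rewrite modc_real modc1 indicE; case: (_ \in _); rewrite ?normr1 ?normr0//.
Qed.

(** The induction of [ge0_integral_indep], with the series over the values of a count replaced by
    finite sums and a limit. *)
Lemma Cintegral_indep (g : 'I_n -> nat -> R[i]) :
  (forall i, sqintegrable Pr (fun w => g i (N i w))) ->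
  Cint (fun w => \prod_(i < n) g i (N i w)) = \prod_(i < n) Cint (fun w => g i (N i w)).
Proof.
suff h m : (m <= n)%N -> forall g : 'I_n -> nat -> R[i],
    (forall i, sqintegrable Pr (fun w => g i (N i w))) ->
    (forall i : 'I_n, (m <= i)%N -> Cindics (g i)) ->
    Cint (fun w => \prod_(i < n) g i (N i w)) = \prod_(i < n) Cint (fun w => g i (N i w)).
  by move=> ig; apply: (h n (leqnn n) g ig) => i; rewrite leqNgt ltn_ord.
elim: m => [_ {}g ig hg|m ih mn {}g ig hg].
  have /choice[U hU] : forall i, Cindics (g i) by move=> i; exact: hg.
  transitivity (Cint (fun w => (\prod_(i < n) \1_(U i) (N i w) : R)%:C)).
    congr (Cintegral _ _ _); apply/funext => w; rewrite rmorph_prod.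
    by apply: eq_bigr => i _; rewrite hU.
  rewrite /Cint Cintegral_real (Rintegral_indep (g := fun i => \1_(U i))).
  - by rewrite rmorph_prod; apply: eq_bigr => i _; rewrite hU Cintegral_real.
  - by move=> i k; rewrite indicE ler0n.
  - move=> i; rewrite -[X in (X < _)%E]/(\int[Pr]_w (\1_[set w | U i (N i w)] w)%:E)%E.
    rewrite integral_indic ?setIT//.
    by apply: (le_lt_trans (probability_le1 _ (mN i (U i)))); rewrite ltry.
pose M := Ordinal mn.
pose gk k := upd g M (fun j => (\1_[set k] j : R)%:C).
have igk k i : sqintegrable Pr (fun w => gk k i (N i w)).
  by rewrite /gk /upd; case: eqP => // _; apply: (@sqint_indics (fun j => (\1_[set k] j : R)%:C) i); exists [set k].
have hgk k (i : 'I_n) : (m <= i)%N -> Cindics (gk k i).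
  rewrite /gk /upd; case: eqP => [_ _|/eqP iM mi]; first by exists [set k].
  by apply: hg; rewrite ltn_neqAle mi andbT eq_sym.
have ihk k := ih (ltnW mn) _ (igk k) (hgk k).
have mNM : forall U : set nat, measurable [set w | U (N M w)] by move=> U; exact: mN.
(* Below [j] exactly one of the indicators equals 1, and from [j] on none does. *)
have cut f j w : (if (N M w < j)%N then f w else 0) =
    \sum_(0 <= k < j) ((\1_[set k] (N M w) : R)%:C * f w) :> R[i].
  case: ifPn => h.
    rewrite (bigD1_seq (N M w)) ?iota_uniq ?mem_index_iota//= indicE mem_set//.
    rewrite mul1r big1 ?addr0// => k /negbTE kN.
    by rewrite indicE memNset ?mul0r// => /= /eqP; rewrite eq_sym kN.
  rewrite big_nat_cond big1// => k /andP[/andP[_ kj] _].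
  rewrite indicE memNset ?mul0r// => /= kN; move/negP: h; apply; by rewrite kN.
apply: (Ccvg_unique (Ccvg_Cintegral_cut (sqint_indep ig) mNM)).
have := CcvgM (Ccvg_cst (\prod_(i < n | i != M) Cint (fun w => g i (N i w))))
  (Ccvg_Cintegral_cut (ig M) mNM).
rewrite [X in _ -> Ccvg _ X](bigD1 M)//= [X in _ -> Ccvg _ X]mulrC.
apply: Ccvg_eq => j.
have e1 : (fun w => if (N M w < j)%N then g M (N M w) else 0) =
    fun w => \sum_(0 <= k < j) g M k * gk k M (N M w).
  apply/funext => w; apply: (etrans (cut (fun w => g M (N M w)) j w)).
  apply: eq_bigr => k _; rewrite /gk /upd eqxx mulrC.
  rewrite indicE; have [->|/eqP kN] := eqVneq (N M w) k; first by rewrite mem_set.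
  by rewrite memNset ?mul0r ?mulr0.
have e2 : (fun w => if (N M w < j)%N then \prod_(i < n) g i (N i w) else 0) =
    fun w => \sum_(0 <= k < j) g M k * \prod_(i < n) gk k i (N i w).
  apply/funext => w; apply: (etrans (cut (fun w => \prod_(i < n) g i (N i w)) j w)).
  apply: eq_bigr => k _; rewrite (bigD1 M)//= [in RHS](bigD1 M)//= /gk /upd eqxx.
  rewrite [in RHS](eq_bigr (fun i => g i (N i w))) => [|i /negbTE -> //].
  rewrite !mulrA; congr (_ * _); rewrite mulrC.
  rewrite indicE; have [->|/eqP kN] := eqVneq (N M w) k; first by rewrite mem_set.
  by rewrite memNset ?mul0r ?mulr0.
rewrite e1 e2 /Cint !Cintegral_sum; last 2 first.
- by move=> k; apply: CintegrableZ; apply: sqint_Cintegrable; exact: sqint_indep.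
- by move=> k; apply: CintegrableZ; apply: sqint_Cintegrable; exact: igk.
rewrite mulr_sumr; apply: eq_bigr => k _.
rewrite !CintegralZ; last 2 first.
- by apply: sqint_Cintegrable; exact: sqint_indep.
- by apply: sqint_Cintegrable; exact: igk.
rewrite [LHS]mulrCA; congr (_ * _); apply: (etrans _ (esym (ihk k))).
rewrite [RHS](bigD1 M)//= [LHS]mulrC; congr (_ * _); apply: eq_bigr => i /negbTE iM.
by rewrite /gk /upd iM.
Qed.

Section generating_function.
Variable r : 'I_n -> R.
Hypothesis r0 : forall i, 0 <= r i.
Hypothesis law : forall i k,
  Pr [set w | N i w = k] = (expR (- r i) * r i ^+ k / k`!%:R)%:E.

(** The second moment is a Poisson series at [nsq z], with partial sums at most
    [expR (- r i) * expR (nsq z * r i)]. *)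
Lemma sqint_gf i (z : R[i]) : sqintegrable Pr (fun w => z ^+ N i w).
Proof.
apply/sqintP; split; first exact: (@Cmeas_count i (fun k => z ^+ k)).
apply: Rintegrable_ge0 => [|w|]; last 2 first.
- exact: nsq_ge0.
- rewrite (@ge0_integral_count i (fun k => nsq (z ^+ k))); last by move=> k; exact: nsq_ge0.
  apply: (@le_lt_trans _ _ (expR (- r i) * expR (nsq z * r i))%:E); last exact: ltry.
  have nX k : nsq (z ^+ k) = nsq z ^+ k by rewrite -!sqr_modc modcX exprAC.
  apply: nneseries_le => [k|k].
    by rewrite law -EFinM lee_fin mulr_ge0 ?nsq_ge0// divr_ge0// mulr_ge0 ?expR_ge0 ?exprn_ge0.
  under eq_bigr do rewrite law -EFinM nX.
  rewrite sumEFin lee_fin.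
  have -> : \sum_(0 <= j < k) (nsq z ^+ j * (expR (- r i) * r i ^+ j / j`!%:R)) =
      expR (- r i) * \sum_(0 <= j < k) exp_coeff (nsq z * r i) j.
    by rewrite mulr_sumr; apply: eq_bigr => j _; rewrite /exp_coeff/= exprMn; ring.
  rewrite ler_wpM2l ?expR_ge0//; apply: nondecreasing_cvgn_le.
    apply/nondecreasing_seqP => j; rewrite /series/= big_nat_recr//= lerDl.
    by apply: exp_coeff_ge0; rewrite mulr_ge0 ?nsq_ge0.
  exact: is_cvg_series_exp_coeff.
apply: Cmeas_nsq; exact: (@Cmeas_count i (fun k => z ^+ k)).
Qed.

(** Cut at [j], the expectation is [expR (- r i)] times the partial sum [expsum j] at [r i * z]. *)
Lemma Cintegral_gf i (z : R[i]) : Cint (fun w => z ^+ N i w) = cexps ((r i)%:C * (z - 1)).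
Proof.
have mNi : forall U : set nat, measurable [set w | U (N i w)] by move=> U; exact: mN.
apply: (Ccvg_unique (Ccvg_Cintegral_cut (sqint_gf i z) mNi)).
have := CcvgM (Ccvg_cst (expR (- r i))%:C) (cexps_cvg ((r i)%:C * z)).
rewrite -cexps_real -cexpsD.
rewrite (_ : (- r i)%:C + (r i)%:C * z = (r i)%:C * (z - 1)); last first.
  by rewrite mulrBr mulr1 rmorphN addrC.
apply: Ccvg_eq => j.
transitivity (Cint (fun w => \sum_(0 <= k < j) z ^+ k * (\1_(at_count i k) w : R)%:C)).
  rewrite /Cint Cintegral_sum => [|k]; last first.
    by apply: CintegrableZ; split; [exact: integrable_indic|exact: integrable0].
  rewrite /expsum mulr_sumr; apply: eq_bigr => k _.
  rewrite CintegralZ; last by split; [exact: integrable_indic|exact: integrable0].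
  rewrite Cintegral_real /Rintegral integral_indic ?setIT//.
  have -> : fine (Pr (at_count i k)) = expR (- r i) * r i ^+ k / k`!%:R.
    by rewrite -[RHS]/(fine (_%:E)) -law.
  rewrite cexps_real exprMn !rmorphM rmorphXn fmorphV rmorph_nat.
  have e (a b c v : R[i]) : a * (b * c * v) = c * (a * b * v) by ring.
  exact: e.
congr (Cintegral _ _ _); apply/funext => w.
case: ifPn => h.
  rewrite (bigD1_seq (N i w)) ?iota_uniq ?mem_index_iota//= indicE mem_set//.
  rewrite mulr1 big1 ?addr0// => k /negbTE kN.
  by rewrite indicE memNset ?mulr0// => /= /eqP; rewrite eq_sym kN.
rewrite big_nat_cond big1// => k /andP[/andP[_ kj] _].
rewrite indicE memNset ?mulr0// => /= kN; move/negP: h; apply; by rewrite kN.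
Qed.

Lemma Cintegral_gf_prod (z : 'I_n -> R[i]) :
  Cint (fun w => \prod_(i < n) z i ^+ N i w) =
  cexps (\sum_(i < n) (r i)%:C * (z i - 1)).
Proof.
rewrite (Cintegral_indep (g := fun i k => z i ^+ k)) => [|i]; last exact: sqint_gf.
by rewrite cexps_sum; apply: eq_bigr => i _; exact: Cintegral_gf.
Qed.

Lemma sqint_gf_prod (z : 'I_n -> R[i]) :
  sqintegrable Pr (fun w => \prod_(i < n) z i ^+ N i w).
Proof. by apply: (sqint_indep (g := fun i k => z i ^+ k)) => i; exact: sqint_gf. Qed.

End generating_function.

End independent_counts.

(** * Indicators of count events as Taylor coefficients *)

Section count_extraction.
Context {R : realType}.
Local Open Scope complex_scope.

Definition indc (k j : nat) : R[i] := (j == k)%:R.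

Definition powc (t : R) (j : nat) : R[i] := t%:C ^+ j.

Definition repl n (T : Type) (g : 'I_n -> T) (m : 'I_n) (x : T) : 'I_n -> T :=
  fun i => if i == m then x else g i.

Definition prodc n (O : Type) (N : 'I_n -> O -> nat) (g : 'I_n -> nat -> R[i]) w : R[i] :=
  \prod_(i < n) g i (N i w).

Lemma prodc_repl n (O : Type) (N : 'I_n -> O -> nat) g m x w :
  prodc N (repl g m x) w = (\prod_(i < n | i != m) g i (N i w)) * x (N m w).
Proof.
rewrite /prodc (bigD1 m)//= /repl eqxx mulrC; congr (_ * _).
by apply: eq_bigr => i /negbTE ->.
Qed.

Lemma modc_indc k j : modc (indc k j) <= 1.
Proof. by rewrite /indc; case: eqP => _; rewrite ?modc1 ?modc0. Qed.

Lemma modc_powc t j : 0 < t <= 1 -> modc (powc t j) <= 1.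
Proof.
move=> /andP[t0 t1]; rewrite /powc modcX modc_real ger0_norm ?(ltW t0)//.
by rewrite exprn_ile1 ?(ltW t0).
Qed.

(** As a function of [t], [t^j] is a power series whose k-th coefficient is the indicator of
    [j = k]; the remainder after [p] terms is at most [t^p] for [0 < t <= 1]. *)
Lemma powc_tail t p j : powc t j - \sum_(0 <= k < p) t%:C ^+ k * indc k j =
  if (j < p)%N then 0 else powc t j.
Proof.
case: ifPn => h.
  rewrite (bigD1_seq j) ?iota_uniq ?mem_index_iota//= /indc eqxx mulr1.
  rewrite big1 ?addr0 ?subrr// => k /negbTE kj.
  by rewrite eq_sym kj mulr0.
rewrite big_nat_cond big1 ?subr0// => k /andP[/andP[_ kp] _].
by rewrite /indc; case: eqP => [jk|_]; [move: h; rewrite jk kp | rewrite mulr0].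
Qed.

Section one_space.
Context d (Omega : measurableType d) (Pr : probability Omega R) (n : nat).
Context (N : 'I_n -> Omega -> nat).
Hypothesis mN : forall i (U : set nat), measurable [set w | U (N i w)].

Lemma sqint_bounded f (c : R) : Cmeas f -> (forall w, modc (f w) <= c) -> sqintegrable Pr f.
Proof.
move=> mf f1; apply: (@sqint_le _ _ _ Pr f (fun=> c%:C * 1)) => // [w|].
  by rewrite modcM modc1 mulr1 modc_real; exact: le_trans (f1 w) (ler_norm _).
by apply: sqintegrableZ; exact: sqint_cst1.
Qed.

Lemma Cmeas_prodc g : Cmeas (prodc N g).
Proof. by apply: Cmeas_prod => i _; exact: (@Cmeas_count _ _ R _ N mN i (g i)). Qed.

Lemma modc_prodc_le1 g w : (forall i k, modc (g i k) <= 1) -> modc (prodc N g w) <= 1.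
Proof.
move=> g1; rewrite /prodc; elim/big_rec: _ => [|i z _ z1]; first by rewrite modc1.
by rewrite modcM mulr_ile1 ?modc_ge0.
Qed.

Lemma sqint_prodc g : (forall i k, modc (g i k) <= 1) -> sqintegrable Pr (prodc N g).
Proof. by move=> g1; apply: (sqint_bounded (Cmeas_prodc g)) => w; exact: modc_prodc_le1. Qed.

Lemma prodc_tail g m t p : (forall i k, modc (g i k) <= 1) -> 0 < t <= 1 ->
  L2norm (toL2 Pr (prodc N (repl g m (powc t))) -
    \sum_(0 <= k < p) t%:C ^+ k *: toL2 Pr (prodc N (repl g m (indc k)))) <=
  L2norm (toL2 Pr (fun=> 1)) * t ^+ p.
Proof.
move=> g1 t01; have /andP[t0 t1] := t01.
have rp x : (forall j, modc (x j) <= 1) -> forall i k, modc (repl g m x i k) <= 1.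
  by move=> x1 i k; rewrite /repl; case: eqP.
have sp : sqintegrable Pr (prodc N (repl g m (powc t))).
  by apply: sqint_prodc; apply: rp => j; exact: modc_powc.
have si k : sqintegrable Pr (prodc N (repl g m (indc k))).
  by apply: sqint_prodc; apply: rp => j; exact: modc_indc.
have si' k : sqintegrable Pr (fun w => t%:C ^+ k * prodc N (repl g m (indc k)) w).
  exact: sqintegrableZ.
pose h w := prodc N (repl g m (powc t)) w -
  \sum_(0 <= k < p) t%:C ^+ k * prodc N (repl g m (indc k)) w.
have -> : toL2 Pr (prodc N (repl g m (powc t))) -
    \sum_(0 <= k < p) t%:C ^+ k *: toL2 Pr (prodc N (repl g m (indc k))) = toL2 Pr h.
  apply/esym/(etrans (toL2B sp (sqint_sum _ si'))); congr (_ - _).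
  apply: (etrans (toL2_sum _ si')); apply: eq_bigr => k _; exact: toL2Z.
rewrite mulrC; apply: (proj2 (@L2norm_toL2_le _ _ _ Pr h (fun=> 1) (t ^+ p) _ _ _ _)).
- by rewrite exprn_ge0// ltW.
- by apply: (sqint_meas (mu := Pr)); apply: sqintB => //; exact: sqint_sum.
- exact: sqint_cst1.
move=> w; rewrite modc1 mulr1 /h prodc_repl.
under [X in _ - X]eq_bigr do rewrite prodc_repl mulrCA.
rewrite -mulr_sumr -mulrBr powc_tail modcM; case: ifPn => h0.
  by rewrite modc0 mulr0 exprn_ge0// ltW.
rewrite -leqNgt in h0.
rewrite -[leRHS]mul1r ler_pM ?modc_ge0//.
  elim/big_rec: _ => [|i z _ z1]; first by rewrite modc1.
  by rewrite modcM mulr_ile1 ?modc_ge0.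
rewrite /powc modcX modc_real ger0_norm ?(ltW t0)//.
by apply: ler_wiXn2l => //; exact: ltW.
Qed.

End one_space.

Section two_spaces.
Context d1 (O1 : measurableType d1) (Pr1 : probability O1 R).
Context d2 (O2 : measurableType d2) (Pr2 : probability O2 R).
Context (n : nat) (N1 : 'I_n -> O1 -> nat) (N2 : 'I_n -> O2 -> nat).
Hypothesis mN1 : forall i (U : set nat), measurable [set w | U (N1 i w)].
Hypothesis mN2 : forall i (U : set nat), measurable [set w | U (N2 i w)].
Variables (K : set (L2 Pr1)) (T : L2 Pr1 -> L2 Pr2).
Hypotheses (sK : @ipsub _ (L2ip Pr1) K) (cK : @ipclosed _ (L2ip Pr1) K).
Hypotheses (lT : @iplinear _ (L2ip Pr1) (L2ip Pr2) K T).
Hypotheses (bT : @ipbounded _ (L2ip Pr1) (L2ip Pr2) K T).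

(* The product of the t_i ^ N_i is a power series in each t_i; its coefficients
   are recovered from its values at small t_i. *)
Lemma count_extraction :
  (forall z : 'I_n -> R, (forall i, 0 < z i <= 1) ->
    K (toL2 Pr1 (prodc N1 (powc \o z))) /\
    T (toL2 Pr1 (prodc N1 (powc \o z))) = toL2 Pr2 (prodc N2 (powc \o z))) ->
  forall k : 'I_n -> nat, K (toL2 Pr1 (prodc N1 (indc \o k))) /\
    T (toL2 Pr1 (prodc N1 (indc \o k))) = toL2 Pr2 (prodc N2 (indc \o k)).
Proof.
move=> base k.
pose isind (h : nat -> R[i]) := exists k, h = indc k.
pose ispow (h : nat -> R[i]) := exists2 z, 0 < z <= 1 & h = powc z.
(* One coordinate at a time: the first [m] already carry indicators, the others still carry
   powers. *)
suff h m : (m <= n)%N -> forall g : 'I_n -> nat -> R[i],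
    (forall i : 'I_n, (i < m)%N -> isind (g i)) ->
    (forall i : 'I_n, (m <= i)%N -> ispow (g i)) ->
    K (toL2 Pr1 (prodc N1 g)) /\ T (toL2 Pr1 (prodc N1 g)) = toL2 Pr2 (prodc N2 g).
  apply: (h n (leqnn n)) => i; last by rewrite leqNgt ltn_ord.
  by move=> _; exists (k i).
elim: m => [_ g _ gp|m ih mn g gi gp].
  have /choice[z hz] : forall i, exists z, 0 < z <= 1 /\ g i = powc z.
    by move=> i; have [z z1 z2] := gp i (leq0n _); exists z.
  have -> : g = powc \o z by apply/funext => i; exact: (hz i).2.
  by apply: base => i; exact: (hz i).1.
pose M := Ordinal mn.
have [kM gM] := gi M (leqnn _).
have g1 i j : modc (g i j) <= 1.
  have [im|im] := ltnP i m.+1; first by have [p ->] := gi i im; exact: modc_indc.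
  by have [z z1 ->] := gp i im; exact: modc_powc.
have gE : g = repl g M (indc kM).
  by apply/funext => i; rewrite /repl; case: eqP => [->|].
rewrite gE.
apply: (@power_extraction _ (L2ip Pr1) (L2ip Pr2) K T
  (fun t => toL2 Pr1 (prodc N1 (repl g M (powc t))))
  (fun p => toL2 Pr1 (prodc N1 (repl g M (indc p))))
  (fun t => toL2 Pr2 (prodc N2 (repl g M (powc t))))
  (fun p => toL2 Pr2 (prodc N2 (repl g M (indc p)))) sK cK lT bT).
- move=> t t01; apply: (ih (ltnW mn)) => i im; rewrite /repl.
    by rewrite -val_eqE/= (ltn_eqF im); apply: gi; exact: ltnW.
  case: eqP => [_|/eqP iM]; first by exists t.
  by apply: gp; rewrite ltn_neqAle im andbT eq_sym.
- by move=> p; exists (L2norm (toL2 Pr1 (fun=> 1))) => t t01; exact: prodc_tail.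
- by move=> p; exists (L2norm (toL2 Pr2 (fun=> 1))) => t t01; exact: prodc_tail.
Qed.

End two_spaces.
End count_extraction.

(** * From extended values to natural counts *)

Section extended_counts.
Context {R : realType}.

(* [0] on the values that are not natural numbers. *)
Definition cntE (x : \bar R) : nat := xget 0%N [set k | x = k%:R%:E].

Lemma cntE_nat k : cntE k%:R%:E = k.
Proof.
rewrite /cntE; case: xgetP => [j _ [/eqP]|/(_ k)/(_ erefl)//].
by rewrite eqr_nat => /eqP.
Qed.

Lemma measurable_cntE (U : set nat) : measurable [set x | U (cntE x)].
Proof.
have mV (V : set nat) : measurable [set x : \bar R | exists2 k, V k & x = k%:R%:E].
  have -> : [set x : \bar R | exists2 k, V k & x = k%:R%:E] =
      \bigcup_(k in V) [set k%:R%:E].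
    by apply/seteqP; split => x [k Vk ->]; exists k.
  apply: bigcup_measurable => k _; exact: emeasurable_set1.
(* The default value 0 of [cntE] puts every value that is not a natural number into the set exactly
   when [U] contains 0. *)
have [U0|U0] := pselect (U 0%N); last first.
  suff -> : [set x | U (cntE x)] = [set x : \bar R | exists2 k, U k & x = k%:R%:E] by [].
  apply/seteqP; split => [x|x [k Uk ->]] /=; last by rewrite cntE_nat.
  by rewrite /cntE; case: xgetP => // k _ -> Uk; exists k.
suff -> : [set x | U (cntE x)] = ~` [set x : \bar R | exists2 k, (~` U) k & x = k%:R%:E].
  by apply: measurableC.
apply/seteqP; split => [x /= Ux [k nUk xk]|x /= h].
  by apply: nUk; move: Ux; rewrite xk cntE_nat.
rewrite /cntE; case: xgetP => // k _ xk; apply: contrapT => nUk.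
by apply: h; exists k.
Qed.

End extended_counts.

Section complete_measure.
Context d (T : measurableType d) {R : realType} (mu : {measure set T -> \bar R}).
Hypothesis cmu : measure_is_complete mu.

(** Applied to [exp_eta f], which is known to be a product of powers of counts only almost
    everywhere; completeness supplies its measurability. *)
Lemma Cmeas_ae (f g : T -> R[i]) : {ae mu, forall x, f x = g x} -> Cmeas g -> Cmeas f.
Proof.
move=> fg [g1 g2]; split; apply/measurable_EFinP.
- apply: (ae_measurable_fun (f := EFin \o (fun x => complex.Re (g x))) cmu).
    by apply: filterS fg => x /= -> _.
  exact/measurable_EFinP.
- apply: (ae_measurable_fun (f := EFin \o (fun x => complex.Im (g x))) cmu).
    by apply: filterS fg => x /= -> _.
  exact/measurable_EFinP.
Qed.

End complete_measure.

(** A finite family of counts takes countably many values, so every predicate of it is a countable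
    union of elementary events. It is also applied with a generated sub-sigma-algebra on [T]. *)
Lemma measurable_counts d (T : measurableType d) n (N : 'I_n -> T -> nat)
    (Q : set ('I_n -> nat)) :
  (forall i k, measurable [set w | N i w = k]) ->
  measurable [set w | Q (fun i => N i w)].
Proof.
move=> mN; have -> : [set w | Q (fun i => N i w)] =
    \bigcup_(k : {ffun 'I_n -> nat}) ([set w | Q k] `&` \bigcap_(i in setT) [set w | N i w = k i]).
  apply/seteqP; split => [w Qw|w [k _ [Qk Nk]]] /=.
    exists (finfun (fun i => N i w)) => //; split => [|i _] /=; last by rewrite ffunE.
    suff -> : ([ffun i => N i w] : 'I_n -> nat) = (fun i => N i w) by [].
    by apply/funext => i; rewrite ffunE.
  by rewrite (_ : (fun i => N i w) = k)//; apply/funext => i; exact: Nk.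
apply: countable_bigcupT_measurable => [|k]; first exact: countableP.
apply: measurableI; last by apply: fin_bigcap_measurable => // i _; exact: mN.
by have [Qk|Qk] := pselect (Q k); [rewrite (_ : mkset _ = setT)//; apply/seteqP; split
  |rewrite (_ : mkset _ = set0)//; apply/seteqP; split].
Qed.

Section poisson_counts.
Context dY (Y : measurableType dY) dO (Omega : measurableType dO) (R : realType).
Context (Pr : probability Omega R) (eta : R.-ker Omega ~> Y).
Context (lam : {measure set Y -> \bar R}).
Hypothesis poi : poisson_process Pr eta lam.
Local Open Scope complex_scope.

Definition npoints (B : set Y) (w : Omega) : nat := cntE (eta w B).

Definition rate (B : set Y) : R := fine (lam B).

Lemma measurable_eta B (V : set (\bar R)) : measurable B -> measurable V ->
  measurable [set w | V (eta w B)].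
Proof.
move=> mB mV; have := measurable_kernel eta B mB measurableT V mV.
by rewrite setTI.
Qed.

Lemma measurable_count_eta B (U : set nat) : measurable B ->
  measurable [set w | U (npoints B w)].
Proof. by move=> mB; exact: (measurable_eta mB (measurable_cntE U)). Qed.

Lemma rate_ge0 B : 0 <= rate B.
Proof. by rewrite fine_ge0. Qed.

Lemma EFin_rate B : (lam B < +oo)%E -> lam B = (rate B)%:E.
Proof. by move=> Bf; rewrite /rate fineK// ge0_fin_numE. Qed.

(** The Poisson probabilities of the natural values add up to 1. *)
Lemma eta_count_ae B : measurable B -> (lam B < +oo)%E ->
  {ae Pr, forall w, eta w B = (npoints B w)%:R%:E}.
Proof.
move=> mB Bf; have [_ law _] := poi.
have Plaw := (law B mB).2 _ (EFin_rate Bf).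
pose A k := [set w | eta w B = k%:R%:E].
have mA k : measurable (A k) by apply: (measurable_eta mB (V := [set k%:R%:E])); exact: emeasurable_set1.
have mU : measurable (\bigcup_k A k) by exact: bigcupT_measurable.
have tA : trivIset setT A.
  apply/trivIsetP => i j _ _ ij; apply/seteqP; split => // w []; rewrite /A /= => -> [/eqP].
  by rewrite eqr_nat (negbTE ij).
have P1 : Pr (\bigcup_k A k) = 1%E.
  rewrite measure_semi_bigcup//.
  apply/cvg_lim => //; rewrite (_ : (fun n => _) =
      EFin \o (fun n => expR (- rate B) * expsum n (rate B))); last first.
    apply/funext => n /=; rewrite mulr_sumr -sumEFin.
    by apply: eq_bigr => k _; rewrite Plaw mulrA.
  rewrite -[X in _ --> X]/((1:R)%:E); apply: cvg_EFin_nat.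
  rewrite -(expRxMexpNx_1 (rate B)) mulrC; apply: cvgMr; exact: expsum_expR.
exists (~` \bigcup_k A k); split; first exact: measurableC.
  by apply: (etrans (probability_setC _ mU)); rewrite P1 subee.
by move=> w /= h [k _ Ak]; apply: h; rewrite /npoints Ak cntE_nat.
Qed.

(** For [k = 0] the event also contains the points where [eta w B] is not a natural number; these
    form a null set by [eta_count_ae]. *)
Lemma count_law B k : measurable B -> (lam B < +oo)%E ->
  Pr [set w | npoints B w = k] = (expR (- rate B) * rate B ^+ k / k`!%:R)%:E.
Proof.
move=> mB Bf; have [_ law _] := poi; rewrite -((law B mB).2 _ (EFin_rate Bf)).
have mc : measurable [set w | npoints B w = k] by exact: (measurable_count_eta [set k] mB).
have me : measurable [set w | eta w B = k%:R%:E].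
  by apply: (measurable_eta mB (V := [set k%:R%:E])); exact: emeasurable_set1.
have [N [mN N0 sN]] := eta_count_ae mB Bf.
apply/eqP; rewrite eq_le; apply/andP; split.
  apply: (@le_trans _ _ (Pr ([set w | eta w B = k%:R%:E] `|` N))).
    apply: le_measure; rewrite ?inE//; first exact: measurableU.
    move=> w /= wk; have [h|h] := pselect (eta w B = (npoints B w)%:R%:E).
      by left; rewrite h wk.
    by right; exact: sN.
  apply: (le_trans (measureU2 _ me mN)); rewrite -[leRHS]adde0 leeD//.
  exact: (eq_ind _ (fun z => z <= 0)%E (lexx 0%E) _ (esym N0)).
by apply: le_measure; rewrite ?inE// => w /= h; rewrite /npoints h cntE_nat.
Qed.

Lemma count_indep n (B : 'I_n -> set Y) (U : 'I_n -> set nat) :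
  (forall i, measurable (B i)) -> trivIset setT B ->
  Pr (\bigcap_(i in setT) [set w | U i (npoints (B i) w)]) =
  (\prod_(i < n) Pr [set w | U i (npoints (B i) w)])%E.
Proof.
move=> mB tB; have [_ _ ind] := poi.
by apply: (ind n B (fun i => [set x | U i (cntE x)])) => // i; exact: measurable_cntE.
Qed.

End poisson_counts.

(** * The vectors Sigma of step functions *)

Section step_functions.
Context d (T : measurableType d) {R : realType}.
Local Open Scope complex_scope.

Definition step m (B : 'I_m -> set T) (c : 'I_m -> R[i]) (y : T) : R[i] :=
  \sum_(i < m) c i * (\1_(B i) y : R)%:C.

Lemma step_in m (B : 'I_m -> set T) c i y : trivIset setT B -> B i y -> step B c y = c i.
Proof.
move=> tB Biy; rewrite /step (bigD1 i)//= indicE mem_set// mulr1 big1 ?addr0// => j ji.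
rewrite indicE memNset ?mulr0// => Bjy; move/eqP: ji; apply.
by apply: tB => //; exists y.
Qed.

Lemma step_out m (B : 'I_m -> set T) c y : (forall i, ~ B i y) -> step B c y = 0.
Proof. by move=> nB; rewrite /step big1// => i _; rewrite indicE memNset ?mulr0. Qed.

Section integral.
Variables (mu : {measure set T -> \bar R}) (m : nat) (B : 'I_m -> set T).
Hypotheses (mB : forall i, measurable (B i)) (fB : forall i, (mu (B i) < +oo)%E).

Let int_indic i : Rintegrable mu (\1_(B i)).
Proof.
apply: Rintegrable_ge0 => [|y|]; first exact: measurable_indic.
  by rewrite indicE ler0n.
by rewrite integral_indic ?setIT.
Qed.

Let Cint_indic i : Cintegrable mu (fun y => (\1_(B i) y : R)%:C).
Proof. by split; [exact: int_indic|exact: integrable0]. Qed.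

(** Applied to [lam] on the whole space and to [eta w] on [X], the latter also with the possibly
    overlapping sets behind [powf]. *)
Lemma Cintegral_step c (X : set T) f : measurable X -> (forall i, B i `<=` X) ->
  (forall y, X y -> f y = step B c y) ->
  Cintegral mu X f = \sum_(i < m) c i * (fine (mu (B i)))%:C.
Proof.
move=> mX BX fE; transitivity (Cintegral mu setT (step B c)).
  have h (p : R[i] -> R) : p 0 = 0 ->
      Rintegral mu X (p \o f) = Rintegral mu setT (p \o step B c).
    move=> p0; rewrite /Rintegral integral_mkcond; congr fine; apply: eq_integral => y _.
    rewrite patchE; case: ifPn => [/set_mem/fE /= ->//|yX] /=.
    rewrite step_out ?p0// => i Biy; move/negP: yX; apply; rewrite inE; exact: (BX i).
  by rewrite /Cintegral !h.
rewrite /step Cintegral_sum => [|i]; last by apply: CintegrableZ; exact: Cint_indic.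
apply: eq_bigr => i _; rewrite CintegralZ; last exact: Cint_indic.
by rewrite Cintegral_real /Rintegral integral_indic ?setIT.
Qed.

Lemma sqint_step c : sqintegrable mu (step B c).
Proof.
apply: sqint_sum => i; apply: sqintegrableZ; apply/sqintP; split; first exact: Cmeas_indic.
rewrite (_ : (fun _ => _) = \1_(B i)); first exact: int_indic.
apply/funext => y; rewrite nsq_real indicE; case: (_ \in _); rewrite ?expr1n//.
by rewrite expr0n.
Qed.

End integral.

(* Two functions with finite range are constant on a common finite family of
   disjoint sets covering the points where they do not both vanish. *)
Lemma step_pair (mu : {measure set T -> \bar R}) (f g : T -> R[i]) :
  sqintegrable mu f -> sqintegrable mu g ->
  finite_set (range f) -> finite_set (range g) ->
  exists m (B : 'I_m -> set T) c d, [/\ forall i, measurable (B i),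
    forall i, (mu (B i) < +oo)%E, trivIset setT B, f = step B c /\ g = step B d
    & forall i, exists2 y, B i y &
      forall y, B i y -> [/\ f y = c i, g y = d i & f y != 0 \/ g y != 0]].
Proof.
move=> sf sg ff fg; have [mf1 mf2] := sqint_meas sf; have [mg1 mg2] := sqint_meas sg.
pose h y := (f y, g y).
have fh : finite_set (range h).
  apply: (@sub_finite_set _ _ (range f `*` range g)); last exact: finite_setX.
  by move=> p [y _ <-]; split; exists y.
have [s us sE] : exists2 s : seq (R[i] * R[i]), uniq s &
    forall p, (p \in s) = `[< (exists y, h y = p) /\ p != (0, 0) >].
  have /finite_seqP[s0 s0E] := fh.
  (* The pair [(0, 0)] is removed because the set where both functions vanish may have infinite
     measure. *)
  exists (undup [seq p <- s0 | p != (0, 0)]); first exact: undup_uniq.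
  move=> p; rewrite mem_undup mem_filter; apply/andP/asboolP => -[h1 h2]; split => //.
    by have : [set` s0] p by []; rewrite -s0E => -[y _ <-]; exists y.
  by have [y yp] := h1; have : range h p by [exists y]; rewrite s0E.
pose p i := tnth (in_tuple s) i.
pose B (i : 'I_(size s)) := [set y | h y = p i].
have ps i : exists2 y, h y = p i & p i != (0, 0).
  have : p i \in s by exact: mem_tnth.
  by rewrite sE => /asboolP[[y hy] pn]; exists y.
have mB i : measurable (B i).
  have -> : B i = ((fun y => complex.Re (f y)) @^-1` [set complex.Re (p i).1] `&`
      (fun y => complex.Im (f y)) @^-1` [set complex.Im (p i).1]) `&`
     ((fun y => complex.Re (g y)) @^-1` [set complex.Re (p i).2] `&`
      (fun y => complex.Im (g y)) @^-1` [set complex.Im (p i).2]).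
    rewrite /B /h; apply/seteqP; split => y /=; first by move=> <-.
    move=> [[e1 e2] [e3 e4]]; rewrite [RHS]surjective_pairing; congr pair; exact: complex_ext.
  by apply: measurableI; apply: measurableI; rewrite -[X in measurable X]setTI;
    [apply: mf1|apply: mf2|apply: mg1|apply: mg2].
have tB : trivIset setT B.
  move=> i j _ _ [y [/= hi hj]]; apply/val_inj/eqP.
  have : p j = p i by rewrite -hi -hj.
  by rewrite /p !(tnth_nth (0,0))/= => /eqP; rewrite nth_uniq// eq_sym.
have fB i : (mu (B i) < +oo)%E.
  have [y hy pn] := ps i.
  (* Chebyshev's inequality: on [B i] the integrable function [|f|^2 + |g|^2] has the constant value
     [a > 0]. *)
  pose a := nsq (p i).1 + nsq (p i).2.
  have a0 : 0 < a.
    rewrite lt_neqAle addr_ge0 ?nsq_ge0// andbT eq_sym paddr_eq0 ?nsq_ge0// !nsq_eq0.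
    by move: pn; case: (p i) => u v.
  have : Rintegrable mu (fun y => nsq (f y) + nsq (g y)) by apply: RintegrableD; exact: sqint_nsq.
  have le : Rintegrable mu (fun y => nsq (f y) + nsq (g y)) -> Rintegrable mu (fun y => a * \1_(B i) y).
    apply: le_Rintegrable => [|z].
      by apply: measurable_funM => //; exact: measurable_indic.
    rewrite indicE; have [zB|zB] := boolP (z \in B i).
      rewrite mulr1 ger0_norm ?(ltW a0)// /a.
      by move: zB; rewrite inE /B /h /= => <-.
    by rewrite mulr0 normr0 addr_ge0 ?nsq_ge0.
  move=> /le/(RintegrableZ a^-1) ia.
  have : Rintegrable mu (\1_(B i)).
    by move: ia; congr Rintegrable; apply/funext => z; rewrite mulrA mulVf ?mul1r// gt_eqF.
  move=> /(integrable_fin_num measurableT).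
  by rewrite integral_indic ?setIT// => /fin_numPlt/andP[].
have key i y : B i y -> [/\ f y = (p i).1, g y = (p i).2 & f y != 0 \/ g y != 0].
  move=> hy; have [_ _] := ps i; rewrite -hy /h /= => pn; split => //.
  by apply/orP; rewrite -negb_and; apply: contra pn => /andP[/eqP -> /eqP ->].
exists (size s), B, (fun i => (p i).1), (fun i => (p i).2); split => //.
  have cov y : (exists i, B i y) \/ (forall i, ~ B i y) /\ h y = (0, 0).
    have [hy|hy] := eqVneq (h y) (0, 0).
      by right; split => // i Bi; have [_ _] := ps i; rewrite -Bi hy eqxx.
    left; have : h y \in s by rewrite sE; apply/asboolP; split => //; exists y.
    by move=> /(@tnthP _ _ (in_tuple s))[i hi]; exists i.
  split; apply/funext => y; have [[i Bi]|[nB [fy gy]]] := cov y.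
  - by rewrite (step_in _ tB Bi); have [] := key _ _ Bi.
  - by rewrite (step_out _ nB).
  - by rewrite (step_in _ tB Bi); have [] := key _ _ Bi.
  - by rewrite (step_out _ nB).
by move=> i; have [y hy _] := ps i; exists y => // z; exact: key.
Qed.

End step_functions.

Lemma ae_mul_eq d (T : measurableType d) (R : realType) (mu : {measure set T -> \bar R})
    (f f' g g' h h' : T -> R[i]) :
  {ae mu, forall x, f x = f' x} -> {ae mu, forall x, g x = g' x} ->
  {ae mu, forall x, h x = h' x} -> (forall x, f' x * g' x = h' x) ->
  {ae mu, forall x, f x * g x = h x}.
Proof. by move=> ff' gg' hh' e; apply: filterS3 ff' gg' hh' => x -> -> ->. Qed.

Section sigma_simple.
Context dY (Y : measurableType dY) dO (Omega : measurableType dO) (R : realType).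
Context (Pr : probability Omega R) (eta : R.-ker Omega ~> Y).
Context (lam : {sigma_finite_measure set Y -> \bar R}) (X : set Y) (ell : R[i] -> R[i]).
Hypotheses (cPr : measure_is_complete Pr) (poi : poisson_process Pr eta lam).
Hypotheses (mX : measurable X) (log : log_branch ell).
Local Open Scope complex_scope.
Local Notation npoints := (npoints eta).
Local Notation rate := (rate lam).
Local Notation exp_eta := (exp_eta X eta ell).
Local Notation Sigma_simple := (Sigma_simple X Pr eta ell).
Local Notation simpleS := (simpleS lam X).

Lemma ell1 : ell 1 = 0.
Proof.
have [_ _ _ h] := log; have := h 1 ltr01.
by rewrite rmorph1 ln1 rmorph0.
Qed.

Lemma ae_forall_ord d (T : measurableType d) (mu : {measure set T -> \bar R}) m
    (Q : 'I_m -> T -> Prop) :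
  (forall i, {ae mu, forall x, Q i x}) -> {ae mu, forall x, forall i, Q i x}.
Proof. exact: filter_forall. Qed.

Lemma counts_ae m (B : 'I_m -> set Y) : (forall i, measurable (B i)) ->
  (forall i, (lam (B i) < +oo)%E) ->
  {ae Pr, forall w, forall i, eta w (B i) = (npoints (B i) w)%:R%:E}.
Proof. by move=> mB fB; apply: ae_forall_ord => i; exact: (eta_count_ae poi (mB i) (fB i)). Qed.

Lemma exp_eta_ae m (B : 'I_m -> set Y) l f : (forall i, measurable (B i)) ->
  (forall i, (lam (B i) < +oo)%E) -> (forall i, B i `<=` X) ->
  (forall y, X y -> ell (1 + f y) = step B l y) ->
  {ae Pr, forall w, exp_eta f w = \prod_(i < m) Cexp (l i) ^+ npoints (B i) w}.
Proof.
move=> mB fB BX fE; apply: filterS (counts_ae mB fB) => w cw.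
rewrite /Defs.exp_eta (@Cintegral_step _ _ _ (eta w) m B mB _ l X)//; last first.
  by move=> i; rewrite cw ltry.
rewrite Cexp_sum; apply: eq_bigr => i _.
rewrite -Cexp_natmul cw; congr (Cexp (_ * _)); exact/esym/natrC.
Qed.

Lemma exp_eta_step m (B : 'I_m -> set Y) c f : (forall i, measurable (B i)) ->
  (forall i, (lam (B i) < +oo)%E) -> (forall i, B i `<=` X) -> trivIset setT B ->
  (forall i, c i <> -1) -> (forall y, X y -> f y = step B c y) ->
  {ae Pr, forall w, exp_eta f w = \prod_(i < m) (1 + c i) ^+ npoints (B i) w}.
Proof.
move=> mB fB BX tB c1 fE; have [_ _ Cl _] := log.
have : forall y, X y -> ell (1 + f y) = step B (fun i => ell (1 + c i)) y.
  move=> y Xy; rewrite fE//; have [[i Bi]|nB] := pselect (exists i, B i y).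
    by rewrite !(step_in _ tB Bi).
  have {}nB i : ~ B i y by move=> Bi; apply: nB; exists i.
  by rewrite !step_out// addr0 ell1.
move/(exp_eta_ae mB fB BX); apply: filterS => w ->; apply: eq_bigr => i _.
rewrite Cl// => /eqP; rewrite addrC addr_eq0 => /eqP; exact: c1.
Qed.

Definition exp_count m (B : 'I_m -> set Y) (c : 'I_m -> R[i]) (w : Omega) : R[i] :=
  \prod_(i < m) (1 + c i) ^+ npoints (B i) w.

(** An explicit form of the vector Sigma of [step B c]: the first factor is the reciprocal of the
    expectation of [exp_count]. *)
Definition exp_step m (B : 'I_m -> set Y) (c : 'I_m -> R[i]) (w : Omega) : R[i] :=
  cexps (- \sum_(i < m) (rate (B i))%:C * c i) * exp_count B c w.

Section step_family.
Variables (m : nat) (B : 'I_m -> set Y).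
Hypotheses (mB : forall i, measurable (B i)) (fB : forall i, (lam (B i) < +oo)%E).
Hypothesis tB : trivIset setT B.

Let mN i (U : set nat) : measurable [set w | U (npoints (B i) w)].
Proof. exact: measurable_count_eta. Qed.

Let indN (U : 'I_m -> set nat) :
  Pr (\bigcap_(i in setT) [set w | U i (npoints (B i) w)]) =
  (\prod_(i < m) Pr [set w | U i (npoints (B i) w)])%E.
Proof. exact: (count_indep poi U mB tB). Qed.

Let r0 i : 0 <= rate (B i). Proof. exact: rate_ge0. Qed.

Let lawN i k : Pr [set w | npoints (B i) w = k] =
  (expR (- rate (B i)) * rate (B i) ^+ k / k`!%:R)%:E.
Proof. exact: (count_law poi k (mB i) (fB i)). Qed.

Lemma sqint_exp_count c : sqintegrable Pr (exp_count B c).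
Proof.
exact: (@sqint_gf_prod _ _ R Pr m (fun i => npoints (B i)) mN indN _ r0 lawN (fun i => 1 + c i)).
Qed.

Lemma Cintegral_exp_count c : Cintegral Pr setT (exp_count B c) =
  cexps (\sum_(i < m) (rate (B i))%:C * c i).
Proof.
apply: (etrans (@Cintegral_gf_prod _ _ R Pr m (fun i => npoints (B i)) mN indN _ r0 lawN (fun i => 1 + c i))).
congr cexps; apply: eq_bigr => i _; by rewrite addrC addKr.
Qed.

Lemma sqint_exp_step c : sqintegrable Pr (exp_step B c).
Proof. by apply: sqintegrableZ; exact: sqint_exp_count. Qed.

Lemma dot_exp_step c e : dot (toL2 Pr (exp_step B c)) (toL2 Pr (exp_step B e)) =
  cexps (\sum_(i < m) (rate (B i))%:C * (c i * (e i)^*)).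
Proof.
rewrite (dotE (sqint_exp_step c) (sqint_exp_step e)).
pose k : R[i] := cexps (- \sum_(i < m) (rate (B i))%:C * c i) *
  conjc (cexps (- \sum_(i < m) (rate (B i))%:C * e i)).
(* From [(1 + c) (1 + conj e) = 1 + x]; the linear terms of [x] cancel against the two normalising
   factors. *)
pose x i := c i + (e i)^* + c i * (e i)^*.
transitivity (Cintegral Pr setT (fun w => k * exp_count B x w)).
  congr (Cintegral _ _ _); apply/funext => w; rewrite /exp_step /k rmorphM mulrACA; congr (_ * _).
  rewrite /exp_count rmorph_prod -big_split/=; apply: eq_bigr => i _.
  rewrite rmorphXn -exprMn rmorphD rmorph1; congr (_ ^+ _); rewrite /x.
  by move: (c i) ((e i)^*) => a b; ring.
rewrite CintegralZ; last by apply: sqint_Cintegrable; exact: sqint_exp_count.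
rewrite Cintegral_exp_count /k -cexpsJ -!cexpsD; congr cexps.
have -> : conjc (- \sum_(i < m) (rate (B i))%:C * e i) =
    - \sum_(i < m) (rate (B i))%:C * conjc (e i).
  rewrite rmorphN rmorph_sum; congr (- _); apply: eq_bigr => i _; rewrite rmorphM.
  by congr (_ * _); apply: complex_ext => //=; rewrite oppr0.
rewrite -!sumrN -!big_split/=; apply: eq_bigr => i _; rewrite /x.
have e0 (r a b : R[i]) : - (r * a) - r * b + r * (a + b + a * b) = r * (a * b) by ring.
exact: e0.
Qed.

Lemma dot_step c e : dot (toL2 lam (step B c)) (toL2 lam (step B e)) =
  \sum_(i < m) (rate (B i))%:C * (c i * (e i)^*).
Proof.
rewrite dotE; [|exact: sqint_step|exact: sqint_step].
rewrite (@Cintegral_step _ _ _ lam m B mB fB (fun i => c i * (e i)^*) setT)//.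
  by apply: eq_bigr => i _; rewrite mulrC.
move=> y _; have [[i Bi]|nB] := pselect (exists i, B i y).
  by rewrite !(step_in _ tB Bi).
have {}nB i : ~ B i y by move=> Bi; apply: nB; exists i.
by rewrite !step_out// mul0r.
Qed.

Lemma exp_stepM c e w : (forall i, c i = 0 \/ e i = 0) ->
  exp_step B c w * exp_step B e w = exp_step B (fun i => c i + e i) w.
Proof.
move=> ce.
have h (a b x y s p : R[i]) : a + b = s -> x * y = p ->
    cexps a * x * (cexps b * y) = cexps s * p.
  by move=> <- <-; rewrite cexpsD mulrACA.
rewrite /exp_step; apply: h.
  by rewrite -!sumrN -[LHS]big_split/=; apply: eq_bigr => i _; rewrite mulrDr opprD.
rewrite /exp_count -big_split/=; apply: eq_bigr => i _; rewrite -exprMn; apply: f_equal2 => //.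
by case: (ce i) => ->; rewrite ?addr0 ?add0r ?mulr1 ?mul1r.
Qed.

Hypothesis BX : forall i, B i `<=` X.

Lemma Sigma_simple_step c f : (forall i, c i <> -1) ->
  (forall y, X y -> f y = step B c y) ->
  Sigma_simple f = toL2 Pr (exp_step B c).
Proof.
move=> c1 fE; have fae := exp_eta_step mB fB BX tB c1 fE.
have mf : Cmeas (exp_eta f).
  by apply: (Cmeas_ae cPr fae); exact: sqint_meas (sqint_exp_count c).
have sf : sqintegrable Pr (exp_eta f).
  by apply: (sqint_ae mf fae); exact: sqint_exp_count.
have Ef : Cintegral Pr setT (exp_eta f) = cexps (\sum_(i < m) (rate (B i))%:C * c i).
  by rewrite -Cintegral_exp_count; apply: Cintegral_ae => //; exact: sqint_meas (sqint_exp_count c).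
apply: toL2_ae; last 2 first.
- exact: sqint_exp_step.
- apply: filterS fae => w ->; rewrite Ef /exp_step mulrC; congr (_ * _).
  apply: (mulfI (cexps_neq0 (\sum_(i < m) (rate (B i))%:C * c i))).
  by rewrite -cexpsD subrr cexps0 divff// cexps_neq0.
rewrite (_ : (fun w => _) = fun w => (Cintegral Pr setT (exp_eta f))^-1 * exp_eta f w).
  exact: sqintegrableZ.
by apply/funext => w; rewrite mulrC.
Qed.

End step_family.

(** Each [B i] contains a point, so pointwise properties of [f] and [g], such as avoiding [-1] or
    never being both nonzero, carry over to the coefficients. *)
Lemma simpleS_pair f g : simpleS f -> simpleS g ->
  exists m (B : 'I_m -> set Y) c e, [/\ [/\ forall i, measurable (B i),
    forall i, (lam (B i) < +oo)%E, trivIset setT B & forall i, B i `<=` X],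
    f = step B c /\ g = step B e,
    forall i, c i <> -1, forall i, e i <> -1
    & forall i, exists2 y, B i y &
      forall y, B i y -> [/\ f y = c i, g y = e i & f y != 0 \/ g y != 0]].
Proof.
move=> [sf ff f0 f1] [sg fg g0 g1].
have [m [B [c [e [mB fB tB fE key]]]]] := step_pair sf sg ff fg.
have BX i : B i `<=` X.
  move=> y Biy; have [_ _ h] := key i; have [_ _ {}h] := h y Biy.
  by apply: contrapT => Xy; move: h; rewrite f0// g0// eqxx; case.
exists m, B, c, e; split => // i; have [y Biy h] := key i; have [fy gy _] := h y Biy.
  by rewrite -fy; apply: f1; exact: BX Biy.
by rewrite -gy; apply: g1; exact: BX Biy.
Qed.

Lemma dot_Sigma_simple f g : simpleS f -> simpleS g ->
  dot (Sigma_simple f) (Sigma_simple g) = cexps (dot (toL2 lam f) (toL2 lam g)).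
Proof.
move=> Sf Sg; have [m [B [c [e [[mB fB tB BX] [fE gE] c1 e1 _]]]]] := simpleS_pair Sf Sg.
rewrite (Sigma_simple_step mB fB tB BX c1 (f := f)); last by rewrite fE.
rewrite (Sigma_simple_step mB fB tB BX e1 (f := g)); last by rewrite gE.
apply: (etrans (dot_exp_step mB fB tB c e)); rewrite fE gE.
exact: congr1 _ (esym (dot_step mB fB tB c e)).
Qed.

Lemma Sigma_simpleM f g : simpleS f -> simpleS g -> (forall y, f y = 0 \/ g y = 0) ->
  {ae Pr, forall w, fun_of_L2 (Sigma_simple f) w * fun_of_L2 (Sigma_simple g) w =
    fun_of_L2 (Sigma_simple (fun y => f y + g y)) w}.
Proof.
move=> Sf Sg fg; have [m [B [c [e [[mB fB tB BX] [fE gE] c1 e1 key]]]]] := simpleS_pair Sf Sg.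
have ce i : c i = 0 \/ e i = 0.
  by have [y Biy h] := key i; have [<- <- _] := h y Biy; exact: fg.
rewrite (Sigma_simple_step mB fB tB BX c1 (f := f)); last by rewrite fE.
rewrite (Sigma_simple_step mB fB tB BX e1 (f := g)); last by rewrite gE.
rewrite (Sigma_simple_step mB fB tB BX (c := fun i => c i + e i)); last 2 first.
- by move=> i; case: (ce i) => ->; rewrite ?addr0 ?add0r.
- move=> y _; rewrite fE gE /step -big_split/=; apply: eq_bigr => i _.
  by rewrite mulrDl.
have h x := fun_toL2 (sqint_exp_step mB fB tB x).
apply: (ae_mul_eq (h c) (h e) (h (fun i => c i + e i))) => w.
exact: (exp_stepM B w ce).
Qed.

End sigma_simple.

(** * The sigma-algebras generated by the process *)

Lemma Cmeas_cvg d (T : measurableType d) (R : realType) (h : nat -> T -> R[i]) f :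
  (forall n, Cmeas (h n)) -> (forall x, Ccvg (h ^~ x) (f x)) -> Cmeas f.
Proof.
move=> mh hf; split.
- apply: (@measurable_fun_cvg _ _ _ setT (fun n x => complex.Re (h n x))) => [n|x _].
    exact: (mh n).1.
  by have /CcvgP[] := hf x.
- apply: (@measurable_fun_cvg _ _ _ setT (fun n x => complex.Im (h n x))) => [n|x _].
    exact: (mh n).2.
  by have /CcvgP[] := hf x.
Qed.

Lemma Cmeas_eq d (T : measurableType d) (R : realType) (h : T -> R[i]) v :
  Cmeas h -> measurable [set x | h x = v].
Proof.
move=> [m1 m2]; have -> : [set x | h x = v] =
    (setT `&` (fun x => complex.Re (h x)) @^-1` [set complex.Re v]) `&`
    (setT `&` (fun x => complex.Im (h x)) @^-1` [set complex.Im v]).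
  rewrite !setTI; apply/seteqP; split => x /=; first by move=> ->.
  by move=> [e1 e2]; exact: complex_ext.
by apply: measurableI; [apply: m1|apply: m2].
Qed.

Section sub_sigma_algebra_L2.
Context d (Omega : measurableType d) (R : realType) (Pr : probability Omega R).
Context (G : set (set Omega)).
Hypothesis Gmeas : <<s G >> `<=` measurable.
Hypothesis Gnegl : Pr.-negligible `<=` <<s G >>.
Local Open Scope complex_scope.
Local Notation OG := (g_sigma_algebraType G).

(** With the generated sigma-algebra as measurable structure, the general closure properties of
    [Cmeas] become available for [L2sub]. *)
Lemma L2subP f : L2sub <<s G >> f <->
  exists h, [/\ sqintegrable Pr h, @Cmeas _ OG R h & f = toL2 Pr h].
Proof.
split=> [[h [sh h1 h2 ->]]|[h [sh [h1 h2] ->]]]; exists h; split => //.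
- by split => _ U mU; rewrite setTI; [exact: h1|exact: h2].
- by move=> U mU; have := h1 measurableT U mU; rewrite setTI.
- by move=> U mU; have := h2 measurableT U mU; rewrite setTI.
Qed.

Lemma Cmeas_sub (h : Omega -> R[i]) : @Cmeas _ OG R h -> @Cmeas _ Omega R h.
Proof.
move=> [h1 h2]; split => _ U mU; apply: Gmeas.
  exact: (h1 measurableT U mU).
exact: (h2 measurableT U mU).
Qed.

Lemma L2sub_sub : @ipsub _ (L2ip Pr) (L2sub <<s G >>).
Proof.
split.
  apply/L2subP; exists (fun=> 0); split; [exact: sqintegrable0|exact: Cmeas_cst|].
  by apply/esym; exact: toL20.
move=> c f g /L2subP[hf [sf mf ->]] /L2subP[hg [sg mg ->]]; apply/L2subP.
exists (fun w => c * hf w + hg w); split.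
- by apply: sqintegrableD => //; exact: sqintegrableZ.
- by apply: CmeasD => //; apply: CmeasM => //; exact: Cmeas_cst.
- by apply/esym/(etrans (toL2D (sqintegrableZ c sf) sg)); exact: (congr1 (fun x => x + toL2 Pr hg) (toL2Z c sf)).
Qed.

(** A norm limit is an almost everywhere limit along a subsequence. The set of convergence has
    negligible complement, hence belongs to the sigma-algebra, and multiplying the limit by its
    indicator gives a measurable representative. *)
Lemma L2sub_closed : @ipclosed _ (L2ip Pr) (L2sub <<s G >>).
Proof.
move=> f hf; have [fs [Kfs cfs]] := @ipclosed_seq _ (L2ip Pr) _ f hf.
have /choice[h hh] : forall n, exists h, [/\ sqintegrable Pr h, @Cmeas _ OG R h & fs n = toL2 Pr h].
  by move=> n; exact/L2subP.
have [s [_ sae]] := L2cvg_ae_subseq cfs.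
pose A := [set w | Ccvg (fun n => h (s n) w) (fun_of_L2 f w)].
have aeA : {ae Pr, forall w, A w}.
  have all_n : {ae Pr, forall w n, fun_of_L2 (fs n) w = h n w}.
    by apply: ae_foralln => n; have [sh _ ->] := hh n; exact: fun_toL2.
  apply: filterS2 all_n sae => w e; rewrite /A /=; congr Ccvg.
  by apply/funext => n; exact: e.
have GA : <<s G >> A.
  by rewrite -[A]setCK; apply: sigma_algebraC; exact: Gnegl.
pose ind w : R[i] := (\1_A w : R)%:C.
have mind : @Cmeas _ OG R ind by exact: (@Cmeas_indic _ OG R A GA).
have mg : @Cmeas _ OG R (fun w => ind w * fun_of_L2 f w).
  apply: (@Cmeas_cvg _ OG R (fun n w => ind w * h (s n) w)) => [n|w].
    by apply: CmeasM => //; have [] := hh (s n).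
  rewrite /ind indicE; have [wA|wA] := boolP (w \in A).
    by apply: CcvgM; [exact: Ccvg_cst|move: wA; rewrite inE].
  rewrite rmorph0 mul0r; under [X in Ccvg X]funext do rewrite mul0r.
  exact: Ccvg_cst.
have gf : {ae Pr, forall w, ind w * fun_of_L2 f w = fun_of_L2 f w}.
  by apply: filterS aeA => w Aw; rewrite /ind indicE mem_set// mul1r.
have sg : sqintegrable Pr (fun w => ind w * fun_of_L2 f w).
  by apply: (sqint_ae (Cmeas_sub mg) gf); exact: sqintegrable_L2.
apply/L2subP; exists (fun w => ind w * fun_of_L2 f w); split => //.
rewrite -[LHS]toL2K; apply: toL2_ae => //; first exact: sqintegrable_L2.
by apply: filterS gf => w ->.
Qed.

(** Functions with finite range are combinations of indicators of their level sets, and they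
    approximate in L^2. *)
Lemma L2sub_min (K : set (L2 Pr)) : @ipsub _ (L2ip Pr) K -> @ipclosed _ (L2ip Pr) K ->
  (forall A, <<s G >> A -> K (toL2 Pr (fun w => (\1_A w : R)%:C))) ->
  L2sub <<s G >> `<=` K.
Proof.
move=> sK cK KA f /L2subP[h [sh mh ->]].
have [s [ms fs les cvs]] := Cmeas_simple_approx mh.
have Ks n : K (toL2 Pr (s n)).
  have /finite_seqP[vs vsE] := fs n.
  pose a v w : R[i] := (\1_[set w | s n w = v] w : R)%:C.
  have Ga v : <<s G >> [set w | s n w = v] by exact: (@Cmeas_eq _ OG R _ v (ms n)).
  have sa v : sqintegrable Pr (a v).
    apply: (@sqint_bounded _ _ _ Pr _ 1).
      by apply: Cmeas_indic; exact: Gmeas.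
    by move=> w; rewrite /a modc_real indicE; case: (_ \in _); rewrite ?normr1 ?normr0.
  have sva v : sqintegrable Pr (fun w => v * a v w) by exact: sqintegrableZ.
  have -> : s n = fun w => \sum_(v <- undup vs) v * a v w.
    apply/funext => w; rewrite (bigD1_seq (s n w)) ?undup_uniq//=; last first.
      by rewrite mem_undup; have : range (s n) (s n w) by []; rewrite vsE.
    rewrite {1}/a indicE mem_set// mulr1 big1 ?addr0// => v vs'.
    by rewrite /a indicE memNset ?mulr0// => /= e; move/eqP: vs'; apply.
  have -> := toL2_sum (undup vs) sva.
  apply: (@ipsub_sum _ (L2ip Pr) K _ _ _ sK) => v.
  rewrite (toL2Z v (sa v)); apply: (@ipsubZ _ (L2ip Pr) K _ _ sK); exact: KA.
apply: (@ipclosedP _ (L2ip Pr) K _ _ cK Ks).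
apply: (sqint_Ccvg_dominated (g := h)) => //.
- by move=> n; exact: Cmeas_sub.
- exact: Cmeas_sub.
- exact: aeW.
Qed.

End sub_sigma_algebra_L2.

Section action.
Context (R : realType) (n : nat).
Context dY (Y : measurableType dY) (act : 'rV[R]_n -> Y -> Y).
Hypothesis mact : measurable_action act.
Implicit Types (a b : 'rV[R]_n) (B : set Y).

Lemma act0 y : act 0 y = y. Proof. by have [h _ _] := mact. Qed.

Lemma actD a b y : act (a + b) y = act a (act b y).
Proof. by have [_ h _] := mact. Qed.

Lemma actK a : cancel (act a) (act (- a)).
Proof. by move=> y; rewrite -actD addNr act0. Qed.

Lemma actNK a : cancel (act (- a)) (act a).
Proof. by move=> y; rewrite -actD subrr act0. Qed.

Lemma measurable_act a : measurable_fun setT (act a).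
Proof.
have [_ _ h] := mact.
pose a' : g_sigma_algebraType (@open 'rV[R]_n) := a.
have h' : measurable_fun setT (fun y : Y => (a', y)).
  by apply: measurable_fun_pair; [exact: measurable_cst|exact: measurable_id].
exact: (measurableT_comp h h').
Qed.

Lemma translateE a B : translate act a B = act (- a) @^-1` B.
Proof.
apply/seteqP; split => [_ [y By <-]|y By] /=; first by rewrite actK.
by exists (act (- a) y) => //; rewrite actNK.
Qed.

Lemma mem_translate a B y : (y \in translate act a B) = (act (- a) y \in B).
Proof. by rewrite translateE; apply/idP/idP; rewrite !inE. Qed.

Lemma measurable_translate a B : measurable B -> measurable (translate act a B).
Proof. by move=> mB; rewrite translateE -[X in measurable X]setTI; exact: measurable_act. Qed.

Lemma translate0 B : translate act 0 B = B.
Proof.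
rewrite translateE oppr0; apply/seteqP; split => y /=; by rewrite act0.
Qed.

Lemma translateD a b B : translate act (a + b) B = translate act a (translate act b B).
Proof.
rewrite !translateE; apply/seteqP; split => y /=; by rewrite opprD addrC actD.
Qed.

Lemma translateSS a B B' : B `<=` B' -> translate act a B `<=` translate act a B'.
Proof. by move=> BB'; exact: image_subset. Qed.

Lemma translate_setD a B B' :
  translate act a (B `\` B') = translate act a B `\` translate act a B'.
Proof. by rewrite !translateE. Qed.

Lemma trivIset_translate a m (B : 'I_m -> set Y) : trivIset setT B ->
  trivIset setT (fun i => translate act a (B i)).
Proof.
move=> tB i j _ _ [y]; rewrite !translateE => -[/= hi hj].
by apply: tB => //; exists (act (- a) y).
Qed.

End action.

Section sigma_eta_simple.
Context (R : realType) (n : nat).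
Context dY (Y : measurableType dY) (act : 'rV[R]_n -> Y -> Y).
Context dO (Omega : measurableType dO).
Context (Pr : probability Omega R) (eta : R.-ker Omega ~> Y).
Context (lam : {sigma_finite_measure set Y -> \bar R}) (X : set Y) (ell : R[i] -> R[i]).
Hypotheses (cPr : measure_is_complete Pr) (poi : poisson_process Pr eta lam).
Hypotheses (mX : measurable X) (log : log_branch ell).
Hypothesis mact : measurable_action act.
Hypothesis inv : forall a B, measurable B -> lam (translate act a B) = lam B.
Local Open Scope complex_scope.
Local Notation npoints := (npoints eta).
Local Notation rate := (rate lam).
Local Notation exp_eta := (exp_eta X eta ell).
Local Notation Sigma_simple := (Sigma_simple X Pr eta ell).
Local Notation simpleS := (simpleS lam X).
Local Notation sigma_eta := (sigma_eta Pr eta).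

Definition simple_on (D : set Y) : set (Y -> R[i]) :=
  [set f | simpleS f /\ forall y, ~ D y -> f y = 0].

(** For [D] inside [X] this is the whole of [L2sub (sigma_eta D)], by [L2sub_sigma_eta]. *)
Definition Sigma_span (D : set Y) : set (L2 Pr) :=
  @ipspan _ (L2ip Pr) [set Sigma_simple f | f in simple_on D].

Lemma sigma_eta_measurable D : sigma_eta D `<=` measurable.
Proof.
apply: smallest_sub; first exact: sigma_algebra_measurable.
move=> A [[B [mB _] [U mU <-]]|nA]; first exact: measurable_eta.
exact: cPr.
Qed.

Lemma sigma_eta_negligible D : Pr.-negligible `<=` sigma_eta D.
Proof. by move=> A nA; apply: sub_sigma_algebra; right. Qed.

Lemma sigma_eta_npoints D m (B : 'I_m -> set Y) (Q : set ('I_m -> nat)) :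
  (forall i, measurable (B i)) -> (forall i, B i `<=` D) ->
  sigma_eta D [set w | Q (fun i => npoints (B i) w)].
Proof.
move=> mB BD; rewrite /Defs.sigma_eta; set G := (X in <<s X >>).
apply: (@measurable_counts _ (g_sigma_algebraType G)) => i k.
apply: sub_sigma_algebra; left; exists (B i); first by split.
by exists [set x | cntE x = k] => //; exact: (measurable_cntE [set k]).
Qed.

Lemma Cintegral_exp_eta f : simpleS f ->
  Cintegral Pr setT (exp_eta f) = cexps (Cintegral lam setT f) /\ sqintegrable Pr (exp_eta f).
Proof.
move=> Sf; have [m [B [c [e [[mB fB tB BX] [fE _] c1 _ _]]]]] := simpleS_pair Sf Sf.
have fE' y : X y -> f y = step B c y by rewrite fE.
have fae := exp_eta_step poi mX log mB fB BX tB c1 fE'.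
have sc := sqint_exp_count poi mB fB tB c.
have mf : Cmeas (exp_eta f) by apply: (Cmeas_ae cPr fae); exact: sqint_meas sc.
split; last exact: (sqint_ae mf fae sc).
apply: (etrans (Cintegral_ae mf (sqint_meas sc) fae)).
apply: (etrans (Cintegral_exp_count poi mB fB tB c)).
congr cexps; apply/esym/(etrans (@Cintegral_step _ _ _ lam m B mB fB c setT f measurableT _ _)) => //.
  by move=> y _; rewrite fE.
by apply: eq_bigr => i _; rewrite mulrC.
Qed.

Lemma toL2_exp_eta f : simpleS f ->
  toL2 Pr (exp_eta f) = cexps (Cintegral lam setT f) *: Sigma_simple f.
Proof.
move=> Sf; have [E s] := Cintegral_exp_eta Sf.
rewrite /Defs.Sigma_simple E; set c := cexps _.
have c0 : c != 0 by exact: cexps_neq0.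
have -> : (fun w => exp_eta f w / c) = (fun w => c^-1 * exp_eta f w).
  by apply/funext => w; rewrite mulrC.
by rewrite (toL2Z _ s) scalerA divff// scale1r.
Qed.

Lemma L2sub_Sigma_simple D f : simple_on D f -> L2sub (sigma_eta D) (Sigma_simple f).
Proof.
move=> [Sf fD]; have [m [B [c [e [[mB fB tB BX] [fE _] c1 _ key]]]]] := simpleS_pair Sf Sf.
have BD i : B i `<=` D.
  move=> y By; have [_ _ h] := key i; have [_ _ {}h] := h y By.
  by apply: contrapT => Dy; move: h; rewrite fD// eqxx; case.
have fE' y : X y -> f y = step B c y by rewrite fE.
rewrite (Sigma_simple_step cPr poi mX log mB fB tB BX c1 fE').
apply/L2subP; exists (exp_step eta lam B c); split => //; first exact: sqint_exp_step.
pose psi (k : 'I_m -> nat) := cexps (- \sum_(i < m) (rate (B i))%:C * c i) *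
  \prod_(i < m) (1 + c i) ^+ k i.
split => _ U mU; rewrite setTI.
- exact: (sigma_eta_npoints (fun k => U (complex.Re (psi k))) mB BD).
- exact: (sigma_eta_npoints (fun k => U (complex.Im (psi k))) mB BD).
Qed.

End sigma_eta_simple.

Lemma iplinear_sum (R : realType) (E F : ipSpace R) (K : set E) (T : E -> F) I (r : seq I)
    (G : I -> E) : ipsub K -> iplinear K T -> (forall i, K (G i)) ->
  T (\sum_(i <- r) G i) = \sum_(i <- r) T (G i).
Proof.
move=> sK lT KG; elim: r => [|i r ih]; first by rewrite !big_nil (iplinear0 sK lT).
rewrite !big_cons -ih -[X in T (X + _)]scale1r lT ?scale1r//.
by apply: ipsub_sum.
Qed.

(** * Functions whose vectors Sigma are multiples of products of powers of counts *)

Section power_function.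
Context dY (Y : measurableType dY) (R : realType) (m : nat).
Variables (B : 'I_m -> set Y) (z : 'I_m -> R).
Hypothesis z01 : forall i, 0 < z i <= 1.
Local Open Scope complex_scope.

(** The product of the [z i] over the sets containing [y], which may be several. Its logarithm is
    the sum of [ln (z i)] over these sets, so integrating against [eta w] yields the counts of the
    individual [B i]. *)
Definition powr y : R := \prod_(i < m) (1 + (z i - 1) * \1_(B i) y).

Definition powf y : R[i] := (powr y)%:C - 1.

Let factorE i y : 1 + (z i - 1) * \1_(B i) y = if y \in B i then z i else 1.
Proof. by rewrite indicE; case: (y \in B i); rewrite ?mulr1 ?mulr0 ?addr0//; ring. Qed.

Lemma powr_gt0 y : 0 < powr y.
Proof.
apply: prodr_gt0 => i _; rewrite factorE; case: ifP => // _.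
by have /andP[] := z01 i.
Qed.

Lemma powr_le1 y : powr y <= 1.
Proof.
have h i : 0 <= 1 + (z i - 1) * \1_(B i) y <= 1.
  have /andP[z0 z1] := z01 i; rewrite factorE; case: ifP => _; last by rewrite ler01 lexx.
  by apply/andP; split => //; exact: ltW.
by apply: le_trans (_ : \prod_(i < m) 1 <= 1); [apply: ler_prod|rewrite big1].
Qed.

Lemma powf_out y : (forall i, ~ B i y) -> powf y = 0.
Proof.
move=> nB; rewrite /powf /powr big1 ?rmorph1 ?subrr// => i _.
by rewrite factorE memNset.
Qed.

Lemma powf_neqN1 y : powf y <> -1.
Proof.
move=> /eqP; rewrite /powf subr_eq addNr => /eqP/(congr1 (@complex.Re R))/= e.
by have := powr_gt0 y; rewrite e ltxx.
Qed.

Lemma finite_range_powf : finite_set (range powf).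
Proof.
pose F (v : {ffun 'I_m -> bool}) : R[i] := (\prod_(i < m) (if v i then z i else 1))%:C - 1.
apply: (@sub_finite_set _ _ (F @` setT)); last exact: finite_image.
move=> _ [y _ <-]; exists [ffun i => y \in B i] => //.
rewrite /F /powf /powr; congr (_%:C - _); apply: eq_bigr => i _.
by rewrite ffunE factorE.
Qed.

Lemma Cmeas_powf : (forall i, measurable (B i)) -> Cmeas powf.
Proof.
move=> mB; apply: CmeasB; last exact: Cmeas_cst.
apply: Cmeas_real; apply: measurable_prod => i _.
by apply: measurable_funD => //; apply: measurable_funM.
Qed.

(** Since [powr] lies between 0 and 1, [powf] has modulus at most 1, and it vanishes off the union
    of the [B i]. *)
Lemma sqint_powf (mu : {measure set Y -> \bar R}) : (forall i, measurable (B i)) ->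
  (forall i, (mu (B i) < +oo)%E) -> sqintegrable mu powf.
Proof.
move=> mB fB; apply: (@sqint_le _ _ _ mu powf (step B (fun=> 1))).
- exact: Cmeas_powf.
- move=> y; have [[i Bi]|nB] := pselect (exists i, B i y); last first.
    by rewrite powf_out ?modc0 ?modc_ge0// => i Bi; apply: nB; exists i.
  apply: (@le_trans _ _ 1).
    rewrite /powf (_ : _ - 1 = (powr y - 1)%:C); last by rewrite rmorphB rmorph1.
    rewrite modc_real ler_norml; apply/andP; split.
      by rewrite lerBrDr addNr ltW// powr_gt0.
    by rewrite lerBlDr (le_trans (powr_le1 y))// lerDl.
  rewrite /step (_ : \sum_(i < m) _ = (\sum_(i < m) \1_(B i) y)%:C); last first.
    by rewrite rmorph_sum; apply: eq_bigr => j _; rewrite mul1r.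
  rewrite modc_real ger0_norm ?sumr_ge0// (bigD1 i)//= indicE mem_set// lerDl.
  by apply: sumr_ge0.
- exact: sqint_step.
Qed.

Lemma ln_powr y : ln (powr y) = \sum_(i < m) ln (z i) * \1_(B i) y.
Proof.
have h i : 0 < 1 + (z i - 1) * \1_(B i) y.
  by rewrite factorE; case: ifP => // _; have /andP[] := z01 i.
rewrite /powr; suff [] : 0 < \prod_(i < m) (1 + (z i - 1) * \1_(B i) y) /\
  ln (\prod_(i < m) (1 + (z i - 1) * \1_(B i) y)) = \sum_(i < m) ln (z i) * \1_(B i) y by [].
elim/big_rec2: _ => [|i x p _ [p0 <-]]; first by rewrite ln1.
split; first by rewrite mulr_gt0.
rewrite lnM ?posrE//; congr (_ + _); rewrite factorE indicE.
by case: (y \in B i); rewrite ?mulr1 ?mulr0 ?ln1.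
Qed.

Lemma ell_powf ell y : log_branch ell -> ell (1 + powf y) = step B (fun i => (ln (z i))%:C) y.
Proof.
move=> [_ _ _ h]; rewrite /powf addrC subrK h ?powr_gt0// ln_powr rmorph_sum.
by apply: eq_bigr => i _; rewrite rmorphM.
Qed.

End power_function.

Lemma Cexp_real (R : realType) (x : R) : Cexp x%:C%C = (expR x)%:C%C.
Proof.
rewrite /Cexp -[complex.Im _]/(0 : R) -[complex.Re _]/x cos0 sin0.
by rewrite -[RHS]mulr1; congr (_ * _); apply: complex_ext.
Qed.

Section translated_simple.
Context (R : realType) (n : nat).
Context dY (Y : measurableType dY) (act : 'rV[R]_n -> Y -> Y).
Context (lam : {sigma_finite_measure set Y -> \bar R}).
Hypothesis mact : measurable_action act.
Hypothesis inv : forall a B, measurable B -> lam (translate act a B) = lam B.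
Local Open Scope complex_scope.

Definition translate_fun (a : 'rV[R]_n) (f : Y -> R[i]) : Y -> R[i] := fun y => f (act (- a) y).
Local Notation shf := translate_fun.

Lemma step_translate a m (B : 'I_m -> set Y) c :
  step (fun i => translate act a (B i)) c = shf a (step B c).
Proof.
apply/funext => y; apply: eq_bigr => i _.
by rewrite !indicE (mem_translate mact).
Qed.

Lemma powf_translate a m (B : 'I_m -> set Y) z :
  powf (fun i => translate act a (B i)) z = shf a (powf B z).
Proof.
apply/funext => y; congr (_%:C - _); apply: eq_bigr => i _.
by rewrite !indicE (mem_translate mact).
Qed.

Lemma shf_step a f : sqintegrable lam f -> finite_set (range f) ->
  sqintegrable lam (shf a f) /\ Cintegral lam setT (shf a f) = Cintegral lam setT f.
Proof.
move=> sf ff; have [m [B [c [e [mB fB tB [fE _] _]]]]] := step_pair sf sf ff ff.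
have mB' i : measurable (translate act a (B i)) by exact: measurable_translate.
have fB' i : (lam (translate act a (B i)) < +oo)%E by rewrite (inv a (mB i)); exact: fB.
rewrite fE -step_translate; split; first exact: sqint_step.
apply: (etrans (@Cintegral_step _ _ _ lam m _ mB' fB' c setT _ measurableT _ _)) => //.
apply/esym/(etrans (@Cintegral_step _ _ _ lam m B mB fB c setT _ measurableT _ _)) => //.
by apply: eq_bigr => i _; congr (_ * (fine _)%:C); exact/esym/(inv a (mB i)).
Qed.

Lemma simple_on_shf (X D : set Y) a f : simple_on lam X D f -> translate act a D `<=` X ->
  simple_on lam X (translate act a D) (shf a f).
Proof.
move=> [[sf ff f0 f1] fD] DX.
have fD' y : ~ translate act a D y -> shf a f y = 0.
  by move=> Dy; apply: fD => h; apply: Dy; rewrite (translateE mact).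
split => //; split.
- by have [] := shf_step a sf ff.
- by apply: sub_finite_set ff => _ [y _ <-]; exists (act (- a) y).
- by move=> y Xy; apply: fD' => h; apply: Xy; exact: DX.
- move=> y _; rewrite /translate_fun; have [h|h] := pselect (X (act (- a) y)); first exact: f1.
  by rewrite f0// => /esym/eqP; rewrite oppr_eq0 oner_eq0.
Qed.

End translated_simple.

Section sigma_span.
Context (R : realType) (n : nat).
Context dY (Y : measurableType dY) (act : 'rV[R]_n -> Y -> Y).
Context dO (Omega : measurableType dO).
Context (Pr : probability Omega R) (eta : R.-ker Omega ~> Y).
Context (lam : {sigma_finite_measure set Y -> \bar R}) (X : set Y) (ell : R[i] -> R[i]).
Hypotheses (cPr : measure_is_complete Pr) (poi : poisson_process Pr eta lam).
Hypotheses (mX : measurable X) (log : log_branch ell).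
Hypothesis mact : measurable_action act.
Hypothesis inv : forall a B, measurable B -> lam (translate act a B) = lam B.
Local Open Scope complex_scope.
Local Notation npoints := (npoints eta).
Local Notation exp_eta := (exp_eta X eta ell).
Local Notation Sigma_simple := (Sigma_simple X Pr eta ell).
Local Notation sigma_eta := (sigma_eta Pr eta).
Local Notation Sigma_span := (@Sigma_span R dY Y dO Omega Pr eta lam X ell).
Local Notation simple_on := (simple_on lam X).

Lemma simple_on_powf (D : set Y) m (B : 'I_m -> set Y) z : D `<=` X ->
  (forall i, measurable (B i)) -> (forall i, (lam (B i) < +oo)%E) ->
  (forall i, B i `<=` D) -> (forall i, 0 < z i <= 1) -> simple_on D (powf B z).
Proof.
move=> DX mB fB BD z01.
have f0 y : ~ D y -> powf B z y = 0 by move=> Dy; apply: powf_out => i /(BD i).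
split => //; split.
- exact: sqint_powf.
- exact: finite_range_powf.
- by move=> y Xy; apply: f0 => /DX.
- by move=> y _; exact: powf_neqN1.
Qed.

Lemma toL2_prodc_powc m (B : 'I_m -> set Y) z :
  (forall i, measurable (B i)) -> (forall i, (lam (B i) < +oo)%E) ->
  (forall i, B i `<=` X) -> (forall i, 0 < z i <= 1) ->
  toL2 Pr (prodc (fun i => npoints (B i)) (@powc R \o z)) =
  cexps (Cintegral lam setT (powf B z)) *: Sigma_simple (powf B z).
Proof.
move=> mB fB BX z01; have [Sf _] := simple_on_powf (@subset_refl _ X) mB fB BX z01.
rewrite -(toL2_exp_eta cPr poi mX log Sf); apply: toL2_ae.
- apply: sqint_prodc => [i U|i k]; first exact: measurable_count_eta.
  exact: modc_powc.
- exact: (Cintegral_exp_eta cPr poi mX log Sf).2.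
have ellf y : X y -> ell (1 + powf B z y) = step B (fun i => (ln (z i))%:C) y.
  by move=> _; exact: ell_powf.
apply: filterS (exp_eta_ae poi mX mB fB BX ellf) => w ->.
apply: eq_bigr => i _; rewrite Cexp_real lnK// posrE.
by have /andP[] := z01 i.
Qed.

Lemma Sigma_span_sub D : @ipsub _ (L2ip Pr) (Sigma_span D).
Proof. exact: ipspan_sub. Qed.

Lemma Sigma_span_closed D : @ipclosed _ (L2ip Pr) (Sigma_span D).
Proof. exact: ipspan_closed. Qed.

Section shift.
Variables (D : set Y) (a : 'rV[R]_n) (T : L2 Pr -> L2 Pr).
Hypotheses (DX : D `<=` X) (DaX : translate act a D `<=` X).
Hypothesis lT : @iplinear _ (L2ip Pr) (L2ip Pr) (Sigma_span D) T.
Hypothesis bT : @ipbounded _ (L2ip Pr) (L2ip Pr) (Sigma_span D) T.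
Hypothesis TS : forall f, simple_on D f -> T (Sigma_simple f) = Sigma_simple (translate_fun act a f).

Section family.
Variables (m : nat) (B : 'I_m -> set Y).
Hypotheses (mB : forall i, measurable (B i)) (fB : forall i, (lam (B i) < +oo)%E).
Hypothesis BD : forall i, B i `<=` D.

Let B' i := translate act a (B i).
Let N i := npoints (B i).
Let N' i := npoints (B' i).

Let mB' i : measurable (B' i). Proof. exact: measurable_translate. Qed.

Let fB' i : (lam (B' i) < +oo)%E.
Proof. by rewrite /B' (inv a (mB i)); exact: fB. Qed.

Let mN i (U : set nat) : measurable [set w | U (N i w)].
Proof. exact: measurable_count_eta. Qed.

Let mN' i (U : set nat) : measurable [set w | U (N' i w)].
Proof. exact: measurable_count_eta. Qed.

(** With [a = 0] and [T] the identity, the first half puts indicators into the span; with the shift,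
    the second half computes it on them. *)
Lemma extraction_shift (k : 'I_m -> nat) :
  Sigma_span D (toL2 Pr (prodc N (@indc R \o k))) /\
  T (toL2 Pr (prodc N (@indc R \o k))) = toL2 Pr (prodc N' (@indc R \o k)).
Proof.
apply: (count_extraction mN mN' (@Sigma_span_sub D) (@Sigma_span_closed D) lT bT) => z z01.
have Sf := simple_on_powf DX mB fB BD z01.
have BX i : B i `<=` X by move=> y /BD/DX.
have BX' i : B' i `<=` X.
  by apply: subset_trans DaX; exact: translateSS.
have Ks : Sigma_span D (Sigma_simple (powf B z)).
  by apply: (@ipspan_incl _ (L2ip Pr)); exists (powf B z).
rewrite (toL2_prodc_powc mB' fB' BX' z01) (toL2_prodc_powc mB fB BX z01); split.
  exact: (@ipsubZ _ (L2ip Pr) _ _ _ (@Sigma_span_sub D)).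
apply: (etrans (@iplinearZ _ (L2ip Pr) (L2ip Pr) _ T _ _ (@Sigma_span_sub D) lT Ks)).
have sE := @powf_translate R n dY Y act mact a m B z.
have [[sf ff _ _] _] := Sf.
have cE := (shf_step mact inv a sf ff).2.
have e : Cintegral lam setT (powf B' z) = Cintegral lam setT (powf B z) by rewrite sE.
have v : T (Sigma_simple (powf B z)) = Sigma_simple (powf B' z).
  exact: (etrans (TS Sf) (congr1 Sigma_simple (esym sE))).
by rewrite e; exact: congr1 v.
Qed.

(* The value of [psi] at the counts, cut off to counts less than [j]. *)
Let trunc (psi : ('I_m -> nat) -> R[i]) (M : 'I_m -> Omega -> nat) j w : R[i] :=
  \sum_(k : {ffun 'I_m -> 'I_j}) psi (fun i => k i) * prodc M (@indc R \o (fun i => k i : nat)) w.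

Let truncE psi M j w :
  trunc psi M j w = if [forall i, (M i w < j)%N] then psi (fun i => M i w) else 0.
Proof.
case: ifPn => [/forallP Mj|nM].
  pose k0 : {ffun 'I_m -> 'I_j} := [ffun i => Ordinal (Mj i)].
  have k0E : (fun i => k0 i : nat) = fun i => M i w.
    by apply/funext => i; rewrite ffunE.
  rewrite /trunc (bigD1 k0)//= k0E /prodc big1 => [|i _]; last first.
    by rewrite /= /indc eqxx.
  rewrite mulr1 big1 ?addr0// => k kk0.
  have [i hi] : exists i, k i != k0 i.
    apply/existsP; rewrite -negb_forall; apply: contra kk0 => /forallP h.
    by apply/eqP/ffunP => i; exact/eqP.
  rewrite (bigD1 i)//= /indc; have -> : (M i w == k i) = false.
    by apply: negbTE; move: hi; rewrite ffunE -val_eqE/= eq_sym.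
  by rewrite mul0r mulr0.
rewrite /trunc big1// => k _.
have [i hi] : exists i, (j <= M i w)%N.
  apply/existsP; rewrite -[X in is_true X]negbK negb_exists.
  by apply: contra nM => /forallP h; apply/forallP => i; rewrite ltnNge; exact: h.
rewrite /prodc (bigD1 i)//= /indc; have -> : (M i w == k i) = false.
  by apply/eqP => e; move: hi; rewrite e leqNgt ltn_ord.
by rewrite mul0r mulr0.
Qed.

(** Truncations of [psi] are finite combinations of the indicators treated by [extraction_shift],
    and they converge in norm, so their images converge to [T] of the limit. Along a subsequence the
    images also converge pointwise to [psi] of the translated counts; this gives both its square
    integrability and the value. *)
Lemma shift_counts (psi : ('I_m -> nat) -> R[i]) :
  sqintegrable Pr (fun w => psi (fun i => N i w)) ->
  sqintegrable Pr (fun w => psi (fun i => N' i w)) /\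
  T (toL2 Pr (fun w => psi (fun i => N i w))) = toL2 Pr (fun w => psi (fun i => N' i w)).
Proof.
move=> sp; set f := fun w => psi (fun i => N i w); set f' := fun w => psi (fun i => N' i w).
have Cpsi (M : 'I_m -> Omega -> nat) : (forall i (U : set nat), measurable [set w | U (M i w)]) ->
    Cmeas (fun w => psi (fun i => M i w)).
  move=> mM; split => _ U mU; rewrite setTI.
    by apply: (@measurable_counts _ Omega m M (fun k => U (complex.Re (psi k)))) => i k;
      exact: (mM i [set k]).
  by apply: (@measurable_counts _ Omega m M (fun k => U (complex.Im (psi k)))) => i k;
    exact: (mM i [set k]).
have sind M (mM : forall i (U : set nat), measurable [set w | U (M i w)]) (k : 'I_m -> nat) :
    sqintegrable Pr (prodc M (@indc R \o k)).
  by apply: sqint_prodc => // i j; exact: modc_indc.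
have sindZ M (mM : forall i (U : set nat), measurable [set w | U (M i w)]) j
    (k : {ffun 'I_m -> 'I_j}) : sqintegrable Pr (fun w => psi (fun i => k i) *
      prodc M (@indc R \o (fun i => k i : nat)) w).
  by apply: sqintegrableZ; exact: sind.
have tE M (mM : forall i (U : set nat), measurable [set w | U (M i w)]) j :
    toL2 Pr (trunc psi M j) = \sum_(k : {ffun 'I_m -> 'I_j}) psi (fun i => k i) *:
      toL2 Pr (prodc M (@indc R \o (fun i => k i : nat))).
  apply: (etrans (toL2_sum _ (sindZ M mM j))); apply: eq_bigr => k _.
  exact: (toL2Z _ (sind M mM _)).
have Kterm j (k : {ffun 'I_m -> 'I_j}) : Sigma_span D (psi (fun i => k i) *:
    toL2 Pr (prodc N (@indc R \o (fun i => k i : nat)))).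
  apply: (@ipsubZ _ (L2ip Pr) _ _ _ (@Sigma_span_sub D)).
  exact: (extraction_shift (fun i => k i)).1.
have Kt j : Sigma_span D (toL2 Pr (trunc psi N j)).
  rewrite tE//; exact: (@ipsub_sum _ (L2ip Pr) _ _ _ _ (@Sigma_span_sub D)).
have Tt j : T (toL2 Pr (trunc psi N j)) = toL2 Pr (trunc psi N' j).
  rewrite (tE N mN) (tE N' mN').
  apply: (etrans (@iplinear_sum _ (L2ip Pr) (L2ip Pr) _ T _ _ _ (@Sigma_span_sub D) lT (Kterm j))).
  apply: eq_bigr => k _.
  have [Kk Tk] := extraction_shift (fun i => k i).
  apply: (etrans (@iplinearZ _ (L2ip Pr) (L2ip Pr) _ T _ _ (@Sigma_span_sub D) lT Kk)).
  exact: congr1.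
have lim M w : Ccvg (fun j => trunc psi M j w) (psi (fun i => M i w)).
  have [j0 hj0] : exists j0, forall i, (M i w < j0)%N.
    exists (\max_(i < m) M i w).+1 => i; rewrite ltnS.
    exact: (leq_bigmax (F := fun i => M i w)).
  apply: cvg_near_cst; exists j0 => // j /= jj0; rewrite truncE.
  have -> : [forall i, (M i w < j)%N] by apply/forallP => i; exact: leq_trans (hj0 i) jj0.
  by rewrite subrr modc0.
have ct : L2cvg (fun j => toL2 Pr (trunc psi N j)) (toL2 Pr f).
  apply: (sqint_Ccvg_dominated (g := f)) => //.
  - by move=> j; apply: Cmeas_sum => k _; exact: sqint_meas (sindZ N mN j k).
  - exact: Cpsi.
  - by move=> j w; rewrite truncE; case: ifP => // _; rewrite modc0 modc_ge0.
  - by apply: aeW => w; exact: lim.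
have Kf : Sigma_span D (toL2 Pr f).
  exact: (@ipclosedP _ (L2ip Pr) _ _ _ (@Sigma_span_closed D) Kt ct).
have cT : L2cvg (fun j => toL2 Pr (trunc psi N' j)) (T (toL2 Pr f)).
  have := @ipbounded_cvg _ (L2ip Pr) (L2ip Pr) _ T _ _ (@Sigma_span_sub D) lT bT Kt Kf ct.
  by rewrite (_ : T \o _ = fun j => toL2 Pr (trunc psi N' j))//; apply/funext => j; exact: Tt.
have [s [hs sae]] := L2cvg_ae_subseq cT.
have aeE : {ae Pr, forall w, fun_of_L2 (T (toL2 Pr f)) w = f' w}.
  have all_n : {ae Pr, forall w j, fun_of_L2 (toL2 Pr (trunc psi N' j)) w = trunc psi N' j w}.
    apply: ae_foralln => j; apply: fun_toL2.
    by apply: sqint_sum => k; exact: sindZ.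
  apply: filterS2 all_n sae => w e c; apply: (Ccvg_unique c).
  have -> : (fun j => fun_of_L2 (toL2 Pr (trunc psi N' (s j))) w) = fun j => trunc psi N' (s j) w.
    by apply/funext => j; exact: e.
  exact: (cvg_subseq_id hs (lim N' w)).
have sf' : sqintegrable Pr f'.
  apply: (@sqint_ae _ _ _ Pr f' (fun_of_L2 (T (toL2 Pr f)))) => //.
  - exact: Cpsi.
  - by apply: filterS aeE => w ->.
  - exact: sqintegrable_L2.
split => //; rewrite -[LHS]toL2K; apply: toL2_ae => //; exact: sqintegrable_L2.
Qed.

End family.
End shift.
End sigma_span.

(** * The span of the vectors Sigma is the whole L^2 space *)

Section sigma_eta_span.
Context (R : realType) (n : nat).
Context dY (Y : measurableType dY) (act : 'rV[R]_n -> Y -> Y).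
Context dO (Omega : measurableType dO).
Context (Pr : probability Omega R) (eta : R.-ker Omega ~> Y).
Context (lam : {sigma_finite_measure set Y -> \bar R}) (X : set Y) (ell : R[i] -> R[i]).
Hypotheses (cPr : measure_is_complete Pr) (poi : poisson_process Pr eta lam).
Hypotheses (mX : measurable X) (log : log_branch ell).
Hypothesis mact : measurable_action act.
Hypothesis inv : forall a B, measurable B -> lam (translate act a B) = lam B.
Local Open Scope complex_scope.
Local Notation npoints := (npoints eta).
Local Notation Sigma_simple := (Sigma_simple X Pr eta ell).
Local Notation sigma_eta := (sigma_eta Pr eta).
Local Notation Sigma_span := (@Sigma_span R dY Y dO Omega Pr eta lam X ell).
Local Notation simple_on := (simple_on lam X).

Lemma shf0 f : translate_fun act 0 f = f.
Proof. by apply/funext => y; rewrite /translate_fun oppr0 (act0 mact). Qed.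

Section indicators.
Variable D : set Y.
Hypothesis DX : D `<=` X.

Let ind (A : set Omega) w : R[i] := (\1_A w : R)%:C.

(** Overlaps are allowed, so that the intersection of two cells is the cell of the concatenated
    families; finite intensity makes the counts almost surely meaningful. *)
Let cell (A : set Omega) := exists m (B : 'I_m -> set Y) (k : 'I_m -> nat),
  [/\ forall i, measurable (B i), forall i, (lam (B i) < +oo)%E, forall i, B i `<=` D
    & A = [set w | forall i, npoints (B i) w = k i]].

Let cell_ind A : cell A -> Sigma_span D (toL2 Pr (ind A)).
Proof.
move=> [m [B [k [mB fB BD ->]]]].
have lid : @iplinear _ (L2ip Pr) (L2ip Pr) (Sigma_span D) id by [].
have bid : @ipbounded _ (L2ip Pr) (L2ip Pr) (Sigma_span D) id.
  by exists 1 => f _; rewrite mul1r.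
have D0X : translate act 0 D `<=` X by rewrite (translate0 mact).
have idS f : simple_on D f -> id (Sigma_simple f) = Sigma_simple (translate_fun act 0 f).
  by rewrite shf0.
have [+ _] := extraction_shift cPr poi mX log mact inv DX D0X lid bid idS mB fB BD k.
congr (Sigma_span D (toL2 Pr _)); apply/funext => w.
rewrite /ind /prodc indicE; have [h|h] := pselect (forall i, npoints (B i) w = k i).
  by rewrite mem_set// big1// => i _; rewrite /= /indc h eqxx.
rewrite memNset//; have [i hi] : exists i, npoints (B i) w != k i.
  by apply: contrapT => hn; apply: h => i; apply/eqP; apply: contrapT => hi;
    apply: hn; exists i; exact/negP.
by rewrite (bigD1 i)//= /indc (negbTE hi) mul0r.
Qed.

Let cellT : cell setT.
Proof.
exists 0%N, (fun=> set0), (fun=> 0%N); split; do ?by case.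
by apply/seteqP; split => // w _; case.
Qed.

Let cellI : setI_closed cell.
Proof.
move=> A1 A2 [m1 [B1 [k1 [mB1 fB1 BD1 ->]]]] [m2 [B2 [k2 [mB2 fB2 BD2 ->]]]].
pose B (i : 'I_(m1 + m2)) := match fintype.split i with inl j => B1 j | inr j => B2 j end.
pose k (i : 'I_(m1 + m2)) := match fintype.split i with inl j => k1 j | inr j => k2 j end.
exists (m1 + m2)%N, B, k; split.
- by move=> i; rewrite /B; case: (fintype.split i).
- by move=> i; rewrite /B; case: (fintype.split i).
- by move=> i; rewrite /B; case: (fintype.split i).
apply/seteqP; split => w /=.
  by move=> [h1 h2] i; rewrite /B /k; case: (fintype.split i).
move=> h; split => j.
  by have := h (lshift m2 j); rewrite /B /k (unsplitK (inl j)).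
by have := h (rshift m1 j); rewrite /B /k (unsplitK (inr j)).
Qed.

Let cell_measurable A : <<s cell >> A -> measurable A.
Proof.
apply: (smallest_sub (sigma_algebra_measurable Omega)).
move=> _ [m [B [k [mB fB BD ->]]]].
apply: (@measurable_counts _ Omega m (fun i => npoints (B i)) [set f | forall i, f i = k i]).
by move=> i j; exact: (measurable_count_eta eta [set j] (mB i)).
Qed.

Let sqint_ind A : measurable A -> sqintegrable Pr (ind A).
Proof.
move=> mA; apply: (@sqint_bounded _ _ _ Pr _ 1); first exact: Cmeas_indic.
by move=> w; rewrite /ind modc_real indicE; case: (_ \in _); rewrite ?normr1 ?normr0.
Qed.

(** Dynkin induction: complements use the constant 1, the indicator of the cell of the empty family,
    and disjoint unions use dominated convergence with bound 1. *)
Let sigma_cell_ind A : <<s cell >> A -> Sigma_span D (toL2 Pr (ind A)).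
Proof.
have sub := @Sigma_span_sub R dY Y dO Omega Pr eta lam X ell D.
have cl := @Sigma_span_closed R dY Y dO Omega Pr eta lam X ell D.
have KT := cell_ind cellT.
apply: (@dynkin_induction _ (g_sigma_algebraType cell) cell
  (fun A => Sigma_span D (toL2 Pr (ind A)))) => //.
- move=> S mS KS; have mS' := cell_measurable mS.
  have -> : ind (~` S) = fun w => ind setT w - ind S w.
    apply/funext => w; rewrite /ind !indicE in_setC in_setT.
    by case: (w \in S); rewrite /= ?rmorph0 ?rmorph1 ?subrr ?subr0.
  have sT : sqintegrable Pr (ind setT) by exact: sqint_ind.
  rewrite (toL2B sT (sqint_ind mS')).
  exact: (@ipsubB _ (L2ip Pr) _ _ _ sub).
- move=> F mF tF KF; have mF' k := cell_measurable (mF k).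
  have sF k : sqintegrable Pr (ind (F k)) by exact: sqint_ind.
  pose h j w := \sum_(0 <= k < j) ind (F k) w.
  have Kh j : Sigma_span D (toL2 Pr (h j)).
    rewrite /h; have -> := toL2_sum (index_iota 0 j) sF.
    exact: (@ipsub_sum _ (L2ip Pr) _ _ _ _ sub).
  have hE j w : h j w = if `[< exists2 k, (k < j)%N & F k w >] then 1 else 0.
    rewrite /h; case: ifPn => [/asboolP[k kj Fkw]|/asboolPn nF].
      rewrite (bigD1_seq k) ?iota_uniq ?mem_index_iota//= /ind indicE mem_set//.
      rewrite big1 ?addr0// => l lk; rewrite indicE memNset// => Flw.
      by move/eqP: lk; apply; apply: tF => //; exists w.
    rewrite big_nat_cond big1// => k /andP[/andP[_ kj] _].
    by rewrite /ind indicE memNset// => Fkw; apply: nF; exists k.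
  have cvg : L2cvg (fun j => toL2 Pr (h j)) (toL2 Pr (ind (\bigcup_k F k))).
    have mU : measurable (\bigcup_k F k : set Omega) by exact: bigcupT_measurable.
    apply: (sqint_Ccvg_dominated (g := fun=> 1)) => //.
    - by move=> j; apply: Cmeas_sum => k _; exact: Cmeas_indic.
    - exact: Cmeas_indic.
    - by move=> j w; rewrite hE modc1; case: ifP; rewrite ?modc1 ?modc0.
    - move=> w; rewrite /ind modc_real modc1 indicE.
      by case: (_ \in _); rewrite ?normr1 ?normr0.
    - exact: sqint_cst1.
    apply: aeW => w; have [[k _ Fkw]|nF] := pselect ((\bigcup_k F k) w).
      apply: cvg_near_cst; exists k.+1 => // j /= kj; rewrite hE.
      rewrite ifT; last by apply/asboolP; exists k.
      by rewrite /ind indicE mem_set ?subrr ?modc0//; exists k.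
    apply: cvg_near_cst; exists 0%N => // j _; rewrite hE ifF; last first.
      by apply/asboolP => -[k _ Fkw]; apply: nF; exists k.
    by rewrite /ind indicE memNset// subrr modc0.
  exact: (@ipclosedP _ (L2ip Pr) _ _ _ cl Kh cvg).
Qed.

(** Cells omit the negligible sets and the [B] of infinite intensity. Both are absorbed by an almost
    sure equality: in the second case [eta w B] is almost surely [+oo], so each event about it is
    trivial. *)
Let sigma_eta_cell A : sigma_eta D A ->
  exists2 A', <<s cell >> A' & {ae Pr, forall w, A w <-> A' w}.
Proof.
move: A; apply: smallest_sub.
  split.
  - by exists set0; [exact: sigma_algebra0|exact: aeW].
  - move=> A [A' cA' AA']; exists (~` A'); first exact: sigma_algebraC.
    by apply: filterS AA' => w e; rewrite setTD; split => h1 h2; apply: h1; apply/e.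
  - move=> F hF.
    have /choice[F' hF'] : forall k, exists A', <<s cell >> A' /\ {ae Pr, forall w, F k w <-> A' w}.
      by move=> k; have [A' cA' AA'] := hF k; exists A'.
    exists (\bigcup_k F' k); first by apply: sigma_algebra_bigcup => k; have [] := hF' k.
    have : {ae Pr, forall w k, F k w <-> F' k w} by apply: ae_foralln => k; have [] := hF' k.
    by apply: filterS => w e; split => -[k _ Fk]; exists k => //; apply/e.
move=> A [|nA]; last first.
  exists set0; first exact: sigma_algebra0.
  have [N [mN N0 sN]] := nA; exists N; split => // w /= h; apply: sN.
  by apply: contrapT => nAw; apply: h; split.
move=> [B [mB BD] [U mU <-]].
have cT : <<s cell >> setT by exact: sub_sigma_algebra cellT.
have [Bf|Boo] := ltP (lam B) +oo%E.
  exists (\bigcup_k [set w | U k%:R%:E /\ npoints B w = k]).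
    apply: sigma_algebra_bigcup => k; have [Uk|Uk] := pselect (U k%:R%:E); last first.
      by rewrite (_ : mkset _ = set0); [exact: sigma_algebra0|apply/seteqP; split => w // []].
    apply: sub_sigma_algebra; exists 1%N, (fun=> B), (fun=> k); split => //.
    by apply/seteqP; split => w /=; [move=> [_ ->]|move=> /(_ ord0) ->].
  apply: filterS (eta_count_ae poi mB Bf) => w e /=; split => [h|[k _ [Uk kE]]].
    by exists (npoints B w) => //; split => //; rewrite -e.
  by rewrite e kE.
have [_ law _] := poi.
have lB : lam B = +oo%E by apply/eqP; rewrite eq_le leey Boo.
have [Uoo|Uoo] := pselect (U +oo%E).
  by exists setT => //; apply: filterS ((law B mB).1 lB) => w /= ->.
exists set0; first exact: sigma_algebra0.
by apply: filterS ((law B mB).1 lB) => w /= ->.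
Qed.

Lemma L2sub_sigma_eta : L2sub (sigma_eta D) = Sigma_span D.
Proof.
have sub := @Sigma_span_sub R dY Y dO Omega Pr eta lam X ell D.
have cl := @Sigma_span_closed R dY Y dO Omega Pr eta lam X ell D.
have meas : sigma_eta D `<=` measurable by exact: sigma_eta_measurable.
have negl : Pr.-negligible `<=` sigma_eta D by exact: sigma_eta_negligible.
apply/seteqP; split; last first.
  apply: (@ipspan_min _ (L2ip Pr)).
  - exact: L2sub_sub.
  - exact: (L2sub_closed meas negl).
  - by move=> _ [f Sf <-]; exact: (L2sub_Sigma_simple cPr poi mX log Sf).
apply: (L2sub_min meas sub cl) => A sA.
have [A' cA' AA'] := sigma_eta_cell sA.
rewrite (_ : toL2 _ _ = toL2 Pr (ind A')); first exact: sigma_cell_ind.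
apply: toL2_ae; [exact/sqint_ind/meas|exact/sqint_ind/cell_measurable|].
apply: filterS AA' => w e; rewrite /ind !indicE; congr (_%:R%:C).
by congr nat_of_bool; apply/idP/idP; rewrite !inE => /e.
Qed.

End indicators.
End sigma_eta_span.

(** * The shifts *)

Section invariant_integral.
Context (R : realType) (n : nat).
Context dY (Y : measurableType dY) (act : 'rV[R]_n -> Y -> Y).
Context (lam : {sigma_finite_measure set Y -> \bar R}).
Hypothesis mact : measurable_action act.
Hypothesis inv : forall a B, measurable B -> lam (translate act a B) = lam B.
Local Open Scope complex_scope.
Local Notation shf := (translate_fun act).

Let ge0_integral_act a (f : Y -> \bar R) : measurable_fun setT f ->
  (forall y, (0 <= f y)%E) -> (\int[lam]_y f (act (- a) y) = \int[lam]_y f y)%E.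
Proof.
move=> mf f0; have ma := measurable_act mact (- a).
have f0' : {in setT, forall y, (0 <= f y)%E} by move=> y _; exact: f0.
apply: (etrans (esym (ge0_integral_pushforward ma lam measurableT mf f0'))).
apply: eq_measure_integral => A mA _.
by rewrite /pushforward -[RHS](inv a mA) (translateE mact).
Qed.

Lemma integral_act a (f : Y -> \bar R) : measurable_fun setT f ->
  (\int[lam]_y f (act (- a) y) = \int[lam]_y f y)%E.
Proof.
move=> mf; rewrite integralE [RHS]integralE; congr (_ - _)%E.
  rewrite -(ge0_integral_act a (measurable_funepos mf)) => [|y]; last exact: funepos_ge0.
  by apply: eq_integral => y _; rewrite !funeposE.
rewrite -(ge0_integral_act a (measurable_funeneg mf)) => [|y]; last exact: funeneg_ge0.
by apply: eq_integral => y _; rewrite !funenegE.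
Qed.

Lemma Cmeas_shf a f : Cmeas f -> Cmeas (shf a f).
Proof. by move=> mf; exact: (Cmeas_comp mf (measurable_act mact (- a))). Qed.

Lemma sqint_shf a f : sqintegrable lam f -> sqintegrable lam (shf a f).
Proof.
move=> sf; have mf := sqint_meas sf; apply/sqintP; split; first exact: Cmeas_shf.
apply: Rintegrable_ge0 => [|y|]; first by apply: Cmeas_nsq; exact: Cmeas_shf.
  exact: nsq_ge0.
rewrite (integral_act a (f := fun y => (nsq (f y))%:E)); last exact/measurable_EFinP/Cmeas_nsq.
have /(integrable_fin_num measurableT) := sqint_nsq sf.
by move=> /fin_numPlt/andP[].
Qed.

Lemma dot_shf a f g : sqintegrable lam f -> sqintegrable lam g ->
  dot (toL2 lam (shf a f)) (toL2 lam (shf a g)) = dot (toL2 lam f) (toL2 lam g).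
Proof.
move=> sf sg; rewrite (dotE (sqint_shf a sf) (sqint_shf a sg)) (dotE sf sg).
have [m1 m2] := CmeasM (sqint_meas sf) (CmeasJ (sqint_meas sg)).
move/measurable_EFinP in m1; move/measurable_EFinP in m2.
congr (fine _ +i* fine _); [exact: (integral_act a m1)|exact: (integral_act a m2)].
Qed.

End invariant_integral.

Section shift_operator.
Context (R : realType) (n : nat).
Context dY (Y : measurableType dY) (act : 'rV[R]_n -> Y -> Y).
Context dO (Omega : measurableType dO).
Context (Pr : probability Omega R) (eta : R.-ker Omega ~> Y).
Context (lam : {sigma_finite_measure set Y -> \bar R}) (X : set Y) (ell : R[i] -> R[i]).
Hypotheses (cPr : measure_is_complete Pr) (poi : poisson_process Pr eta lam).
Hypotheses (mX : measurable X) (log : log_branch ell).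
Hypothesis mact : measurable_action act.
Hypothesis inv : forall a B, measurable B -> lam (translate act a B) = lam B.
Local Open Scope complex_scope.
Local Notation npoints := (npoints eta).
Local Notation Sigma_simple := (Sigma_simple X Pr eta ell).
Local Notation sigma_eta := (sigma_eta Pr eta).
Local Notation Sigma_span := (@Sigma_span R dY Y dO Omega Pr eta lam X ell).
Local Notation simple_on := (simple_on lam X).
Local Notation shf := (translate_fun act).
Local Notation is_shift := (@Defs.is_shift R n dY Y act X dO Omega Pr eta).
Local Notation shift := (@Defs.shift R n dY Y act X dO Omega Pr eta).

Lemma eta_infinite_ae B : measurable B -> lam B = +oo%E ->
  {ae Pr, forall w, eta w B = +oo%E}.
Proof. by move=> mB Boo; have [_ law _] := poi; exact: (law B mB).1. Qed.

Section phi.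
Variables (D : set Y) (a : 'rV[R]_n) (T : L2 Pr -> L2 Pr).
Hypotheses (DX : D `<=` X) (DaX : translate act a D `<=` X).
Hypothesis lT : @iplinear _ (L2ip Pr) (L2ip Pr) (Sigma_span D) T.
Hypothesis bT : @ipbounded _ (L2ip Pr) (L2ip Pr) (Sigma_span D) T.
Hypothesis TS : forall f, simple_on D f -> T (Sigma_simple f) = Sigma_simple (shf a f).

Lemma shift_phi m (B : 'I_m -> set Y) (phi : ('I_m -> \bar R) -> R[i]) :
  (forall i, measurable (B i)) -> (forall i, B i `<=` D) ->
  sqintegrable Pr (fun w => phi (fun i => eta w (B i))) ->
  T (toL2 Pr (fun w => phi (fun i => eta w (B i)))) =
    toL2 Pr (fun w => phi (fun i => eta w (translate act a (B i)))).
Proof.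
move=> mB BD sp.
(* The specification of the shift allows sets of infinite intensity. Their coordinate is almost
   surely the constant [+oo], before and after translation, so they are replaced by the empty set
   and [psi] inserts the constant. *)
pose fin i := `[< (lam (B i) < +oo)%E >].
pose C i := if fin i then B i else set0.
pose psi (k : 'I_m -> nat) := phi (fun i => if fin i then (k i)%:R%:E else +oo%E).
have mC i : measurable (C i) by rewrite /C; case: (fin i).
have fC i : (lam (C i) < +oo)%E.
  by rewrite /C /fin; case: asboolP => // _; rewrite measure0.
have CD i : C i `<=` D by rewrite /C; case: (fin i).
have noo i : ~~ fin i -> lam (B i) = +oo%E.
  by move=> /asboolPn h; apply/eqP; rewrite eq_le leey leNgt; exact/negP.
have ae_eta (A : 'I_m -> set Y) : (forall i, measurable (A i)) ->
    (forall i, lam (A i) = lam (B i)) ->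
    {ae Pr, forall w, phi (fun i => eta w (A i)) =
      psi (fun i => npoints (if fin i then A i else set0) w)}.
  move=> mA lA.
  have h i : {ae Pr, forall w, eta w (A i) =
      if fin i then (npoints (if fin i then A i else set0) w)%:R%:E else +oo%E}.
    have [fi|fi] := boolP (fin i).
      have lf : (lam (A i) < +oo)%E by rewrite lA; exact/asboolP.
      exact: (eta_count_ae poi (mA i) lf).
    exact: (eta_infinite_ae (mA i) (etrans (lA i) (noo i fi))).
  by apply: filterS (ae_forall_ord h) => w hw; rewrite /psi; congr phi; apply/funext.
have aeB := ae_eta B mB (fun=> erefl).
have mB' i : measurable (translate act a (B i)) by exact: measurable_translate.
have aeB' := ae_eta _ mB' (fun i => inv a (mB i)).
have CE : (fun i => if fin i then translate act a (B i) else set0) =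
    fun i => translate act a (C i).
  apply/funext => i; rewrite /C; case: (fin i) => //; by rewrite /translate image_set0.
have mpsi : Cmeas (fun w => psi (fun i => npoints (C i) w)).
  by apply: (Cmeas_ae cPr _ (sqint_meas sp)); apply: filterS aeB => w ->.
have spsi : sqintegrable Pr (fun w => psi (fun i => npoints (C i) w)).
  by apply: (sqint_ae mpsi _ sp); apply: filterS aeB => w ->.
have [s' e] := shift_counts cPr poi mX log mact inv DX DaX lT bT TS mC fC CD spsi.
have aeB2 : {ae Pr, forall w, phi (fun i => eta w (translate act a (B i))) =
    psi (fun i => npoints (translate act a (C i)) w)}.
  apply: filterS aeB' => w ->; congr psi; apply/funext => i.
  by have /(congr1 (@^~ i)) <- := CE.
rewrite (toL2_ae sp spsi aeB); apply: (etrans e); apply: toL2_ae => //.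
  by apply: (sqint_ae _ aeB2 s'); apply: (Cmeas_ae cPr aeB2); exact: sqint_meas s'.
by apply: filterS aeB2 => w ->.
Qed.

End phi.

(** Invariance of [lam] makes translation preserve the kernel of the vectors Sigma, and
    [isometric_extension] applies. *)
Lemma shift_exists (D : set Y) a : D `<=` X -> translate act a D `<=` X ->
  exists T : L2 Pr -> L2 Pr,
  [/\ @iplinear _ (L2ip Pr) (L2ip Pr) (Sigma_span D) T,
      @ipisometric _ (L2ip Pr) (L2ip Pr) (Sigma_span D) T,
      forall f, simple_on D f -> T (Sigma_simple f) = Sigma_simple (shf a f)
    & T @` Sigma_span D = Sigma_span (translate act a D)].
Proof.
move=> DX DaX.
pose I := {f | simple_on D f}.
pose s (i : I) := Sigma_simple (sval i).
pose t (i : I) := Sigma_simple (shf a (sval i)).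
have st i j : dot (t i) (t j) = 1%:C * dot (s i) (s j).
  have [Si Sj] := (svalP i, svalP j).
  have Si' := simple_on_shf mact inv Si DaX.
  have Sj' := simple_on_shf mact inv Sj DaX.
  apply: (etrans (dot_Sigma_simple cPr poi mX log Si'.1 Sj'.1)).
  rewrite mul1r; apply: (etrans _ (esym (dot_Sigma_simple cPr poi mX log Si.1 Sj.1))).
  have [[si _ _ _] _] := Si; have [[sj _ _ _] _] := Sj.
  exact: congr1 _ (dot_shf mact inv a si sj).
have [T [lT iT Ts]] := @isometric_extension _ (L2ip Pr) (L2ip Pr) I s t 1 st ler01.
have spanE : @ipspan _ (L2ip Pr) (range s) = Sigma_span D.
  congr ipspan; apply/seteqP; split => [_ [i _ <-]|_ [f Sf <-]].
    by exists (sval i) => //; exact: svalP.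
  by exists (exist _ f Sf).
rewrite spanE in lT iT.
have iso : @ipisometric _ (L2ip Pr) (L2ip Pr) (Sigma_span D) T.
  by move=> f g Kf Kg; rewrite iT// mul1r.
have TS f : simple_on D f -> T (Sigma_simple f) = Sigma_simple (shf a f).
  by move=> Sf; exact: (Ts (exist _ f Sf)).
exists T; split => //.
have := @ipisometric_span _ (L2ip Pr) (L2ip Pr) _ T _ (@Sigma_span_sub R dY Y dO Omega Pr eta lam X ell D) lT iso (fun x h => h).
move=> h; apply: (etrans h); apply: (congr1 (@ipspan _ (L2ip Pr))).
apply/seteqP; split => [_ [_ [f Sf <-] <-]|_ [f Sf <-]].
  by exists (shf a f); [exact: simple_on_shf|rewrite TS].
(* Surjectivity: a function supported on the translate of [D] is the translate by [a] of its
   translate by [- a]. *)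
have DE : translate act (- a) (translate act a D) = D.
  by rewrite -translateD// addNr (translate0 mact).
have Sf' : simple_on D (shf (- a) f).
  by rewrite -[D in simple_on D]DE; apply: simple_on_shf => //; rewrite DE.
exists (Sigma_simple (shf (- a) f)); first by exists (shf (- a) f).
apply: (etrans (TS _ Sf')); apply: (congr1 Sigma_simple); apply/funext => y.
by rewrite /translate_fun opprK (actNK mact).
Qed.

(** [shift] is a chosen map, so it satisfies its specification as soon as one map does. *)
Lemma is_shiftP a b : translate act a X `<=` X -> is_shift a 0 b (shift a 0 b).
Proof.
move=> aX; pose D := translate act 0 X `\` translate act b X.
have DX : D `<=` X by rewrite /D (translate0 mact) => y [].
have DaX : translate act a D `<=` X.
  by apply: subset_trans aX; exact: translateSS.
have [T [lT iT TS TE]] := shift_exists DX DaX.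
have E2 : translate act (0 + a) X `\` translate act (b + a) X = translate act a D.
  by rewrite /D translate_setD// -!translateD// addrC [b + a]addrC.
rewrite /Defs.shift; apply: xgetPex; exists T; split.
  rewrite /sigma_interval E2.
  by rewrite !(L2sub_sigma_eta cPr poi mX log mact inv).
move=> m B phi mB BD sp.
exact: (shift_phi DX DaX lT (ipisometric_bounded iT) TS mB BD sp).
Qed.

(** The specification speaks of functions of counts, so the vector is written as such a function;
    its normalising factor is unchanged because [lam] is invariant. *)
Lemma shift_Sigma_simple a b f : translate act a X `<=` X ->
  simple_on (X `\` translate act b X) f ->
  shift a 0 b (Sigma_simple f) = Sigma_simple (shf a f).
Proof.
move=> aX [Sf fD]; have [_ ph] := is_shiftP b aX.
have [m [B [c [e [[mB fB tB BX] [fE _] c1 _ key]]]]] := simpleS_pair Sf Sf.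
have BD i : B i `<=` translate act 0 X `\` translate act b X.
  rewrite (translate0 mact) => y By; have [_ _ h] := key i; have [_ _ {}h] := h y By.
  by apply: contrapT => Dy; move: h; rewrite fD// eqxx; case.
pose phi (x : 'I_m -> \bar R) := cexps (- \sum_(i < m) (rate lam (B i))%:C * c i) *
  \prod_(i < m) (1 + c i) ^+ cntE (x i).
have fE' y : X y -> f y = step B c y by rewrite fE.
rewrite (Sigma_simple_step cPr poi mX log mB fB tB BX c1 fE').
have sp : sqintegrable Pr (fun w => phi (fun i => eta w (B i))).
  exact: (sqint_exp_step poi mB fB tB c).
apply: (etrans (ph m B phi mB BD sp)).
have mB' i : measurable (translate act a (B i)) by exact: measurable_translate.
have fB' i : (lam (translate act a (B i)) < +oo)%E.
  by rewrite (inv a (mB i)); exact: fB.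
have tB' := trivIset_translate mact (a := a) tB.
have BX' i : translate act a (B i) `<=` X by apply: subset_trans aX; exact: translateSS.
have fE2 y : X y -> shf a f y = step (fun i => translate act a (B i)) c y.
  by move=> _; rewrite (step_translate mact) fE.
rewrite (Sigma_simple_step cPr poi mX log mB' fB' tB' BX' c1 fE2).
have rE : \sum_(i < m) (rate lam (translate act a (B i)))%:C * c i =
    \sum_(i < m) (rate lam (B i))%:C * c i.
  by apply: eq_bigr => i _; exact: (congr1 (fun x => (fine x)%:C * c i) (inv a (mB i))).
apply: (congr1 (toL2 Pr)); apply/funext => w.
exact: (congr1 (fun s => cexps (- s) *
  exp_count eta (fun i => translate act a (B i)) c w) (esym rE)).
Qed.

End shift_operator.

(** * The isometry Theta *)

Section supported_functions.
Context d (T : measurableType d) (R : realType) (mu : {measure set T -> \bar R}).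
Implicit Types D : set T.
Local Open Scope complex_scope.

Lemma L2on_subspace D : Defs.subspace (L2on mu D).
Proof.
split; first by apply: filterS (fun_toL2 (sqintegrable0 mu)) => x ->.
move=> c f g Df Dg; apply: filterS3 (fun_of_L2D (c *: f) g) (fun_of_L2Z c f) (filterI Df Dg).
by move=> x -> -> [hf hg] Dx; rewrite hf// hg// mulr0 addr0.
Qed.

Lemma L2onS D D' : D `<=` D' -> L2on mu D `<=` L2on mu D'.
Proof. by move=> DD' f; apply: filterS => x h D'x; apply: h => /DD'. Qed.

Lemma L2on_toL2 D f : sqintegrable mu f -> (forall x, ~ D x -> f x = 0) ->
  L2on mu D (toL2 mu f).
Proof. by move=> sf fD; apply: filterS (fun_toL2 sf) => x -> /fD. Qed.

(* The factor [1 - 1 / (n + 2)] moves the value [-1] away from itself. *)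
Let avoid (s : T -> R[i]) n x : R[i] :=
  s x * (1 - n.+2%:R^-1 * \1_[set y | s y = -1] x)%:C.

Let avoid_le s n x : modc (avoid s n x) <= modc (s x).
Proof.
rewrite /avoid modcM modc_real -[leRHS]mulr1 ler_wpM2l ?modc_ge0//.
have h0 : 0 <= n.+2%:R^-1 :> R by rewrite invr_ge0.
have h1 : n.+2%:R^-1 <= 1 :> R by rewrite invf_le1 ?ltr0n// ler1n.
rewrite indicE; case: (_ \in _); rewrite ?mulr1 ?mulr0 ?subr0 ?normr1//.
by rewrite ger0_norm ?subr_ge0// lerBlDr lerDl.
Qed.

Let avoid_neqN1 s n x : avoid s n x <> -1.
Proof.
rewrite /avoid indicE; have [e|e] := pselect (s x = -1); last first.
  by rewrite memNset// mulr0 subr0 rmorph1 mulr1.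
rewrite mem_set// mulr1 e mulN1r => /eqP.
rewrite eqr_opp => /eqP/(congr1 (@complex.Re R))/= /eqP.
by rewrite subr_eq -subr_eq0 opprD addNKr oppr_eq0 invr_eq0 pnatr_eq0.
Qed.

Let avoid_cvg (s : nat -> T -> R[i]) x l : Ccvg (s ^~ x) l ->
  Ccvg (fun n => avoid (s n) n x) l.
Proof.
move=> sl; rewrite -[l]mulr1; apply: CcvgM => //.
apply: (@squeeze0 R _ (fun n => n.+1%:R^-1)) => [n|n|].
- exact: modc_ge0.
- rewrite -[X in _ - X](rmorph1 (real_complex R)) -rmorphB modc_real addrAC subrr add0r normrN.
  rewrite indicE; case: (_ \in _); rewrite ?mulr1 ?mulr0 ?normr0 ?invr_ge0//.
  by rewrite ger0_norm ?invr_ge0// lef_pV2 ?posrE ?ltr0n// ler_nat.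
- exact: cvg_harmonic.
Qed.

Lemma L2on_approx D f : measurable D -> L2on mu D f ->
  exists fs : nat -> T -> R[i], [/\ forall n, sqintegrable mu (fs n),
    forall n, finite_set (range (fs n)), forall n x, ~ D x -> fs n x = 0,
    forall n x, fs n x <> -1 & L2cvg (fun n => toL2 mu (fs n)) f].
Proof.
move=> mD Df; pose g x := (\1_D x : R)%:C * fun_of_L2 f x.
have mf := sqint_meas (sqintegrable_L2 f).
have mg : Cmeas g by apply: CmeasM => //; exact: Cmeas_indic.
have gf : {ae mu, forall x, g x = fun_of_L2 f x}.
  apply: filterS Df => x h; rewrite /g indicE; have [Dx|Dx] := pselect (D x).
    by rewrite mem_set// mul1r.
  by rewrite memNset// mul0r h.
have sg := sqint_ae mg gf (sqintegrable_L2 f).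
have [s [ms fs les cvs]] := Cmeas_simple_approx mg.
have ma n : Cmeas (avoid (s n) n).
  apply: CmeasM => //; apply: Cmeas_real; apply: measurable_funB => //.
  apply: measurable_funM => //; apply: measurable_indic; exact: Cmeas_eq.
have le n x : modc (avoid (s n) n x) <= modc (g x).
  exact: le_trans (avoid_le _ _ _) (les n x).
exists (fun n => avoid (s n) n); split.
- by move=> n; exact: sqint_le (ma n) (le n) sg.
- move=> n; pose h (z : R[i]) : R[i] := z * (1 - n.+2%:R^-1 * (z == -1)%:R)%:C.
  apply: (@sub_finite_set _ _ (h @` range (s n))); last exact: finite_image.
  move=> _ [x _ <-]; exists (s n x); first by exists x.
  rewrite /h /avoid indicE; congr (_ * (1 - _ * _%:R)%:C).
  by congr nat_of_bool; apply/eqP/idP; rewrite inE.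
- move=> n x Dx; apply/eqP; rewrite -modc_eq0 eq_le modc_ge0 andbT.
  by rewrite (le_trans (le n x))// /g indicE memNset// mul0r modc0.
- by move=> n x; exact: avoid_neqN1.
have -> : f = toL2 mu g.
  rewrite -[LHS]toL2K; apply: toL2_ae => //; first exact: sqintegrable_L2.
  by apply: filterS gf => x ->.
by apply: (sqint_Ccvg_dominated (g := g)) => //; apply: aeW => x; exact: avoid_cvg.
Qed.

End supported_functions.

Section fock_to_poisson.
Context (R : realType).
Context dY (Y : measurableType dY).
Context dO (Omega : measurableType dO).
Context (Pr : probability Omega R) (eta : R.-ker Omega ~> Y).
Context (lam : {sigma_finite_measure set Y -> \bar R}) (X : set Y) (ell : R[i] -> R[i]).
Hypotheses (cPr : measure_is_complete Pr) (poi : poisson_process Pr eta lam).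
Hypotheses (mX : measurable X) (log : log_branch ell).
Local Open Scope complex_scope.
Local Notation FM := (fock_measure lam).
Local Notation Sigma_simple := (Sigma_simple X Pr eta ell).
Local Notation Sigma_span := (@Sigma_span R dY Y dO Omega Pr eta lam X ell).
Local Notation simple_on := (simple_on lam X).
Local Notation simpleS := (simpleS lam X).
Local Notation Sigma := (Sigma lam X Pr eta ell).

Definition expvec_simple (D : set Y) : set (L2 FM) :=
  [set expvec (toL2 lam f) | f in simple_on D].

Lemma simpleS_on f : simpleS f -> simple_on X f.
Proof. by move=> Sf; split => //; have [_ _ ? _] := Sf. Qed.

Lemma simple_on_dense D xi : D `<=` X -> measurable D -> L2on lam D xi ->
  exists fs, (forall n, simple_on D (fs n)) /\ L2cvg (fun n => toL2 lam (fs n)) xi.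
Proof.
move=> DX mD Dxi; have [fs [sf ff f0 f1 cf]] := L2on_approx mD Dxi.
exists fs; split => // n; split; last exact: f0.
by split => // y Xy; apply: f0 => /DX.
Qed.

Lemma fock_L2on D : fock (L2on lam D) =
  @ipspan _ (L2ip FM) [set expvec xi | xi in L2on lam D].
Proof. exact: fock_expvec (L2on_subspace lam D). Qed.

(** Density of simple functions and continuity of [expvec] reduce the generators to those on which
    [Sigma_simple] is defined. *)
Lemma fock_simple D : D `<=` X -> measurable D ->
  fock (L2on lam D) = @ipspan _ (L2ip FM) (expvec_simple D).
Proof.
move=> DX mD; rewrite fock_L2on; apply/seteqP; split.
  apply: (@ipspan_min _ (L2ip FM)).
  - exact: ipspan_sub.
  - exact: ipspan_closed.
  - move=> _ [xi Dxi <-]; have [fs [Sfs cfs]] := simple_on_dense DX mD Dxi.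
    apply: (@ipclosedP _ (L2ip FM) _ _ _ (@ipspan_closed _ (L2ip FM) _) _ (expvec_cvg cfs)).
    by move=> k; apply: (@ipspan_incl _ (L2ip FM)); exists (fs k).
apply: (@ipspanS _ (L2ip FM)) => _ [f [Sf fD] <-].
by exists (toL2 lam f) => //; apply: L2on_toL2 => //; have [] := Sf.
Qed.

Lemma fock_L2onS D D' : D `<=` D' -> fock (L2on lam D) `<=` fock (L2on lam D').
Proof.
move=> DD'; rewrite !fock_L2on; apply: (@ipspanS _ (L2ip FM)) => _ [xi Dxi <-].
by exists xi => //; exact: L2onS Dxi.
Qed.

Lemma expvec_fock D xi : L2on lam D xi -> fock (L2on lam D) (expvec xi).
Proof. by move=> Dxi; rewrite fock_L2on; apply: (@ipspan_incl _ (L2ip FM)); exists xi. Qed.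

Lemma fock_L2on_sub D : @ipsub _ (L2ip FM) (fock (L2on lam D)).
Proof. by rewrite fock_L2on; exact: ipspan_sub. Qed.

Section Theta_properties.
Variable T : L2 FM -> L2 Pr.
Hypothesis lT : @iplinear _ (L2ip FM) (L2ip Pr) (fock (L2on lam X)) T.
Hypothesis iT : @ipisometric _ (L2ip FM) (L2ip Pr) (fock (L2on lam X)) T.
Hypothesis Ts : forall f, simpleS f -> T (expvec (toL2 lam f)) = Sigma_simple f.

Lemma fock_Sigma_image D : D `<=` X -> measurable D ->
  T @` fock (L2on lam D) = Sigma_span D.
Proof.
move=> DX mD; have h := @ipisometric_span _ (L2ip FM) (L2ip Pr) _ T (expvec_simple D)
  (@fock_L2on_sub X) lT iT.
rewrite (fock_simple DX mD); apply: (etrans (h _)).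
  by rewrite -fock_simple//; exact: fock_L2onS.
apply: (congr1 (@ipspan _ (L2ip Pr))); apply/seteqP.
split => [_ [_ [f Sf <-] <-]|_ [f Sf <-]].
  by exists f => //; exact/esym/Ts/(Sf.1).
by exists (expvec (toL2 lam f)); [exists f|exact: Ts Sf.1].
Qed.

Lemma is_Sigma_image xi : L2on lam X xi -> is_Sigma X eta ell xi (T (expvec xi)).
Proof.
move=> Xxi fs Sfs cfs; have Xf k : fock (L2on lam X) (expvec (toL2 lam (fs k))).
  apply: expvec_fock; have [sf ff f0 _] := Sfs k; exact: L2on_toL2.
have := @ipbounded_cvg _ (L2ip FM) (L2ip Pr) _ T _ _ (@fock_L2on_sub X) lT
  (ipisometric_bounded iT) Xf (expvec_fock Xxi) (expvec_cvg cfs).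
by rewrite (_ : T \o _ = fun k => Sigma_simple (fs k))//; apply/funext => k; exact: Ts.
Qed.

(** [Sigma] is chosen among the limits along all approximating sequences; such a limit is unique
    because at least one sequence exists, by [simple_on_dense]. *)
Lemma Sigma_image xi : L2on lam X xi -> T (expvec xi) = Sigma xi.
Proof.
move=> Xxi; have h := is_Sigma_image Xxi.
have [fs [Sfs cfs]] := simple_on_dense (@subset_refl _ X) mX Xxi.
have Sf k := (Sfs k).1.
have h' : is_Sigma X eta ell xi (Sigma xi) by apply: xgetPex; exists (T (expvec xi)).
exact: (@ipcvg_unique _ (L2ip Pr) _ _ _ (h fs Sf cfs) (h' fs Sf cfs)).
Qed.

End Theta_properties.

Lemma Theta_exists : exists T : L2 FM -> L2 Pr,
  [/\ @iplinear _ (L2ip FM) (L2ip Pr) (fock (L2on lam X)) T,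
      @ipisometric _ (L2ip FM) (L2ip Pr) (fock (L2on lam X)) T
    & forall f, simpleS f -> T (expvec (toL2 lam f)) = Sigma_simple f].
Proof.
pose I := {f | simple_on X f}.
pose s (i : I) : L2 FM := expvec (toL2 lam (sval i)).
pose t (i : I) := Sigma_simple (sval i).
have st i j : dot (t i) (t j) = 1%:C * dot (s i) (s j).
  have [Si Sj] := (svalP i, svalP j).
  apply: (etrans (dot_Sigma_simple cPr poi mX log Si.1 Sj.1)).
  by rewrite mul1r; apply/esym; exact: dot_expvec.
have [T [lT iT Ts]] := @isometric_extension _ (L2ip FM) (L2ip Pr) I s t 1 st ler01.
have spanE : @ipspan _ (L2ip FM) (range s) = fock (L2on lam X).
  rewrite (fock_simple (@subset_refl _ X) mX).
  apply: (congr1 (@ipspan _ (L2ip FM))); apply/seteqP; split => [_ [i _ <-]|_ [f Sf <-]].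
    by exists (sval i) => //; exact: svalP.
  by exists (exist _ f Sf).
rewrite spanE in lT iT; exists T; split => //.
  by move=> f g Kf Kg; rewrite iT// mul1r.
by move=> f /simpleS_on Sf; exact: (Ts (exist _ f Sf)).
Qed.

End fock_to_poisson.

(** * Products of independent random variables *)

Lemma ae_and d (T : measurableType d) (R : realType) (mu : {measure set T -> \bar R})
    (Q Q' : T -> Prop) : {ae mu, forall x, Q x} -> {ae mu, forall x, Q' x} ->
  {ae mu, forall x, Q x /\ Q' x}.
Proof. by move=> h h'; exact: filterI h h'. Qed.

Section inner_product_extension.
Context (R : realType) (E F : ipSpace R).
Local Open Scope complex_scope.

Let extend_left (S : set E) (T : E -> F) (c : R[i]) (w : F) (w' : E) :
  iplinear (ipspan S) T -> ipbounded (ipspan S) T ->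
  (forall v, S v -> ip (T v) w = c * ip v w') ->
  forall v, ipspan S v -> ip (T v) w = c * ip v w'.
Proof.
move=> lT bT TS; pose K := [set v | ipspan S v /\ ip (T v) w = c * ip v w'].
have sS := @ipspan_sub _ _ S; have cS := @ipspan_closed _ _ S.
suff KS : ipspan S `<=` K by move=> v /KS[].
apply: ipspan_min.
- split; first by split; [exact: sS.1|rewrite (iplinear0 sS lT) !ip0l mulr0].
  move=> a f g [Kf ef] [Kg eg]; split; first exact: sS.2.
  by rewrite lT// !ipDl !ipZl ef eg; ring.
- move=> f hf; have [fs [Kfs cf]] := ipclosed_seq hf.
  have Sfs n := (Kfs n).1; have Sf := ipclosedP cS Sfs cf; split => //.
  apply: (Ccvg_unique (ipcvg_ip (ipbounded_cvg sS lT bT Sfs Sf cf) (ipcvg_cst w))).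
  apply: Ccvg_eq (CcvgM (Ccvg_cst c) (ipcvg_ip cf (ipcvg_cst w'))) => n.
  exact: esym (Kfs n).2.
- by move=> v Sv; split; [exact: ipspan_incl|exact: TS].
Qed.

(** The identity is extended in one argument with the other fixed, then in the other by conjugate
    symmetry, which conjugates the constant. *)
Lemma ip_extend (S : set E) (T T' : E -> F) (c : R[i]) :
  iplinear (ipspan S) T -> ipbounded (ipspan S) T ->
  iplinear (ipspan S) T' -> ipbounded (ipspan S) T' ->
  (forall v v', S v -> S v' -> ip (T v) (T' v') = c * ip v v') ->
  forall v v', ipspan S v -> ipspan S v' -> ip (T v) (T' v') = c * ip v v'.
Proof.
move=> lT bT lT' bT' TS v v' Sv Sv'.
have h v0 : S v0 -> ip (T v) (T' v0) = c * ip v v0.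
  by move=> Sv0; apply: (extend_left lT bT) => // v1 Sv1; exact: TS.
have h' : ip (T' v') (T v) = c^* * ip v' v.
  apply: (extend_left lT' bT') => // v0 Sv0.
  rewrite ipC h//; apply: (etrans (rmorphM _ _ _)); apply: (congr1 ( *%R (c^*))).
  exact/esym/ipC.
rewrite ipC h'; apply: (etrans (rmorphM _ _ _)).
exact: (congr2 *%R (conjcK c) (esym (ipC _ _))).
Qed.

End inner_product_extension.

Section multiplication.
Context d (Omega : measurableType d) (R : realType) (Pr : {measure set Omega -> \bar R}).
Local Open Scope complex_scope.

(* Multiplication by [h] is closed, so it agrees with a bounded operator on a
   closed span as soon as it does so on the generators. *)
Lemma mult_extension (h : Omega -> R[i]) (S : set (L2 Pr)) (T : L2 Pr -> L2 Pr) :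
  @iplinear _ (L2ip Pr) (L2ip Pr) (@ipspan _ (L2ip Pr) S) T ->
  @ipbounded _ (L2ip Pr) (L2ip Pr) (@ipspan _ (L2ip Pr) S) T ->
  (forall v, S v -> {ae Pr, forall w, h w * fun_of_L2 v w = fun_of_L2 (T v) w}) ->
  forall v, @ipspan _ (L2ip Pr) S v ->
    {ae Pr, forall w, h w * fun_of_L2 v w = fun_of_L2 (T v) w}.
Proof.
move=> lT bT TS; have sS := @ipspan_sub _ (L2ip Pr) S; have cS := @ipspan_closed _ (L2ip Pr) S.
pose K := [set v | @ipspan _ (L2ip Pr) S v /\
  {ae Pr, forall w, h w * fun_of_L2 v w = fun_of_L2 (T v) w}].
suff KS : @ipspan _ (L2ip Pr) S `<=` K by move=> v /KS[].
apply: (@ipspan_min _ (L2ip Pr)).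
- split.
    split; first exact: sS.1.
    have -> : T 0 = 0 by exact: (@iplinear0 _ (L2ip Pr) (L2ip Pr) _ T sS lT).
    by apply: filterS (fun_toL2 (sqintegrable0 Pr)) => w ->; rewrite mulr0.
  move=> a f g [Kf ef] [Kg eg]; split; first exact: sS.2.
  rewrite (lT a f g Kf Kg).
  have e1 := ae_and (fun_of_L2D (a *: f) g) (fun_of_L2Z a f).
  have e2 := ae_and (fun_of_L2D (a *: T f) (T g)) (fun_of_L2Z a (T f)).
  apply: filterS3 e1 e2 (ae_and ef eg) => w [h1 h2] [h3 h4] [h5 h6].
  apply: (etrans (congr1 ( *%R (h w)) h1)); apply: (etrans _ (esym h3)).
  by rewrite mulrDr h2 h4 mulrCA h5 h6.
- move=> f hf; have [fs [Kfs cf]] := @ipclosed_seq _ (L2ip Pr) _ f hf.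
  have Sfs n := (Kfs n).1; have Sf := @ipclosedP _ (L2ip Pr) _ _ _ cS Sfs cf; split => //.
  (* A first subsequence gives pointwise convergence of the vectors, a further one that of their
     images; both are needed to compare the limits at a point. *)
  have [s [hs sae]] := L2cvg_ae_subseq cf.
  have cT := @ipbounded_cvg _ (L2ip Pr) (L2ip Pr) _ T _ _ sS lT bT Sfs Sf cf.
  have cTs : L2cvg (fun n => T (fs (s n))) (T f).
    exact: (cvg_subseq_id hs cT).
  have [s' [hs' sae']] := L2cvg_ae_subseq cTs.
  have all_n : {ae Pr, forall w n, h w * fun_of_L2 (fs n) w = fun_of_L2 (T (fs n)) w}.
    by apply: ae_foralln => n; exact: (Kfs n).2.
  apply: filterS3 all_n sae sae' => w e c c'.
  apply: (Ccvg_unique _ c').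
  by apply: Ccvg_eq (CcvgM (Ccvg_cst (h w)) (cvg_subseq_id hs' c)) => n; exact: e.
- by move=> v Sv; split; [exact: (@ipspan_incl _ (L2ip Pr))|exact: TS].
Qed.

Definition pmul (u v : L2 Pr) : L2 Pr :=
  toL2 Pr (fun w => fun_of_L2 u w * fun_of_L2 v w).

(** [toL2] sends a function that is not square integrable to 0, so [pmul] is the genuine product
    only under this condition. *)
Definition sqint_mul (u v : L2 Pr) : Prop :=
  sqintegrable Pr (fun w => fun_of_L2 u w * fun_of_L2 v w).

Lemma pmulC u v : pmul u v = pmul v u.
Proof. by congr toL2; apply/funext => w; rewrite mulrC. Qed.

Lemma sqint_mulC u v : sqint_mul u v -> sqint_mul v u.
Proof. by rewrite /sqint_mul; congr sqintegrable; apply/funext => w; rewrite mulrC. Qed.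

Lemma Cmeas_mul (u v : L2 Pr) : Cmeas (fun w => fun_of_L2 u w * fun_of_L2 v w).
Proof. by apply: CmeasM; apply: (sqint_meas (mu := Pr)); exact: sqintegrable_L2. Qed.

Lemma pmul_ae u v x : {ae Pr, forall w, fun_of_L2 u w * fun_of_L2 v w = fun_of_L2 x w} ->
  sqint_mul u v /\ pmul u v = x.
Proof.
move=> e; have s : sqint_mul u v.
  by apply: (sqint_ae (Cmeas_mul u v) e); exact: sqintegrable_L2.
split => //; rewrite -[RHS]toL2K; apply: toL2_ae => //; exact: sqintegrable_L2.
Qed.

Lemma pmul_linear_l c u u' v : sqint_mul u v -> sqint_mul u' v ->
  pmul (c *: u + u') v = c *: pmul u v + pmul u' v.
Proof.
move=> s s'; apply: (proj2 (pmul_ae _)).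
have e1 := ae_and (fun_of_L2D (c *: u) u') (fun_of_L2Z c u).
have e2 := ae_and (fun_of_L2D (c *: pmul u v) (pmul u' v)) (fun_of_L2Z c (pmul u v)).
apply: filterS3 e1 e2 (ae_and (fun_toL2 s) (fun_toL2 s')) => w [h1 h2] [h3 h4] [h5 h6].
apply: (etrans (congr1 ( *%R^~ (fun_of_L2 v w)) h1)); apply: (etrans _ (esym h3)).
apply: (etrans _ (esym (congr2 +%R (etrans h4 (congr1 ( *%R c) h5)) h6))).
by rewrite h2 mulrDl mulrA.
Qed.

Lemma pmul_linear_r c u v v' : sqint_mul u v -> sqint_mul u v' ->
  pmul u (c *: v + v') = c *: pmul u v + pmul u v'.
Proof.
move=> /sqint_mulC s /sqint_mulC s'; rewrite [pmul u v]pmulC [pmul u v']pmulC pmulC.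
exact: pmul_linear_l.
Qed.

End multiplication.

Section independent_product.
Context (R : realType).
Context dY (Y : measurableType dY).
Context dO (Omega : measurableType dO).
Context (Pr : probability Omega R) (eta : R.-ker Omega ~> Y).
Context (lam : {sigma_finite_measure set Y -> \bar R}) (X : set Y) (ell : R[i] -> R[i]).
Hypotheses (cPr : measure_is_complete Pr) (poi : poisson_process Pr eta lam).
Hypotheses (mX : measurable X) (log : log_branch ell).
Local Open Scope complex_scope.
Local Notation Sigma_simple := (Sigma_simple X Pr eta ell).
Local Notation Sigma_span := (@Sigma_span R dY Y dO Omega Pr eta lam X ell).
Local Notation simple_on := (simple_on lam X).
Local Notation simpleS := (simpleS lam X).
Variables D1 D2 : set Y.
Hypothesis D12 : D1 `&` D2 = set0.
Local Notation K1 := (Sigma_span D1).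
Local Notation K2 := (Sigma_span D2).

Let disj f g y : simple_on D1 f -> simple_on D2 g -> f y = 0 \/ g y = 0.
Proof.
move=> [_ f0] [_ g0]; have [D1y|D1y] := pselect (D1 y); last by left; exact: f0.
right; apply: g0 => D2y; have : (D1 `&` D2) y by [].
by rewrite D12.
Qed.

Let simpleS_add f g : simple_on D1 f -> simple_on D2 g -> simpleS (fun y => f y + g y).
Proof.
move=> Sf Sg; have [[sf ff f0 f1] _] := Sf; have [[sg fg g0 g1] _] := Sg; split.
- exact: sqintegrableD.
- apply: (@sub_finite_set _ _ ((fun p => p.1 + p.2) @` (range f `*` range g))).
    by move=> _ [y _ <-]; exists (f y, g y) => //; split; exists y.
  by apply: finite_image; exact: finite_setX.
- by move=> y Xy; rewrite f0// g0// addr0.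
- move=> y Xy; case: (disj y Sf Sg) => ->; rewrite ?add0r ?addr0; [exact: g1|exact: f1].
Qed.

(** Independence in the form in which it is used: for disjoint supports the cross terms of
    [<f + g, f' + g'>] vanish, and the exponential kernel factors. *)
Let dot_simple_add f g f' g' : simple_on D1 f -> simple_on D2 g ->
  simple_on D1 f' -> simple_on D2 g' ->
  dot (Sigma_simple (fun y => f y + g y)) (Sigma_simple (fun y => f' y + g' y)) =
  dot (Sigma_simple f) (Sigma_simple f') * dot (Sigma_simple g) (Sigma_simple g').
Proof.
move=> Sf Sg Sf' Sg'.
apply: (etrans (dot_Sigma_simple cPr poi mX log (simpleS_add Sf Sg) (simpleS_add Sf' Sg'))).
apply: (etrans _ (esym (congr2 *%R (dot_Sigma_simple cPr poi mX log Sf.1 Sf'.1)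
  (dot_Sigma_simple cPr poi mX log Sg.1 Sg'.1)))).
apply: (etrans _ (cexpsD _ _)); apply: (congr1 (@cexps R)).
have [[[sf _ _ _] _] [[sg _ _ _] _]] := (Sf, Sg).
have [[[sf' _ _ _] _] [[sg' _ _ _] _]] := (Sf', Sg').
have [[s _ _ _] [s' _ _ _]] := (simpleS_add Sf Sg, simpleS_add Sf' Sg').
rewrite (dotE s s') (dotE sf sf') (dotE sg sg').
rewrite -(CintegralD (sqint_mul_Cintegrable sf sf') (sqint_mul_Cintegrable sg sg')).
congr (Cintegral _ _ _); apply/funext => y.
have key (a b c e : R[i]) : a = 0 \/ e = 0 -> c = 0 \/ b = 0 ->
    (a + b) * conjc (c + e) = a * conjc c + b * conjc e.
  have J0 : conjc (0 : R[i]) = 0 by exact: rmorph0.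
  by case=> ->; case=> ->; rewrite ?(addr0, add0r, mul0r)// J0 !mulr0 addr0.
by apply: key; exact: disj.
Qed.

Let range_span D (I := {f | simple_on D f}) :
  @ipspan _ (L2ip Pr) (range (fun i : I => Sigma_simple (sval i))) = Sigma_span D.
Proof.
apply: (congr1 (@ipspan _ (L2ip Pr))); apply/seteqP; split => [_ [i _ <-]|_ [f Sf <-]].
  by exists (sval i) => //; exact: svalP.
by exists (exist _ f Sf).
Qed.

(** By the factored kernel, sending the vector of [g] to that of [f + g] is an isometry up to the
    squared norm of the vector of [f]. Its extension is multiplication by that vector, by
    [mult_extension], so the products are square integrable. *)
Let pmul_simple f : simple_on D1 f ->
  (forall v, K2 v -> sqint_mul (Sigma_simple f) v) /\
  @ipbounded _ (L2ip Pr) (L2ip Pr) K2 (pmul (Sigma_simple f)).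
Proof.
move=> Sf; pose I := {g | simple_on D2 g}.
pose s (i : I) := Sigma_simple (sval i).
pose t (i : I) := Sigma_simple (fun y => f y + sval i y).
have st i j : dot (t i) (t j) = (L2norm (Sigma_simple f) ^+ 2)%:C * dot (s i) (s j).
  apply: (etrans (dot_simple_add Sf (svalP i) Sf (svalP j))).
  exact: (congr1 ( *%R^~ _) (dotff _)).
have [T [lT iT Ts]] := @isometric_extension _ (L2ip Pr) (L2ip Pr) I s t _ st (sqr_ge0 _).
rewrite range_span in lT iT; have bT := ipscaled_bounded iT.
have TE : forall v, K2 v ->
    {ae Pr, forall w, fun_of_L2 (Sigma_simple f) w * fun_of_L2 v w = fun_of_L2 (T v) w}.
  apply: (mult_extension lT bT) => _ [g Sg <-].
  rewrite (Ts (exist _ g Sg)).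
  apply: (Sigma_simpleM cPr poi mX log Sf.1 Sg.1) => y; exact: disj.
split=> [v Kv|]; first by have [] := pmul_ae (TE v Kv).
have [M hM] := bT; exists M => v Kv; have [_ ->] := pmul_ae (TE v Kv); exact: hM.
Qed.

Let pmul_simple_linear f : simple_on D1 f ->
  @iplinear _ (L2ip Pr) (L2ip Pr) K2 (pmul (Sigma_simple f)).
Proof.
by move=> /pmul_simple[h _] c v v' Kv Kv'; apply: pmul_linear_r; exact: h.
Qed.

Let pmul_simpleE f g : simple_on D1 f -> simple_on D2 g ->
  pmul (Sigma_simple f) (Sigma_simple g) = Sigma_simple (fun y => f y + g y).
Proof.
move=> Sf Sg; apply: (proj2 (pmul_ae _)).
by apply: (Sigma_simpleM cPr poi mX log Sf.1 Sg.1) => y; exact: disj.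
Qed.

Let dot_pmul_simple f f' : simple_on D1 f -> simple_on D1 f' ->
  forall v v', K2 v -> K2 v' ->
  dot (pmul (Sigma_simple f) v) (pmul (Sigma_simple f') v') =
  dot (Sigma_simple f) (Sigma_simple f') * dot v v'.
Proof.
move=> Sf Sf'.
apply: (@ip_extend _ (L2ip Pr) (L2ip Pr) [set Sigma_simple g | g in simple_on D2]
  (pmul (Sigma_simple f)) (pmul (Sigma_simple f'))).
- exact: pmul_simple_linear.
- exact: (pmul_simple Sf).2.
- exact: pmul_simple_linear.
- exact: (pmul_simple Sf').2.
move=> _ _ [g Sg <-] [g' Sg' <-].
apply: (etrans (congr2 (@dot _ _ _ Pr) (pmul_simpleE Sf Sg) (pmul_simpleE Sf' Sg'))).
exact: (dot_simple_add Sf Sg Sf' Sg').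
Qed.

(** The argument of [pmul_simple] in the other variable, now with any [v] in the second span:
    [dot_pmul_simple] provides the scaled isometry. *)
Let pmul_right v : K2 v -> (forall u, K1 u -> sqint_mul u v) /\
  @ipbounded _ (L2ip Pr) (L2ip Pr) K1 (fun u => pmul u v).
Proof.
move=> Kv; pose I := {f | simple_on D1 f}.
pose s (i : I) := Sigma_simple (sval i).
pose t (i : I) := pmul (Sigma_simple (sval i)) v.
have st i j : dot (t i) (t j) = (L2norm v ^+ 2)%:C * dot (s i) (s j).
  apply: (etrans (dot_pmul_simple (svalP i) (svalP j) Kv Kv)).
  apply: (etrans (mulrC _ _)); exact: (congr1 ( *%R^~ _) (dotff _)).
have [T [lT iT Ts]] := @isometric_extension _ (L2ip Pr) (L2ip Pr) I s t _ st (sqr_ge0 _).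
rewrite range_span in lT iT; have bT := ipscaled_bounded iT.
have TE : forall u, K1 u ->
    {ae Pr, forall w, fun_of_L2 v w * fun_of_L2 u w = fun_of_L2 (T u) w}.
  apply: (mult_extension lT bT) => _ [f Sf <-].
  rewrite (Ts (exist _ f Sf)).
  apply: filterS (fun_toL2 ((pmul_simple Sf).1 v Kv)) => w e.
  by apply: (etrans (mulrC _ _)); exact: esym.
split=> [u Ku|]; first by have [/sqint_mulC] := pmul_ae (TE u Ku).
have [M hM] := bT; exists M => u Ku; rewrite pmulC.
have [_ ->] := pmul_ae (TE u Ku); exact: hM.
Qed.

Lemma sqint_pmul u v : K1 u -> K2 v -> sqint_mul u v.
Proof. by move=> Ku Kv; exact: (pmul_right Kv).1. Qed.

Lemma dot_pmul u v u' v' : K1 u -> K2 v -> K1 u' -> K2 v' ->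
  dot (pmul u v) (pmul u' v') = dot u u' * dot v v'.
Proof.
move=> Ku Kv Ku' Kv'; have lin x : K2 x -> @iplinear _ (L2ip Pr) (L2ip Pr) K1 (fun u => pmul u x).
  by move=> Kx c f f' Kf Kf'; apply: pmul_linear_l; exact: sqint_pmul.
apply: (etrans (@ip_extend _ (L2ip Pr) (L2ip Pr) [set Sigma_simple f | f in simple_on D1]
  (fun u => pmul u v) (fun u => pmul u v') (dot v v') (lin v Kv) (pmul_right Kv).2
  (lin v' Kv') (pmul_right Kv').2 _ u u' Ku Ku')); last exact: mulrC.
move=> _ _ [f Sf <-] [f' Sf' <-].
apply: (etrans (dot_pmul_simple Sf Sf' Kv Kv')); exact: mulrC.
Qed.

Lemma pmul_Sigma_simple f g : simple_on D1 f -> simple_on D2 g ->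
  simpleS (fun y => f y + g y) /\
  pmul (Sigma_simple f) (Sigma_simple g) = Sigma_simple (fun y => f y + g y).
Proof. by move=> Sf Sg; split; [exact: simpleS_add|exact: pmul_simpleE]. Qed.

End independent_product.

(** * The multiplications and the measurable structures *)

Section tensor_maps.
Context (R : realType) (E F G : ipSpace R).
Local Open Scope complex_scope.

(* [m] induces an isometry on the tensor product of [K1] and [K2]. *)
Definition is_tensor (K1 : set E) (K2 : set F) (m : E -> F -> G) : Prop :=
  [/\ forall u, K1 u -> iplinear K2 (m u),
      forall v, K2 v -> iplinear K1 (fun u => m u v)
    & forall u v u' v', K1 u -> K2 v -> K1 u' -> K2 v' ->
        ip (m u v) (m u' v') = ip u u' * ip v v'].

Lemma kernel_cvg (xs : nat -> G) x : Ccvg (fun n => ip (xs n) (xs n)) (ip x x) ->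
  Ccvg (fun n => ip (xs n) x) (ip x x) -> ipcvg xs x.
Proof.
move=> h1 h2; apply: sqr_cvg0 => [n|]; first exact: ipnorm_ge0.
have [r1 _] := (CcvgP _ _).1 h1; have [r2 _] := (CcvgP _ _).1 h2.
have -> : (fun n => ipnorm (xs n - x) ^+ 2) = fun n =>
    (complex.Re (ip (xs n) (xs n)) - complex.Re (ip (xs n) x)) +
    (complex.Re (ip x x) - complex.Re (ip (xs n) x)).
  apply/funext => n; rewrite sqr_ipnorm ipBl !ipBr [ip x (xs n)]ipC.
  by rewrite !(cReD, cReN, cReJ); ring.
rewrite -[X in _ --> X](addr0 0); apply: cvgD.
  rewrite -(subrr (complex.Re (ip x x))); exact: cvgB.
by rewrite -(subrr (complex.Re (ip x x))); apply: cvgB => //; exact: cvg_cst.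
Qed.

(** Joint continuity: the inner products of the images factor and converge, which is enough by
    [kernel_cvg]. *)
Lemma is_tensor_cvg K1 K2 m us u vs v : is_tensor K1 K2 m ->
  (forall n, K1 (us n)) -> K1 u -> (forall n, K2 (vs n)) -> K2 v ->
  ipcvg us u -> ipcvg vs v -> ipcvg (fun n => m (us n) (vs n)) (m u v).
Proof.
move=> [_ _ ipm] Kus Ku Kvs Kv cu cv; apply: kernel_cvg.
  rewrite ipm//; have := CcvgM (ipcvg_ip cu cu) (ipcvg_ip cv cv).
  by under [X in _ -> Ccvg X _]funext do rewrite ipm//.
rewrite ipm//; have := CcvgM (ipcvg_ip cu (ipcvg_cst u)) (ipcvg_ip cv (ipcvg_cst v)).
by under [X in _ -> Ccvg X _]funext do rewrite ipm//.
Qed.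

Lemma is_tensor_bounded_r K1 K2 m u : is_tensor K1 K2 m -> K1 u -> ipbounded K2 (m u).
Proof.
move=> [_ _ ipm] Ku; apply: (ipscaled_bounded (r := ipnorm u ^+ 2)) => v v' Kv Kv'.
by rewrite ipm// ipff.
Qed.

Lemma is_tensor_bounded_l K1 K2 m v : is_tensor K1 K2 m -> K2 v ->
  ipbounded K1 (fun u => m u v).
Proof.
move=> [_ _ ipm] Kv; apply: (ipscaled_bounded (r := ipnorm v ^+ 2)) => u u' Ku Ku'.
by rewrite ipm// (ipff v) mulrC.
Qed.

Section spans.
Variables (S1 : set E) (S2 : set F).

(** With one argument fixed, both maps are bounded and linear in the other, so [ipspan_eq] applies
    to each variable in turn. *)
Lemma is_tensor_eq m m' : is_tensor (ipspan S1) (ipspan S2) m ->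
  is_tensor (ipspan S1) (ipspan S2) m' ->
  (forall u v, S1 u -> S2 v -> m u v = m' u v) ->
  forall u v, ipspan S1 u -> ipspan S2 v -> m u v = m' u v.
Proof.
move=> tm tm' mm' u v Su Sv; have [lr ll _] := tm; have [lr' ll' _] := tm'.
apply: (ipspan_eq (S := S1) (T := fun u => m u v) (T' := fun u => m' u v) (@ipspan_sub _ _ S1)) => //.
- exact: ll.
- exact: ll'.
- exact: is_tensor_bounded_l tm Sv.
- exact: is_tensor_bounded_l tm' Sv.
move=> u1 Su1; have Ku1 := ipspan_incl Su1.
apply: (ipspan_eq (S := S2) (T := m u1) (T' := m' u1) (@ipspan_sub _ _ S2)) => //.
- exact: lr.
- exact: lr'.
- exact: is_tensor_bounded_r tm Ku1.
- exact: is_tensor_bounded_r tm' Ku1.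
- by move=> v1; exact: mm'.
Qed.

Lemma bounded_span_image (H H' : ipSpace R) (S : set H) (T : H -> H') (K : set H') :
  iplinear (ipspan S) T -> ipbounded (ipspan S) T -> ipsub K -> ipclosed K ->
  (forall v, S v -> K (T v)) -> forall v, ipspan S v -> K (T v).
Proof.
move=> lT bT sK cK KS; have sS := @ipspan_sub _ _ S; have cS := @ipspan_closed _ _ S.
suff h : ipspan S `<=` [set v | ipspan S v /\ K (T v)] by move=> v /h[].
apply: ipspan_min.
- split; first by split; [exact: sS.1|rewrite (iplinear0 sS lT); exact: sK.1].
  by move=> c f g [Sf Kf] [Sg Kg]; split; [exact: sS.2|rewrite lT//; exact: sK.2].
- move=> f hf; have [fs [Kfs cf]] := ipclosed_seq hf.
  have Sfs n := (Kfs n).1; have Sf := ipclosedP cS Sfs cf; split => //.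
  by apply: (ipclosedP cK _ (ipbounded_cvg sS lT bT Sfs Sf cf)) => n; exact: (Kfs n).2.
- by move=> v Sv; split; [exact: ipspan_incl|exact: KS].
Qed.

End spans.

Lemma is_tensor_in (S1 : set E) (S2 : set F) (K : set G) m :
  is_tensor (ipspan S1) (ipspan S2) m -> ipsub K -> ipclosed K ->
  (forall u v, S1 u -> S2 v -> K (m u v)) ->
  forall u v, ipspan S1 u -> ipspan S2 v -> K (m u v).
Proof.
move=> tm sK cK KS u v Su Sv; have [lr ll _] := tm.
apply: (bounded_span_image (T := fun u => m u v) (ll v Sv) (is_tensor_bounded_l tm Sv)) => //.
move=> u1 Su1; have Ku1 := ipspan_incl Su1.
apply: (bounded_span_image (lr u1 Ku1) (is_tensor_bounded_r tm Ku1)) => //.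
by move=> v1; exact: KS.
Qed.

End tensor_maps.

Lemma ipisometric_dist (R : realType) (E F : ipSpace R) (K : set E) (T : E -> F) f g :
  ipisometric K T -> K f -> K g -> ipnorm (T f - T g) = ipnorm (f - g).
Proof.
by move=> iT Kf Kg; rewrite /ipnorm !ipBl !ipBr !iT.
Qed.

Section traces.
Context (R : realType) (n : nat).
Context d1 (T1 : measurableType d1) d2 (T2 : measurableType d2).
Context (mu1 : {measure set T1 -> \bar R}) (mu2 : {measure set T2 -> \bar R}).
Local Notation gen1 := [set A `*` U | A in (@open 'rV[R]_n) & U in @L2open _ _ _ mu1].
Local Notation gen2 := [set A `*` U | A in (@open 'rV[R]_n) & U in @L2open _ _ _ mu2].

(** The sets whose preimage has a measurable trace form a sigma-algebra, so products of open sets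
    suffice. It serves for the isometry and for its inverse, which gives both halves of the Borel
    isomorphism. *)
Lemma trace_preimage (K : set (L2 mu1)) (T : L2 mu1 -> L2 mu2)
    (tot : set ('rV[R]_n * L2 mu1)) :
  (forall f g, K f -> K g -> L2norm (T f - T g) = L2norm (f - g)) ->
  (forall p, tot p -> K p.2) ->
  forall M, <<s gen2 >> M ->
  exists2 M', <<s gen1 >> M' & (fun p => (p.1, T p.2)) @^-1` M `&` tot = M' `&` tot.
Proof.
move=> iT Ktot; pose tr (p : 'rV[R]_n * L2 mu1) := (p.1, T p.2).
apply: smallest_sub.
  split.
  - by exists set0; [exact: sigma_algebra0|rewrite preimage_set0].
  - move=> M [M' gM' e]; exists (~` M'); first by rewrite -setTD; exact: sigma_algebraCD.
    apply/seteqP; split => p /= [h tp]; split => //.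
      by move=> M'p; case: h => _; apply; have : (M' `&` tot) p by []; rewrite -e => -[].
    by split => // Mp; apply: h; have : (tr @^-1` M `&` tot) p by []; rewrite e => -[].
  - move=> M hM.
    have /choice[M' hM'] : forall k, exists M', <<s gen1 >> M' /\ tr @^-1` M k `&` tot = M' `&` tot.
      by move=> k; have [M' ? ?] := hM k; exists M'.
    exists (\bigcup_k M' k); first by apply: sigma_algebra_bigcup => k; exact: (hM' k).1.
    rewrite preimage_bigcup !setI_bigcupl; apply: eq_bigcupr => k _; exact: (hM' k).2.
move=> _ [A oA [U oU <-]].
(* [T] is controlled only on [K], so the preimage of [U] need not be open; this union of balls
   centred in [K] is open and meets [K] in the same points. *)
pose U' : set (L2 mu1) := [set f | exists f0 r, [/\ K f0, 0 < r, L2norm (f - f0) < r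
  & forall g, L2norm (g - T f0) < r -> U g]].
exists (A `*` U').
  apply: sub_sigma_algebra; exists A => //; exists U' => //.
  move=> f [f0 [r [Kf0 r0 fr hU]]]; exists (r - L2norm (f - f0)); first by rewrite subr_gt0.
  move=> g gf; exists f0, r; split; [exact: Kf0|exact: r0| |exact: hU].
  apply: (le_lt_trans (@ipnorm_triangle _ (L2ip mu1) f g f0)).
  by rewrite -ltrBrDr.
apply/seteqP; split => [[x f] /= [[Ax UTf] tp]|[x f] /= [[Ax [f0 [r [Kf0 r0 fr hU]]]] tp]].
  split => //; split => //; have [r r0 hr] := oU _ UTf.
  have Kf := Ktot _ tp; exists f, r; split => //.
  have -> : f - f = 0 by exact: subrr.
  by rewrite L2norm0.
split => //; split => //; apply: hU.
by rewrite iT//; exact: (Ktot _ tp).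
Qed.

End traces.

(** * The isometric representation and the kernels of its adjoints *)

Section translation_isometry.
Context (R : realType) (n : nat).
Context dY (Y : measurableType dY) (act : 'rV[R]_n -> Y -> Y).
Context (lam : {sigma_finite_measure set Y -> \bar R}) (X : set Y).
Hypothesis mX : measurable X.
Hypothesis mact : measurable_action act.
Hypothesis inv : forall a B, measurable B -> lam (translate act a B) = lam B.
Local Open Scope complex_scope.
Local Notation shf := (translate_fun act).
Local Notation V := (translation act lam X).

Let L2norm_of_eq (u v : L2 lam) : u = v -> L2norm (u - v) = 0.
Proof. by move=> ->; rewrite (_ : v - v = 0); [exact: L2norm0|exact: subrr]. Qed.

Let L2eq_of_norm (u v : L2 lam) : L2norm (u - v) = 0 -> u = v.
Proof. by move=> /L2norm_eq0/eqP; rewrite subr_eq0 => /eqP. Qed.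

Lemma shf_dist a f g : sqintegrable lam f -> sqintegrable lam g ->
  L2norm (toL2 lam (shf a f) - toL2 lam (shf a g)) = L2norm (toL2 lam f - toL2 lam g).
Proof.
move=> sf sg; have s := sqintB sf sg.
apply: (congr1 (fun z => Num.sqrt (complex.Re z))).
have e : toL2 lam f - toL2 lam g = toL2 lam (fun y => f y - g y) by exact/esym/toL2B.
have e' : toL2 lam (shf a f) - toL2 lam (shf a g) = toL2 lam (shf a (fun y => f y - g y)).
  apply/esym; exact: (toL2B (sqint_shf mact inv a sf) (sqint_shf mact inv a sg)).
rewrite e e'; exact: dot_shf.
Qed.

(** Translation of functions passes to classes because it preserves the L^2 distance. *)
Lemma toL2_shf_eq a f g : sqintegrable lam f -> sqintegrable lam g ->
  toL2 lam f = toL2 lam g -> toL2 lam (shf a f) = toL2 lam (shf a g).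
Proof.
move=> sf sg e; have h := shf_dist a sf sg.
exact: L2eq_of_norm (etrans h (L2norm_of_eq e)).
Qed.

Definition cut (f : L2 lam) (y : Y) : R[i] := if y \in X then fun_of_L2 f y else 0.

Lemma cutE f y : cut f y = (\1_X y : R)%:C * fun_of_L2 f y.
Proof. by rewrite /cut indicE; case: (y \in X); rewrite ?mul1r ?mul0r. Qed.

Lemma sqint_cut f : sqintegrable lam (cut f).
Proof.
apply: (sqint_le (g := fun_of_L2 f)); last exact: sqintegrable_L2.
  have -> : cut f = fun y => (\1_X y : R)%:C * fun_of_L2 f y.
    by apply/funext => y; exact: cutE.
  by apply: CmeasM; [exact: Cmeas_indic|apply: (sqint_meas (mu := lam)); exact: sqintegrable_L2].
by move=> y; rewrite /cut; case: ifP => // _; rewrite modc0 modc_ge0.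
Qed.

Lemma toL2_cut f : L2on lam X f -> toL2 lam (cut f) = f.
Proof.
move=> Xf; rewrite -[RHS]toL2K; apply: toL2_ae; [exact: sqint_cut|exact: sqintegrable_L2|].
apply: filterS Xf => y h; rewrite /cut; have [Xy|Xy] := pselect (X y).
  by rewrite mem_set.
by rewrite memNset// h.
Qed.

Lemma translation_cut a f : V a f = toL2 lam (shf a (cut f)).
Proof. by []. Qed.

Lemma translation_toL2 a f : sqintegrable lam f -> (forall y, ~ X y -> f y = 0) ->
  V a (toL2 lam f) = toL2 lam (shf a f).
Proof.
move=> sf f0; apply: (toL2_shf_eq a (sqint_cut _) sf).
by apply: toL2_cut; exact: L2on_toL2.
Qed.

Lemma translation_dist a f g : L2on lam X f -> L2on lam X g ->
  L2norm (V a f - V a g) = L2norm (f - g).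
Proof.
move=> Xf Xg; rewrite !translation_cut; apply: (etrans (shf_dist a (sqint_cut f) (sqint_cut g))).
by rewrite (toL2_cut Xf) (toL2_cut Xg).
Qed.

Lemma L2on_translation a f : L2on lam (translate act a X) (V a f).
Proof.
rewrite translation_cut; apply: L2on_toL2; first exact: (sqint_shf mact inv a (sqint_cut f)).
by move=> y; rewrite (translateE mact) => /= h; rewrite /translate_fun /cut memNset.
Qed.

Lemma ker_adjoint_translation a : ker_adjoint (L2on lam X) V a = L2on lam (X `\` translate act a X).
Proof.
have mXa : measurable (translate act a X) by exact: measurable_translate.
apply/seteqP; split => f; last first.
  move=> fD; split; first by apply: L2onS fD => y [].
  move=> g Xg; have d0 : dot g (0 : L2 lam) = 0 by exact: (@ip0r _ (L2ip lam)).
  rewrite d0; have sV := sqint_shf mact inv a (sqint_cut g).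
  rewrite -[f]toL2K translation_cut (dotE sV (sqintegrable_L2 f)).
  rewrite -[RHS](Cintegral0 lam); apply: Cintegral_ae.
  - apply: CmeasM; first exact: sqint_meas sV.
    by apply: CmeasJ; apply: (sqint_meas (mu := lam)); exact: sqintegrable_L2.
  - exact: Cmeas_cst.
  apply: filterS fD => y h; rewrite /translate_fun /cut; case: ifPn => [/set_mem Xy|_]; last by rewrite mul0r.
  rewrite h ?rmorph0 ?mulr0// => -[_]; apply; by rewrite (translateE mact).
move=> [Xf orth]; pose h y := (\1_(translate act a X) y : R)%:C * fun_of_L2 f y.
have sf := sqintegrable_L2 f.
have sh : sqintegrable lam h.
  apply: (sqint_le (g := fun_of_L2 f)) => //.
    by apply: CmeasM; [exact: Cmeas_indic|exact: sqint_meas sf].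
  move=> y; rewrite /h modcM modc_real indicE; case: (_ \in _).
    by rewrite normr1 mul1r.
  by rewrite normr0 mul0r modc_ge0.
(* The test vector: translating the part [h] of [f] on the translate of [X] back into [X] gives
   [V a g = h], and orthogonality to [f] forces [<h, h> = 0]. *)
pose g := shf (- a) h.
have sg : sqintegrable lam g by exact: sqint_shf.
have g0 y : ~ X y -> g y = 0.
  move=> Xy; rewrite /g /translate_fun /h indicE (mem_translate mact) opprK (actK mact).
  by rewrite memNset// mul0r.
have shg : shf a g = h.
  by apply/funext => y; rewrite /g /translate_fun opprK (actNK mact).
have := orth (toL2 lam g) (L2on_toL2 sg g0).
have -> : dot (toL2 lam g) (0 : L2 lam) = 0 by exact: (@ip0r _ (L2ip lam)).
rewrite (translation_toL2 a sg g0) shg => e.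
have hh : dot (toL2 lam h) (toL2 lam h) = 0.
  apply: (etrans _ e); rewrite -[in RHS](toL2K f) (dotE sh sh) (dotE sh sf).
  congr (Cintegral _ _ _); apply/funext => y; rewrite /h indicE.
  by case: (_ \in _); rewrite ?mul1r ?mul0r.
have h0 : toL2 lam h = 0.
  apply: L2norm_eq0; apply/eqP; rewrite /L2norm hh sqrtr_eq0//.
have aeh : {ae lam, forall y, h y = 0}.
  apply: (toL2_inj sh (sqintegrable0 lam)); rewrite h0; exact/esym/toL20.
apply: filterS2 aeh Xf => y hy fX nD; have [Xy|Xy] := pselect (X y); last exact: fX.
have Xay : translate act a X y by apply: contrapT => Xay; apply: nD.
by move: hy; rewrite /h indicE mem_set// mul1r.
Qed.

End translation_isometry.

(** * Comparison of the two multiplications *)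

Section multiplications.
Context (R : realType) (n : nat).
Context dY (Y : measurableType dY) (act : 'rV[R]_n -> Y -> Y).
Context dO (Omega : measurableType dO).
Context (Pr : probability Omega R) (eta : R.-ker Omega ~> Y).
Context (lam : {sigma_finite_measure set Y -> \bar R}) (X : set Y) (ell : R[i] -> R[i]).
Hypotheses (cPr : measure_is_complete Pr) (poi : poisson_process Pr eta lam).
Hypotheses (mX : measurable X) (log : log_branch ell).
Hypothesis mact : measurable_action act.
Hypothesis inv : forall a B, measurable B -> lam (translate act a B) = lam B.
Local Open Scope complex_scope.
Local Notation FM := (fock_measure lam).
Local Notation Sigma_simple := (Sigma_simple X Pr eta ell).
Local Notation Sigma_span := (@Sigma_span R dY Y dO Omega Pr eta lam X ell).
Local Notation simple_on := (simple_on lam X).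
Local Notation simpleS := (simpleS lam X).
Local Notation FX := (fock (L2on lam X)).
Local Notation V := (translation act lam X).
Local Notation shf := (translate_fun act).

Variable T : L2 FM -> L2 Pr.
Hypothesis lT : @iplinear _ (L2ip FM) (L2ip Pr) FX T.
Hypothesis iT : @ipisometric _ (L2ip FM) (L2ip Pr) FX T.
Hypothesis Ts : forall f, simpleS f -> T (expvec (toL2 lam f)) = Sigma_simple f.

Let sFX : @ipsub _ (L2ip FM) FX. Proof. exact: fock_L2on_sub. Qed.

Let T_inj F G : FX F -> FX G -> T F = T G -> F = G.
Proof. exact: (@ipisometric_inj _ (L2ip FM) (L2ip Pr) _ T _ _ sFX lT iT). Qed.

Let TX : T @` FX = Sigma_span X. Proof. exact: fock_Sigma_image. Qed.

Definition Tinv (x : L2 Pr) : L2 FM := xget 0 [set F | FX F /\ T F = x].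

Lemma TinvP x : Sigma_span X x -> FX (Tinv x) /\ T (Tinv x) = x.
Proof.
rewrite -TX => -[F FF Fx]; have : exists F, FX F /\ T F = x by exists F.
by move=> /(xgetPex 0).
Qed.

Lemma TinvK F : FX F -> Tinv (T F) = F.
Proof.
move=> FF; have [] := @TinvP (T F); first by rewrite -TX; exists F.
by move=> h1 h2; exact: T_inj.
Qed.

Section pair.
Variables a b : 'rV[R]_n.
Hypothesis aX : translate act a X `<=` X.
Let Da := X `\` translate act a X.
Let Db := X `\` translate act b X.
Let D2 := translate act a Db.
Let S := @Defs.shift R n dY Y act X dO Omega Pr eta a 0 b.
Local Notation FA := (fock (L2on lam Da)).
Local Notation FB := (fock (L2on lam Db)).

Let DaX : Da `<=` X. Proof. by move=> y []. Qed.
Let DbX : Db `<=` X. Proof. by move=> y []. Qed.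
Let D2X : D2 `<=` X. Proof. by apply: subset_trans aX; exact: translateSS. Qed.
Let mDa : measurable Da. Proof. by apply: measurableD => //; exact: measurable_translate. Qed.
Let mDb : measurable Db. Proof. by apply: measurableD => //; exact: measurable_translate. Qed.

Let D12 : Da `&` D2 = set0.
Proof.
by apply/seteqP; split => // y [[_ nay]] D2y; apply: nay; move: y D2y; exact: translateSS.
Qed.

Let FAX : FA `<=` FX. Proof. exact: fock_L2onS. Qed.
Let FBX : FB `<=` FX. Proof. exact: fock_L2onS. Qed.

Let TA F : FA F -> Sigma_span Da (T F).
Proof. by move=> FF; rewrite -(fock_Sigma_image lT iT Ts DaX mDa); exists F. Qed.

Let TB F : FB F -> Sigma_span Db (T F).
Proof. by move=> FF; rewrite -(fock_Sigma_image lT iT Ts DbX mDb); exists F. Qed.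

Let S_spec : [/\ @iplinear _ (L2ip Pr) (L2ip Pr) (Sigma_span Db) S,
  @ipisometric _ (L2ip Pr) (L2ip Pr) (Sigma_span Db) S
  & forall x, Sigma_span Db x -> Sigma_span D2 (S x)].
Proof.
have [[im lin iso] _] := is_shiftP cPr poi mX log mact inv b aX.
have E1 : translate act 0 X `\` translate act b X = Db by rewrite (translate0 mact).
have E2 : translate act (0 + a) X `\` translate act (b + a) X = D2.
  by rewrite /D2 /Db translate_setD// -!translateD// add0r [b + a]addrC.
rewrite /sigma_interval E1 E2 in im lin iso.
rewrite !(L2sub_sigma_eta cPr poi mX log mact inv)// in im lin iso.
by split => // x Kx; rewrite -im; exists x.
Qed.

Definition poisson_mul (F G : L2 FM) : L2 Pr := eta_mul act X eta a b (T F) (T G).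

Let pmE F G : poisson_mul F G = pmul (T F) (S (T G)). Proof. by []. Qed.

Let sq F G : FA F -> FB G -> sqint_mul (T F) (S (T G)).
Proof.
move=> FF FG; have [_ _ SD] := S_spec.
exact: (sqint_pmul cPr poi mX log D12 (TA FF) (SD _ (TB FG))).
Qed.

Lemma poisson_mul_tensor : @is_tensor _ (L2ip FM) (L2ip FM) (L2ip Pr) FA FB poisson_mul.
Proof.
have [lS iS SD] := S_spec; split.
- move=> F FF c G G' FG FG'; rewrite !pmE.
  rewrite (lT c (FBX FG) (FBX FG')); apply: (etrans (congr1 (pmul _) (lS c _ _ (TB FG) (TB FG')))).
  by apply: pmul_linear_r; exact: sq.
- move=> G FG c F F' FF FF'; rewrite !pmE (lT c (FAX FF) (FAX FF')).
  by apply: pmul_linear_l; exact: sq.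
- move=> F G F' G' FF FG FF' FG'.
  apply: (etrans (dot_pmul cPr poi mX log D12 (TA FF) (SD _ (TB FG)) (TA FF') (SD _ (TB FG')))).
  exact: (congr2 *%R (iT (FAX FF) (FAX FF')) (etrans (iS _ _ (TB FG) (TB FG')) (iT (FBX FG) (FBX FG')))).
Qed.

Let poisson_mul_simple f g : simple_on Da f -> simple_on Db g ->
  simpleS (fun y => f y + shf a g y) /\
  poisson_mul (expvec (toL2 lam f)) (expvec (toL2 lam g)) =
    Sigma_simple (fun y => f y + shf a g y).
Proof.
move=> Sf Sg; have Sg' : simple_on D2 (shf a g) by exact: simple_on_shf.
have [h1 h2] := pmul_Sigma_simple cPr poi mX log D12 Sf Sg'; split => //.
rewrite pmE (Ts Sf.1) (Ts Sg.1) /S.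
by rewrite (shift_Sigma_simple cPr poi mX log mact inv aX Sg).
Qed.

(** This places the products in the range of [T], so that [Tinv] can pull them back to the Fock
    space. *)
Lemma poisson_mul_in F G : FA F -> FB G -> Sigma_span X (poisson_mul F G).
Proof.
have := poisson_mul_tensor; rewrite (fock_simple lam DaX mDa) (fock_simple lam DbX mDb) => tm FF FG.
apply: (is_tensor_in tm _ _ _ FF FG); [exact: Sigma_span_sub|exact: Sigma_span_closed|].
move=> _ _ [f Sf <-] [g Sg <-]; have [h ->] := poisson_mul_simple Sf Sg.
by apply: (@ipspan_incl _ (L2ip Pr)); exists (fun y => f y + shf a g y) => //; exact: simpleS_on.
Qed.

(** For simple functions both sides are the vector Sigma of [f] plus the translate of [g]; both
    depend continuously on [xi] and [zeta], since [V a] is isometric. *)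
Lemma poisson_mul_expvec xi zeta : L2on lam Da xi -> L2on lam Db zeta ->
  FX (expvec (xi + V a zeta)) /\
  T (expvec (xi + V a zeta)) = poisson_mul (expvec xi) (expvec zeta).
Proof.
move=> Dxi Dzeta; have XA := @L2onS _ _ _ lam _ _ DaX; have XB := @L2onS _ _ _ lam _ _ DbX.
have XV z : L2on lam X (V a z).
  by apply: L2onS (L2on_translation mX mact inv a z); exact: aX.
have [Xxi Xzeta] := (XA _ Dxi, XB _ Dzeta).
have XS u v : L2on lam X u -> L2on lam X v -> L2on lam X (u + v).
  have := L2on_subspace lam X; exact: (@ipsubD _ (L2ip lam)).
have FXs : FX (expvec (xi + V a zeta)) by apply: expvec_fock; exact: XS.
split => //.
have [fs [Sfs cfs]] := simple_on_dense DaX mDa Dxi.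
have [gs [Sgs cgs]] := simple_on_dense DbX mDb Dzeta.
have Df k : L2on lam Da (toL2 lam (fs k)).
  have [[sf _ _ _] f0] := Sfs k; exact: L2on_toL2.
have Dg k : L2on lam Db (toL2 lam (gs k)).
  have [[sg _ _ _] g0] := Sgs k; exact: L2on_toL2.
have c1 := @is_tensor_cvg _ (L2ip FM) (L2ip FM) (L2ip Pr) _ _ _ _ _ _ _ poisson_mul_tensor
  (fun k => expvec_fock (Df k)) (expvec_fock Dxi) (fun k => expvec_fock (Dg k))
  (expvec_fock Dzeta) (expvec_cvg cfs) (expvec_cvg cgs).
have cV : L2cvg (fun k => V a (toL2 lam (gs k))) (V a zeta).
  have e : (fun k => L2norm (V a (toL2 lam (gs k)) - V a zeta)) =
      fun k => L2norm (toL2 lam (gs k) - zeta).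
    by apply/funext => k; exact: (translation_dist mX mact inv a (XB _ (Dg k)) Xzeta).
  by rewrite /L2cvg e.
have cS : L2cvg (fun k => toL2 lam (fs k) + V a (toL2 lam (gs k))) (xi + V a zeta).
  exact: (@ipcvgD _ (L2ip lam) _ _ _ _ cfs cV).
have c2 := @ipbounded_cvg _ (L2ip FM) (L2ip Pr) _ T _ _ sFX lT (ipisometric_bounded iT)
  (fun k => expvec_fock (XS _ _ (XA _ (Df k)) (XV (toL2 lam (gs k))))) FXs (expvec_cvg cS).
have e : (fun k => poisson_mul (expvec (toL2 lam (fs k))) (expvec (toL2 lam (gs k)))) =
    T \o (fun k => expvec (toL2 lam (fs k) + V a (toL2 lam (gs k)))).
  apply/funext => k; have [Sk ek] := poisson_mul_simple (Sfs k) (Sgs k).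
  apply: (etrans ek); apply: (etrans (esym (Ts Sk))).
  apply: (congr1 (fun x => T (expvec x))).
  have [[sf _ _ _] f0] := Sfs k; have [[sg _ g0 _] _] := Sgs k.
  apply: (etrans (toL2D sf (sqint_shf mact inv a sg))).
  exact: (congr1 _ (esym (translation_toL2 mX mact inv a sg g0))).
have c1' := eq_ind _ (fun us => @ipcvg _ (L2ip Pr) us _) c1 _ e.
exact: (@ipcvg_unique _ (L2ip Pr) _ _ _ c2 c1').
Qed.

Let m0 F G := Tinv (poisson_mul F G).

Let m0P F G : FA F -> FB G -> FX (m0 F G) /\ T (m0 F G) = poisson_mul F G.
Proof. by move=> FF FG; apply: TinvP; exact: poisson_mul_in. Qed.

Let m0_tensor : @is_tensor _ (L2ip FM) (L2ip FM) (L2ip FM) FA FB m0.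
Proof.
have [lr ll ipm] := poisson_mul_tensor.
have sA : @ipsub _ (L2ip FM) FA by exact: fock_L2on_sub.
have sB : @ipsub _ (L2ip FM) FB by exact: fock_L2on_sub.
split.
- move=> F FF c G G' FG FG'.
  have [h1 e1] := m0P FF FG; have [h2 e2] := m0P FF FG'.
  have [h3 e3] := m0P FF (sB.2 c _ _ FG FG').
  apply: T_inj => //; first exact: sFX.2.
  apply: (etrans e3); apply: (etrans (lr F FF c _ _ FG FG')).
  apply: (etrans _ (esym (lT c h1 h2))).
  by rewrite e1 e2.
- move=> G FG c F F' FF FF'.
  have [h1 e1] := m0P FF FG; have [h2 e2] := m0P FF' FG.
  have [h3 e3] := m0P (sA.2 c _ _ FF FF') FG.
  apply: T_inj => //; first exact: sFX.2.
  apply: (etrans e3); apply: (etrans (ll G FG c _ _ FF FF')).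
  apply: (etrans _ (esym (lT c h1 h2))).
  by rewrite e1 e2.
- move=> F G F' G' FF FG FF' FG'.
  have [h1 e1] := m0P FF FG; have [h2 e2] := m0P FF' FG'.
  apply: (etrans (esym (iT h1 h2))); rewrite e1 e2; exact: ipm.
Qed.

(** [ccr_mul] is chosen among the maps satisfying [is_ccr_mul]. The pulled-back product [m0] is one,
    so the chosen map satisfies them too, and [is_tensor_eq] makes the two agree on the fibres,
    which exponential vectors span. *)
Lemma ccr_mulE F G : FA F -> FB G ->
  T (ccr_mul (L2on lam X) V a b F G) = poisson_mul F G.
Proof.
move=> FF FG; have Ka := ker_adjoint_translation mX mact inv a.
have Kb := ker_adjoint_translation mX mact inv b.
have m0_ccr : is_ccr_mul (L2on lam X) V a b m0.
  have [lr ll ipm] := m0_tensor; rewrite /is_ccr_mul /ccr_fibre Ka Kb; split => //.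
  move=> xi zeta Dxi Dzeta; have [h e] := poisson_mul_expvec Dxi Dzeta.
  have [h' e'] := m0P (expvec_fock Dxi) (expvec_fock Dzeta).
  by apply: T_inj => //; rewrite e'.
have : is_ccr_mul (L2on lam X) V a b (ccr_mul (L2on lam X) V a b).
  by apply: xgetPex; exists m0.
rewrite /is_ccr_mul /ccr_fibre Ka Kb => -[lr ll ipm mexp].
suff -> : ccr_mul (L2on lam X) V a b F G = m0 F G by exact: (m0P FF FG).2.
have tm : @is_tensor _ (L2ip FM) (L2ip FM) (L2ip FM) FA FB (ccr_mul (L2on lam X) V a b).
  by split.
have t0 := m0_tensor; move: tm t0 FF FG; rewrite !fock_L2on => tm t0 FF FG.
apply: (is_tensor_eq tm t0 _ FF FG) => _ _ [xi Dxi <-] [zeta Dzeta <-].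
apply: (etrans (mexp xi zeta Dxi Dzeta)); have [h e] := poisson_mul_expvec Dxi Dzeta.
have [h' e'] := m0P (expvec_fock Dxi) (expvec_fock Dzeta).
by apply: T_inj => //; rewrite e'.
Qed.

End pair.
End multiplications.

Theorem proposition4p1 (R : realType) (n : nat) (P : set 'rV[R]_n)
    (dY : measure_display) (Y : measurableType dY) (act : 'rV[R]_n -> Y -> Y)
    (lam : {sigma_finite_measure set Y -> \bar R}) (X : set Y)
    (dO : measure_display) (Omega : measurableType dO)
    (Pr : probability Omega R) (eta : R.-ker Omega ~> Y)
    (ell : R[i] -> R[i]) :
  closed_convex_cone P ->
  [set p - q | p in P & q in P] = setT ->
  P `&` [set - p | p in P] = [set 0] ->
  (exists C : nat -> set Y, @measurable dY Y = <<s range C >>) ->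
  measurable_action act ->
  (forall a B, measurable B -> lam (translate act a B) = lam B) ->
  measurable X ->
  (forall a, P a -> translate act a X `<=` X) ->
  \bigcap_(a in P) translate act a X = set0 ->
  measure_is_complete Pr ->
  poisson_process Pr eta lam ->
  @measurable dO Omega = sigma_eta Pr eta setT ->
  log_branch ell ->
  let E := eta_prodsys act X Pr eta in
  let F := ccr_prodsys (L2on lam X) (translation act lam X) in
  exists Theta : 'rV[R]_n -> L2 (ps_measure F) -> L2 (ps_measure E),
    [/\ ps_iso P Theta,
        forall a f, P a -> L2on lam (X `\` translate act a X) f ->
          Theta a (expvec f) = Sigma lam X Pr eta ell f
      & forall a (S : L2 (ps_measure F) -> L2 (ps_measure E)), P a ->
          linear_on (@ps_fibre R n F a) S -> bounded_on (@ps_fibre R n F a) S ->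
          (forall f, L2on lam (X `\` translate act a X) f ->
             S (expvec f) = Sigma lam X Pr eta ell f) ->
          forall G, @ps_fibre R n F a G -> S G = Theta a G].
Proof.
move=> _ _ _ _ mact inv mX PX _ cPr poi _ log E F.
have [T [lT iT Ts]] := Theta_exists cPr poi mX log.
pose D a := X `\` translate act a X.
have DX a : D a `<=` X by move=> y [].
have mD a : measurable (D a) by apply: measurableD => //; exact: measurable_translate.
have fF a : @ps_fibre R n F a = fock (L2on lam (D a)).
  rewrite /F /= /ccr_fibre; congr fock; exact: ker_adjoint_translation.
have fE a : @ps_fibre R n E a = @Sigma_span R dY Y dO Omega Pr eta lam X ell (D a).
  rewrite /E /= /eta_fibre /sigma_interval (translate0 mact).
  exact: (L2sub_sigma_eta cPr poi mX log mact inv (DX a)).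
have FX a : fock (L2on lam (D a)) `<=` fock (L2on lam X) by exact: fock_L2onS.
have TD a := fock_Sigma_image lT iT Ts (DX a) (mD a).
have TX := fock_Sigma_image lT iT Ts (@subset_refl _ X) mX.
have DS a : @Sigma_span R dY Y dO Omega Pr eta lam X ell (D a) `<=` @Sigma_span R dY Y dO Omega Pr eta lam X ell X.
  by rewrite -(TD a) -TX; exact: image_subset.
have tT p : @ps_total R n P F p -> @ps_total R n P E (p.1, T p.2).
  move=> [Pa]; rewrite fF => Fp.
  have h : @ps_fibre R n E p.1 (T p.2) by rewrite fE -TD; exists p.2.
  by split.
have tTinv p : @ps_total R n P E p -> @ps_total R n P F (p.1, Tinv X T p.2).
  move=> [Pa]; rewrite fE -TD => -[f Ff fp].
  have h : @ps_fibre R n F p.1 (Tinv X T p.2).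
    by rewrite fF -fp (TinvK mX lT iT Ts)//; exact: (FX _ _ Ff).
  by split.
exists (fun _ => T); split.
- split.
  + move=> a Pa; rewrite fF fE; split; first exact: TD.
      by move=> c f g Ff Fg; apply: lT; exact: (FX a).
    by move=> f g Ff Fg; apply: iT; exact: (FX a).
  + move=> a b f g Pa Pb; rewrite !fF => Ff Fg.
    exact: (ccr_mulE cPr poi mX log mact inv lT iT Ts (PX a Pa) Ff Fg).
  + move=> W [M sM ->].
    have [M' sM' e] := @trace_preimage R n _ _ _ _ _ _ _ T (@ps_total R n P F)
      (fun f g Kf Kg => ipisometric_dist iT Kf Kg)
      (fun p tp => FX p.1 _ (eq_ind _ (fun K : set _ => K p.2) tp.2 _ (fF p.1))) M sM.
    exists M' => //; rewrite -e; apply/seteqP; split => p /= [h tp]; split => //; first by case: h.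
    by split => //; exact: tT.
  + move=> W [M sM ->].
    (* The direct image of a measurable set is treated as its preimage under [Tinv], which is
       isometric on the span. *)
    have iTinv f g : @Sigma_span R dY Y dO Omega Pr eta lam X ell X f -> @Sigma_span R dY Y dO Omega Pr eta lam X ell X g ->
        L2norm (Tinv X T f - Tinv X T g) = L2norm (f - g).
      move=> Kf Kg; have [h1 e1] := TinvP mX lT iT Ts Kf; have [h2 e2] := TinvP mX lT iT Ts Kg.
      by have h := ipisometric_dist iT h1 h2; rewrite e1 e2 in h; exact: esym h.
    have [M' sM' e] := @trace_preimage R n _ _ _ _ _ _ _ (Tinv X T) (@ps_total R n P E) iTinv
      (fun p tp => DS p.1 _ (eq_ind _ (fun K : set _ => K p.2) tp.2 _ (fE p.1))) M sM.
    exists M' => //; rewrite -e; apply/seteqP; split => [_ [p [Mp tp] <-]|p /= [Mp tp]].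
      have Fp : fock (L2on lam X) p.2 by apply: (FX p.1); rewrite -fF; exact: tp.2.
      split; last exact: tT.
      by rewrite /= (TinvK mX lT iT Ts Fp) -surjective_pairing.
    exists (p.1, Tinv X T p.2); first by split => //; exact: tTinv.
    have Sp : @Sigma_span R dY Y dO Omega Pr eta lam X ell X p.2 by apply: (DS p.1); rewrite -fE; exact: tp.2.
    by rewrite /= (TinvP mX lT iT Ts Sp).2 -surjective_pairing.
- by move=> a f Pa Df; apply: (Sigma_image mX lT iT Ts); exact: L2onS Df.
(* Uniqueness: [S] and [T] are bounded and linear on the fibre and agree on the exponential vectors,
   whose closed span is the fibre. *)
move=> a S Pa; rewrite fF => lS bS Sexp G; rewrite fock_L2on => FG.
have lTa : @iplinear _ (L2ip (fock_measure lam)) (L2ip Pr) (fock (L2on lam (D a))) T.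
  by move=> c f g Ff Fg; apply: lT; exact: (FX a).
have iTa : @ipisometric _ (L2ip (fock_measure lam)) (L2ip Pr) (fock (L2on lam (D a))) T.
  by move=> f g Ff Fg; apply: iT; exact: (FX a).
apply: (@ipspan_eq _ (L2ip (fock_measure lam)) (L2ip Pr) [set expvec xi | xi in L2on lam (D a)] S T
  _ (@fock_L2on_sub _ _ _ lam (D a)) lS lTa bS (ipisometric_bounded iTa)) => //.
  by rewrite fock_L2on.
move=> _ [xi Dxi <-]; rewrite Sexp//; apply/esym/(Sigma_image mX lT iT Ts); exact: L2onS Dxi.
Qed.
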